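(* Let $\varpi:\mathbb{N}\to\mathbb{R}_{+}$ be an arbitrary function increasing to infinity, and let $\gamma$ be a real number with $$\gamma\ge 4+[0;\overline{3,1}]+[0;2,\overline{1,3}]=4.62202\ldots.$$ Then there exists a real number $\alpha$ such that the inequality $$\left|\alpha-\frac{p}{q}\right|<\frac{1}{\gamma q^{2}}\left(1+\frac{\varpi(q)}{q^{2}}\right)$$ has infinitely many solutions in reduced fractions $\frac{p}{q}$ (with $p\in\mathbb{Z}$, $q\in\mathbb{Z}_{+}$), while the inequality $$\left|\alpha-\frac{p}{q}\right|<\frac{1}{\gamma q^{2}}\left(1-\frac{\varpi(q)}{q^{2}}\right)$$ has at most finitely many rational solutions $\frac{p}{q}$.
   Context: $[a_0;a_1,a_2,\ldots]$ denotes the regular (simple) continued fraction $a_0+\cfrac{1}{a_1+\cfrac{1}{a_2+\cdots}}$ with $a_0\in\mathbb{Z}$ and $a_i\in\mathbb{Z}_{+}$ for $i\ge1$; an overline denotes a block of partial quotients repeated periodically forever, e.g. $[0;\overline{3,1}]=[0;3,1,3,1,\ldots]$ and $[0;2,\overline{1,3}]=[0;2,1,3,1,3,\ldots]$. *)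

(* Defs.v *)
From mathcomp Require Import all_boot all_order all_algebra.
From mathcomp Require Import all_classical all_reals all_analysis.

Set Implicit Arguments.
Unset Strict Implicit.
Unset Printing Implicit Defensive.

Import Order.TTheory GRing.Theory Num.Theory.
Import numFieldNormedType.Exports.

Local Open Scope classical_set_scope.
Local Open Scope ring_scope.

(* [a i] is the partial quotient of index [i.+1], and [cf_tail R a n] is the
   finite continued fraction [0; a 0, ..., a n.-1] (which is 0 for n = 0). *)
Fixpoint cf_tail (R : realType) (a : nat -> nat) (n : nat) : R :=
  if n is n'.+1 then ((a 0%N)%:R + cf_tail R (fun i => a i.+1) n')^-1 else 0.

Definition cf_convergent (R : realType) (a0 : int) (a : nat -> nat) (n : nat)
  : R := a0%:~R + cf_tail R a n.

(* [lim] is meaningful here because the convergents converge whenever every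
   partial quotient [a i] is positive. *)
Definition cfrac (R : realType) (a0 : int) (a : nat -> nat) : R :=
  lim (cf_convergent R a0 a n @[n --> \oo]).

(* The word [pre] followed by [per] repeated forever; [per] must be nonempty. *)
Definition eventually_periodic (pre per : seq nat) (n : nat) : nat :=
  if (n < size pre)%N then nth 0%N pre n
  else nth 0%N per ((n - size pre) %% size per)%N.

Definition periodic_cfrac (R : realType) (a0 : int) (pre per : seq nat) : R :=
  cfrac R a0 (eventually_periodic pre per).

(* Main.v *)
(* If q_(n-1), q_n are denominators of consecutive convergents of
   alpha = [0; a_0, a_1, ...], then |alpha - p_n/q_n| = 1/(V_n q_n^2) with
   V_n = a_n + [0; a_(n+1), ...] + [0; a_(n-1), ..., a_0].  First gamma is written as
   N + x + y with N >= 4, where x and y have partial quotients at most 3 (only the first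
   one of y may be 4, and only when N >= 5).  Then alpha is the concatenation of ever longer
   blocks y_m ... y_1 N x_1 ... x_l.  At a letter N the number V_n is so close to gamma that
   |V_n - gamma| q_n^2 is bounded in terms of the letters before the block, hence is at most
   varpi(q_n) if m is chosen large after them; at the other letters V_n <= gamma; and by
   Legendre's theorem only convergents matter.

   The decomposition of gamma is a strengthening of Hall's theorem: with partial quotients at
   most 3, the sums x + y fill an interval starting at m + [0;2,1,3,1,3,...], where
   m = [0;3,1,3,1,...] is the smallest such number.  A sum z is located in the sum of two
   cylinders of words u, v, and one shows that u and v can be refined by one letter so that z
   stays in the sum.  The hulls of cylinders are intervals with gaps, so near the two ends of
   the hull sum ("corners") z need not be a sum at all; what survives refinement is that z is
   either beyond the first gap of one summand, or that at the corner the gaps of one summand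
   are bridged by the other one at all scales.  Up to scaling, the pair (u, v) is described by
   the ratios q_(n-1)/q_n of both words, the ratio of the lengths of the hulls, and two
   parities; the refinement step is checked by computation on finitely many boxes of these
   parameters. *)

From Stdlib Require Import BinInt Znat.
Require Import Defs.
From mathcomp Require Import all_boot all_order all_algebra.
From mathcomp Require Import all_classical all_reals all_analysis.
From mathcomp Require Import ssrZ zify ring lra.

Set Implicit Arguments.
Unset Strict Implicit.
Unset Printing Implicit Defensive.

Import Order.TTheory GRing.Theory Num.Theory.
Import numFieldNormedType.Exports.

Local Open Scope classical_set_scope.
Local Open Scope ring_scope.

(** The threshold is the right end of a gap in the set of sums: two first digits 3 give at most [2 *
    pt [:: 3]], about 0.613, while any other pair gives at least [m + pt [:: 2; 1]], about 0.622. On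
    the side of alpha there is little room: for N = 4, the letters other than N are controlled by
    V_n <= 3 + 47/29 = 4.6207, just below 4.6220. The usual argument for sums of Cantor sets asks
    that each gap be no longer than the opposite hull. At a corner it fails for hulls of equal size,
    because the gap between the digits 3 and 2 is about 28/23 times as long as the hull of the digit
    3. So z is accepted near a corner only with a reason, and the reason must again be available for
    the refined pair. The computation is finite because the parameters are bounded: the ratios
    q_(n-1)/q_n lie in [0, 1], and exchanging the two words puts the ratio of the hulls in [0, 1].
    Small ratios are ruled out by [link], which also prevents one word from growing while the other
    stays short. *)

(** * Continued fractions of words *)

(* With [cfmat w = ((n0, n1), (d0, d1))], the value of [0; w + x] is
   (n0 + n1 x) / (d0 + d1 x). *)
Fixpoint cfmat (w : seq nat) : (nat * nat) * (nat * nat) :=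
  if w is d :: w' then
    let: ((n0, n1), (d0, d1)) := cfmat w' in
    ((d0, d1), (d * d0 + n0, d * d1 + n1)%N)
  else ((0, 1), (1, 0))%N.
Definition cfn0 w := (cfmat w).1.1.
Definition cfn1 w := (cfmat w).1.2.
Definition cfd0 w := (cfmat w).2.1.
Definition cfd1 w := (cfmat w).2.2.

Definition positive (w : seq nat) := all (leq 1) w.

Lemma cfmat_cons d w :
  cfmat (d :: w) =
  ((cfd0 w, cfd1 w), (d * cfd0 w + cfn0 w, d * cfd1 w + cfn1 w)%N).
Proof. by rewrite /cfn0 /cfn1 /cfd0 /cfd1 /=; case: (cfmat w) => -[? ?] [? ?]. Qed.

Lemma cfn0_cons d w : cfn0 (d :: w) = cfd0 w.
Proof. by rewrite /cfn0 cfmat_cons. Qed.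
Lemma cfn1_cons d w : cfn1 (d :: w) = cfd1 w.
Proof. by rewrite /cfn1 cfmat_cons. Qed.
Lemma cfd0_cons d w : cfd0 (d :: w) = (d * cfd0 w + cfn0 w)%N.
Proof. by rewrite {1}/cfd0 cfmat_cons. Qed.
Lemma cfd1_cons d w : cfd1 (d :: w) = (d * cfd1 w + cfn1 w)%N.
Proof. by rewrite {1}/cfd1 cfmat_cons. Qed.

(** The matrix is built from the left, whereas refinement appends on the right. This recurrence
    identifies [cfd0] and [cfd1] with two consecutive denominators q_n and q_(n-1), and [cfn0],
    [cfn1] with the numerators. *)
Lemma cf_rcons w d :
  [/\ cfd0 (rcons w d) = (d * cfd0 w + cfd1 w)%N, cfd1 (rcons w d) = cfd0 w,
      cfn0 (rcons w d) = (d * cfn0 w + cfn1 w)%N & cfn1 (rcons w d) = cfn0 w].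
Proof.
elim: w => [|c w [IH1 IH2 IH3 IH4]] //=.
  by rewrite /cfd0 /cfd1 /cfn0 /cfn1 /= !muln1 !muln0 !addn0 ?add0n.
rewrite !(cfd0_cons, cfd1_cons, cfn0_cons, cfn1_cons) IH1 IH2 IH3 IH4; split=> //.
by rewrite !mulnDr !mulnA ![(c * d)%N]mulnC -!addnA; congr (_ + _)%N; rewrite addnCA.
Qed.

Lemma cfd0_rcons w d : cfd0 (rcons w d) = (d * cfd0 w + cfd1 w)%N.
Proof. by case: (cf_rcons w d). Qed.
Lemma cfd1_rcons w d : cfd1 (rcons w d) = cfd0 w.
Proof. by case: (cf_rcons w d). Qed.
Lemma cfn0_rcons w d : cfn0 (rcons w d) = (d * cfn0 w + cfn1 w)%N.
Proof. by case: (cf_rcons w d). Qed.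
Lemma cfn1_rcons w d : cfn1 (rcons w d) = cfn0 w.
Proof. by case: (cf_rcons w d). Qed.

Lemma positive_rcons w d : positive (rcons w d) = (0 < d)%N && positive w.
Proof. by rewrite /positive all_rcons. Qed.

Lemma cfd1_le_cfd0 w : positive w -> (cfd1 w <= cfd0 w)%N.
Proof.
elim/last_ind: w => // w d IH; rewrite positive_rcons => /andP[d0 /IH H].
by rewrite cfd0_rcons cfd1_rcons (leq_trans _ (leq_addr _ _)) // leq_pmull.
Qed.

Lemma cfd0_gt0 w : positive w -> (0 < cfd0 w)%N.
Proof.
elim/last_ind: w => // w d IH; rewrite positive_rcons => /andP[d0 /IH H].
by rewrite cfd0_rcons addn_gt0 muln_gt0 d0 H.
Qed.

Lemma cfd0_ge_size w : positive w -> (size w <= cfd0 w)%N.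
Proof.
elim/last_ind: w => // w d; case/lastP: w => [|w e] IH.
  by rewrite /= andbT /cfd0 /= muln1 addn0.
rewrite positive_rcons => /andP[d0 pw]; move: (IH pw).
rewrite !size_rcons => le_w; rewrite cfd0_rcons cfd1_rcons.
have: (0 < cfd0 w)%N by move: pw; rewrite positive_rcons => /andP[_ /cfd0_gt0].
move=> gt_w; apply: (@leq_trans (cfd0 (rcons w e)).+1); first by rewrite ltnS.
by rewrite -addn1 leq_add // leq_pmull.
Qed.

(** The matrix of a word is a product of symmetric matrices, one for each letter; reversal
    transposes it and so exchanges q_(n-1) with p_n. *)
Lemma cf_rev w :
  [/\ cfd0 (rev w) = cfd0 w, cfd1 (rev w) = cfn0 w, cfn0 (rev w) = cfd1 w
    & cfn1 (rev w) = cfn1 w].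
Proof.
elim: w => [|d w [IH1 IH2 IH3 IH4]] //; rewrite rev_cons.
rewrite cfd0_rcons cfd1_rcons cfn0_rcons cfn1_rcons.
by rewrite cfd0_cons cfd1_cons cfn0_cons cfn1_cons IH1 IH2 IH3 IH4.
Qed.

Lemma cfd0_le_4cfd1 w : w != [::] -> all (leq^~ 3) w -> positive w ->
  (cfd0 w <= 4 * cfd1 w)%N.
Proof.
case/lastP: w => // w d _; rewrite all_rcons positive_rcons.
move=> /andP[d3 _] /andP[_ /cfd1_le_cfd0 h].
rewrite cfd0_rcons cfd1_rcons mulSn addnC leq_add //.
by rewrite leq_mul2r d3 orbT.
Qed.

Section CfVal.
Variable R : realFieldType.
Implicit Types (w u : seq nat) (x y : R).

Definition cfval w x : R := foldr (fun d y => (d%:R + y)^-1) x w.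
Definition den w x : R := (cfd0 w)%:R + (cfd1 w)%:R * x.
Definition num w x : R := (cfn0 w)%:R + (cfn1 w)%:R * x.

Lemma cfval_cat u w x : cfval (u ++ w) x = cfval u (cfval w x).
Proof. by rewrite /cfval foldr_cat. Qed.

Lemma den_nil x : den [::] x = 1.
Proof. by rewrite /den /cfd0 /cfd1 /= mul0r addr0. Qed.

Lemma den_cons d w x : den (d :: w) x = d%:R * den w x + num w x.
Proof. by rewrite /den /num cfd0_cons cfd1_cons !natrD !natrM; ring. Qed.

Lemma num_cons d w x : num (d :: w) x = den w x.
Proof. by rewrite /den /num cfn0_cons cfn1_cons. Qed.

Lemma num_ge0 w x : 0 <= x -> 0 <= num w x.
Proof. by move=> x0; rewrite addr_ge0 // mulr_ge0. Qed.

Lemma den_gt0 w x : positive w -> 0 <= x -> 0 < den w x.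
Proof. by move=> pw x0; rewrite ltr_wpDr ?mulr_ge0 // ltr0n cfd0_gt0. Qed.

Lemma den_ge_cfd0 w x : 0 <= x -> (cfd0 w)%:R <= den w x.
Proof. by move=> x0; rewrite lerDl mulr_ge0. Qed.

Lemma cfvalE w x : positive w -> 0 <= x -> cfval w x = num w x / den w x.
Proof.
elim: w => [_ _|d w IH /andP[d0 pw] x0].
  by rewrite den_nil /num /cfn0 /cfn1 /= mul1r add0r divr1.
have dn : den w x != 0 by rewrite gt_eqF ?den_gt0.
have dn' : den (d :: w) x != 0 by rewrite gt_eqF // den_gt0 //= d0.
rewrite /= IH // num_cons den_cons; rewrite den_cons in dn'; field.
by rewrite dn dn'.
Qed.

Lemma cfval_ge0 w x : positive w -> 0 <= x -> 0 <= cfval w x.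
Proof. by move=> pw x0; rewrite cfvalE // divr_ge0 ?num_ge0 // ltW ?den_gt0. Qed.

Lemma cfval_le1 w x : positive w -> 0 <= x <= 1 -> cfval w x <= 1.
Proof.
case: w => [_ /andP[]//|d w /andP[d0 pw] /andP[x0 _]].
rewrite /= invf_le1; last by rewrite ltr_wpDr ?cfval_ge0 // ltr0n.
by rewrite ler_wpDr ?cfval_ge0 // ler1n.
Qed.

(** Cocycle identity of composed Möbius maps. It separates the distortion due to a prefix from that
    due to the letters appended later. *)
Lemma den_cat u w x : positive u -> positive w -> 0 <= x ->
  den (u ++ w) x = den u (cfval w x) * den w x.
Proof.
move=> pu pw x0; have dw : den w x != 0 by rewrite gt_eqF ?den_gt0.
rewrite cfvalE //; suff: den (u ++ w) x = den u (num w x / den w x) * den w x /\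
   num (u ++ w) x = num u (num w x / den w x) * den w x by case.
elim: u pu => [_|d u IH /andP[d0 pu]] /=.
  split; first by rewrite den_nil mul1r.
  by rewrite {2}/num /cfn0 /cfn1 /= mul1r add0r divfK.
by have [E1 E2] := IH pu; rewrite !den_cons !num_cons E1 E2; split; ring.
Qed.

(** The Möbius map of a word has determinant 1 or -1 according to the length; this sign is the
    source of all parities below. *)
Lemma cfvalB w x y : positive w -> 0 <= x -> 0 <= y ->
  cfval w x - cfval w y = (-1) ^+ size w * (x - y) / (den w x * den w y).
Proof.
move=> + x0 y0; elim: w => [_|d w IH /andP[d0 pw]].
  by rewrite !den_nil /= expr0 mulr1 divr1 mul1r.
have dx : den w x != 0 by rewrite gt_eqF ?den_gt0.
have dy : den w y != 0 by rewrite gt_eqF ?den_gt0.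
have dx' : den (d :: w) x != 0 by rewrite gt_eqF // den_gt0 //= d0.
have dy' : den (d :: w) y != 0 by rewrite gt_eqF // den_gt0 //= d0.
have E z : 0 <= z -> den w z != 0 -> den (d :: w) z = (d%:R + cfval w z) * den w z.
  by move=> z0 dz; rewrite den_cons cfvalE // mulrDl divfK.
move: dx' dy'; rewrite !E // !mulf_eq0 !negb_or => /andP[ex _] /andP[ey _].
have {}IH := IH pw; rewrite /= exprS.
have -> : (d%:R + cfval w x)^-1 - (d%:R + cfval w y)^-1 =
  - (cfval w x - cfval w y) / ((d%:R + cfval w x) * (d%:R + cfval w y)).
  by field; rewrite ex ey.
by rewrite IH; field; rewrite ex ey dx dy.
Qed.

Lemma dist_cfval w x y : positive w -> 0 <= x -> 0 <= y ->
  `|cfval w x - cfval w y| = `|x - y| / (den w x * den w y).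
Proof.
move=> pw x0 y0; rewrite cfvalB // normrM normrM normrX normrN1 expr1n mul1r.
by rewrite normfV [`|den w x * _|]ger0_norm // mulr_ge0 // ltW // den_gt0.
Qed.

Lemma dist_cfval_le w x y : positive w -> 0 <= x <= 1 -> 0 <= y <= 1 ->
  `|cfval w x - cfval w y| <= ((cfd0 w)%:R ^+ 2)^-1.
Proof.
move=> pw /andP[x0 x1] /andP[y0 y1]; rewrite dist_cfval //.
have d0 : 0 < (cfd0 w)%:R :> R by rewrite ltr0n cfd0_gt0.
have Dx : (cfd0 w)%:R <= den w x :> R by rewrite den_ge_cfd0.
have Dy : (cfd0 w)%:R <= den w y :> R by rewrite den_ge_cfd0.
have le1 : `|x - y| <= 1 by rewrite ler_norml; lra.
rewrite -[leRHS]mul1r; apply: ler_pM => //; first by rewrite invr_ge0; nra.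
by rewrite lef_pV2 ?posrE; nra.
Qed.

Lemma cfd1_cfd0 w : positive w -> (cfd1 w)%:R / (cfd0 w)%:R = cfval (rev w) 0.
Proof.
move=> pw; rewrite cfvalE ?/positive ?all_rev // /num /den !mulr0 !addr0.
by have [-> _ -> _] := cf_rev w.
Qed.
End CfVal.

(** * Certified refinement of pairs of cylinders *)

Section Checker.
Local Open Scope Z_scope.

(* Fixed-point scales of points, of the ratios q_(n-1)/q_n, and of the ratio of two hulls. *)
Definition pscale : Z := 65536.
Definition tscale : Z := 256.
Definition wscale : Z := 4096.

(* Bounds for [pscale * pt w]; 17285 and 17286 enclose [pscale * m]. *)
Fixpoint enclose (w : seq nat) : Z * Z :=
  if w is d :: w' then
    let: (l, h) := enclose w' in
    (pscale * pscale / (Z.of_nat d * pscale + h),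
     pscale * pscale / (Z.of_nat d * pscale + l) + 1)
  else (17285, 17286).

Inductive trie := Nil | Node of Z * Z & trie & trie & trie.

Fixpoint mktrie (n : nat) (w : seq nat) : trie :=
  if n is n'.+1 then
    Node (enclose w) (mktrie n' (rcons w 1%N)) (mktrie n' (rcons w 2%N))
      (mktrie n' (rcons w 3%N))
  else Nil.

(** A table of the enclosures of the words of length at most 4, so that the tests look them up
    instead of dividing again. *)
Definition trie5 := Eval vm_compute in mktrie 5 [::].

Fixpoint find_bounds (t : trie) (w : seq nat) : option (Z * Z) :=
  if t is Node b t1 t2 t3 then
    match w with
    | [::] => Some b
    | 1%N :: w' => find_bounds t1 w'
    | 2%N :: w' => find_bounds t2 w'
    | 3%N :: w' => find_bounds t3 w'
    | _ => None
    end
  else None.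

Definition bounds (w : seq nat) : Z * Z :=
  if find_bounds trie5 w is Some b then b else enclose w.

Fixpoint eq_word (u v : seq nat) : bool :=
  match u, v with
  | [::], [::] => true
  | d :: u', e :: v' => PeanoNat.Nat.eqb d e && eq_word u' v'
  | _, _ => false
  end.

(* Scaled ranges of the ratios q_(n-1)/q_n of two words, and weights bounding the ratio of the
   lengths of their hulls; see [in_half]. *)
Record halfbox := Halfbox { lo1 : Z; hi1 : Z; lo2 : Z; hi2 : Z; wt1 : Z; wt2 : Z }.

Definition lin t x := tscale * pscale + t * x.
Definition linl t x := Z.shiftr (lin t x) 11.
Definition linh t x := Z.shiftr (lin t x) 11 + 1.

(** Input: [kd * hull_den u <= kn * hull_den v]. The weights absorb the linear factors at m and 3 m
    by which [den_test] would have to divide; [wt1] is rounded down and [wt2] up. *)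
Definition mkhalf a0 a1 b0 b1 kn kd :=
  let: (ml, mh) := bounds [::] in let: (Ml, Mh) := bounds [:: 1%N] in
  Halfbox a0 a1 b0 b1
    (Z.shiftr (kd * (linl a1 ml * linl a0 Ml)) 24)
    (Z.shiftr (kn * (linh b0 mh * linh b1 Mh)) 24 + 1).

(* (1 + t a)/(1 + t b) is monotone in t, so it suffices to test the extreme values of the
   parameters; the two 11-bit shifts in [linl] and [linh] cancel. *)
Definition den_test h cA (xa xb : Z * Z) cB (ya yb : Z * Z) :=
  (cB * wt2 h) * (linh (hi1 h) xa.2 * linh (lo1 h) xb.2)
  <=? (cA * wt1 h) * (linl (lo2 h) ya.1 * linl (hi2 h) yb.1).

Definition sort_bounds (X Y : Z * Z) := if X.1 <=? Y.1 then (X, Y) else (Y, X).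

(* Sufficient for [n * |v x y'| <= d * |u x x'|], where [|u a b|] is the distance of the points
   of the cylinder [u] with tails [a] and [b]. *)
Definition len_test h n d x x' y y' :=
  let: (xa, xb) := sort_bounds (bounds x) (bounds x') in
  let: (ya, yb) := sort_bounds (bounds y) (bounds y') in
  [&& 0 <=? xb.1 - xa.2, ya.2 <=? yb.2
    & den_test h (d * (xb.1 - xa.2)) xa xb (n * (yb.2 - ya.1)) ya yb].

(* [par] tells whether the two words have lengths of opposite parities. *)
Record box := Box { par : bool; hA : halfbox; hB : halfbox }.

Definition mkbox p a0 a1 b0 b1 w0 w1 :=
  Box p (mkhalf a0 a1 b0 b1 w1 wscale) (mkhalf b0 b1 a0 a1 wscale w0).

Definition len_testA bx n d x x' y y' := len_test (hA bx) n d x x' y y'.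
Definition len_testB bx n d x x' y y' := len_test (hB bx) n d y y' x x'.

Definition link_test bx u v :=
  len_testA bx 6 5 u (u ++ [:: 1%N]) (v ++ [:: 2%N]) (v ++ [:: 1; 1]%N) &&
  len_testB bx 6 5 (u ++ [:: 2%N]) (u ++ [:: 1; 1]%N) v (v ++ [:: 1%N]).

(* The factor 1001/1000 makes the refuted inequality of [link] strict. *)
Definition unlinked bx :=
  len_testB bx 5005 6000 [::] [:: 1%N] [:: 2%N] [:: 1; 1]%N ||
  len_testA bx 5005 6000 [:: 2%N] [:: 1; 1]%N [::] [:: 1%N].

Definition den_bound (U : seq nat) x : Z :=
  Z.of_nat (cfd0 U) * pscale + Z.of_nat (cfd1 U) * x.

(* den U <= 0.91 den V, hence the squares have ratio less than 0.8282. *)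
Definition den_ratio_test h U V x :=
  let l := Z.shiftr (91 * den_bound V (bounds x).1) 12 in
  let r := Z.shiftr (100 * den_bound U (bounds x).2) 12 + 1 in
  let bU := bounds (U ++ x) in let bV := bounds (V ++ x) in
  den_test h (l * l) bU bU (r * r) bV bV.

(** The empty zoom word is tested directly. For the others the tails lie between m and [pt [:: 3]],
    and an affine comparison of denominators holds in between once it holds at both ends. *)
Definition expands_test h U V :=
  [&& len_test h 1 1 U (U ++ [:: 3%N]) (V ++ [:: 3%N]) (V ++ [:: 2; 1]%N),
      den_ratio_test h U V [::] & den_ratio_test h U V [:: 3%N]].

(* The words that have to be appended to the current pair of words. *)
Definition germ := (seq nat * seq nat)%type.

Definition eq_germ (g g' : germ) := eq_word g.1 g'.1 && eq_word g.2 g'.2.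

Definition corner_cert bx (g : germ) :=
  expands_test (hA bx) g.1 g.2 || expands_test (hB bx) g.2 g.1.

(* The words leading to points near the corner [0; 3, 1, 3, 1, ...]. *)
Fixpoint zoom_word (w : seq nat) : bool :=
  match w with
  | [::] => true
  | 3%N :: w' => match w' with 1%N :: w'' => zoom_word w'' | _ => zoom_word w' end
  | _ => false
  end.

Fixpoint strip (u v : seq nat) : option (seq nat) :=
  match u, v with
  | [::], _ => Some v
  | d :: u', e :: v' => if PeanoNat.Nat.eqb d e then strip u' v' else None
  | _, _ => None
  end.

(** The bridging condition quantifies over all zoom words, hence survives appending the same zoom
    word to both summands. *)
Definition inherits (g G : germ) :=
  match strip G.1 g.1, strip G.2 g.2 with
  | Some w, Some w' => eq_word w w' && zoom_word w
  | _, _ => false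
  end.

(* Why a point may be near a corner: the gaps are bridged by computation ([Cert]) or by
   assumption, by the first or by the second summand ([Plus], [Minus]), or the point lies beyond
   the first gap of one of the summands ([Cut1], [Cut2]). *)
Inductive corner_option := Cert | Plus | Minus | Cut1 | Cut2.

Definition is_full o := match o with Cut1 | Cut2 => false | _ => true end.

Definition end1 (b : bool) : seq nat := if b then [:: 1%N] else [::].

(** The extreme tails are m and 3 m = [pt [:: 1]], and each letter reverses the order. Low and high
    refer to the order induced by the first word of the current pair; [p] corrects for the second
    word. *)
Definition low_corner (p : bool) (c : germ) : germ :=
  (c.1 ++ end1 (odd (size c.1)), c.2 ++ end1 (p (+) odd (size c.2))).
Definition high_corner (p : bool) (c : germ) : germ :=
  (c.1 ++ end1 (~~ odd (size c.1)), c.2 ++ end1 (~~ (p (+) odd (size c.2)))).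

(** Seen from the tail m, the first gap runs from [pt [:: 3]] to [pt [:: 2; 1]]; this is its far
    end. *)
Definition cut1 (g : germ) : germ := (g.1 ++ [:: 2; 1]%N, g.2).
Definition cut2 (g : germ) : germ := (g.1, g.2 ++ [:: 2; 1]%N).

Definition corner_options bx g :=
  if corner_cert bx g then [:: Cert] else
    (if len_testB bx 1001 1000 g.1 (g.1 ++ [:: 3%N]) (g.2 ++ [:: 3%N]) (g.2 ++ [:: 2; 1]%N)
     then [::] else [:: Plus]) ++
    (if len_testA bx 1001 1000 (g.1 ++ [:: 3%N]) (g.1 ++ [:: 2; 1]%N) g.2 (g.2 ++ [:: 3%N])
     then [::] else [:: Minus]) ++ [:: Cut1; Cut2].

(* [3; 1] followed by m is m. *)
Definition canon (w : seq nat) := if eq_word w [:: 3; 1]%N then [::] else w.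

Definition cmp_word (x y : seq nat) : option comparison :=
  if eq_word x y then Some Eq
  else if (bounds x).2 <=? (bounds y).1 then Some Lt
  else if (bounds y).2 <=? (bounds x).1 then Some Gt else None.

Definition flip_order (p : bool) o := match o with
  | Some Lt => if p then Some Gt else Some Lt
  | Some Gt => if p then Some Lt else Some Gt
  | _ => o end.

(** Sufficient for [q] to precede [r] in the order of the first word. When the two summands move in
    opposite directions, the lengths of the moves are compared. *)
Definition pos_test bx (q r : germ) :=
  let: (x, y) := (canon q.1, canon q.2) in let: (x', y') := (canon r.1, canon r.2) in
  match cmp_word x x', flip_order (par bx) (cmp_word y y') with
  | Some Lt, Some Lt | Some Lt, Some Eq | Some Eq, Some Lt | Some Eq, Some Eq => true
  | Some Lt, Some Gt => len_testA bx 1 1 x x' y y'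
  | Some Gt, Some Lt => len_testB bx 1 1 x x' y y'
  | _, _ => false
  end.

(* The comparison given directly by the hypothesis that [u] bridges the first gap of [v], or
   conversely. *)
Definition hyp_test bx oL (q r : germ) :=
  [&& ~~ par bx, eq_germ r ([:: 3%N], [:: 3%N])
    & match oL with
      | Plus => eq_germ q ([:: 3; 1]%N, [:: 2; 1]%N)
      | Minus => eq_germ q ([:: 2; 1]%N, [:: 3; 1]%N)
      | _ => false
      end].

(** Passing any one of these points gives the corner condition at [g]; [full] means that the gaps at
    [g] are known to be bridged. *)
Definition child_points (full : bool) g :=
  if full then [:: g] else [:: cut1 g; cut2 g].
Definition option_point o g := match o with Cut1 => cut1 g | Cut2 => cut2 g | _ => g end.

Definition child_info := (germ * (bool * bool * bool))%type.

Definition child_infos bx (l : seq germ) : seq child_info :=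
  [seq (c, let b := link_test bx c.1 c.2 in
           (b, b && corner_cert bx (low_corner (par bx) c),
            b && corner_cert bx (high_corner (par bx) c)))
  | c <- l].

Fixpoint find_info (c : germ) (l : seq child_info) : bool * bool * bool :=
  if l is (c', i) :: l' then if eq_germ c c' then i else find_info c l'
  else (false, false, false).

Definition full_corner p oL oR (crt : bool) g :=
  [|| crt, is_full oL && inherits g (low_corner p ([::], [::]))
    | is_full oR && inherits g (high_corner p ([::], [::]))].

(** All of [prevs] are points that z has passed. The child [c] has to start no later than one of
    them. Then either z has not passed some end point of [c], and [c] is a valid refinement, or z
    has passed all of them and they become the new [prevs]. The high corner of the parent closes the
    chain. *)
Fixpoint check_chain bx oL oR (inf : seq child_info) (prevs : seq germ) (l : seq germ) : bool :=
  if l is c :: l' then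
    let: (lk, cl, ch) := find_info c inf in
    lk &&
    (let p := par bx in
     let gl := low_corner p c in let gh := high_corner p c in
     let ss := child_points (full_corner p oL oR cl gl) gl in
     let es := child_points (full_corner p oL oR ch gh) gh in
     has (fun s => has (fun e => pos_test bx s e || hyp_test bx oL s e) prevs) ss &&
     (if l' is [::] then has (pos_test bx (option_point oR (high_corner p ([::], [::])))) es
      else check_chain bx oL oR inf es l'))
  else false.

(* The hulls of the sums of the listed refinements, from one corner to the other, overlap for
   suitable parameters. *)
Definition chains (p : bool) : seq (seq germ) :=
  let o := [::] : seq nat in let i := [:: 1%N] in let j := [:: 2%N] in let k := [:: 3%N] in
  if p then
   [:: [:: (k, o); (j, o); (i, o)];
       [:: (k, i); (j, i); (i, o)];
       [:: (o, i); (i, o)];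
       [:: (k, i); (j, o); (i, o)];
       [:: (k, i); (j, i); (k, k); (j, j); (i, o)]]
  else
   [:: [:: (k, k); (k, j); (j, j); (i, o)];
       [:: (j, k); (j, j); (o, i)];
       [:: (k, j); (j, j); (i, o)];
       [:: (k, k); (k, j); (j, o); (i, o)];
       [:: (k, o); (j, o); (i, o)];
       [:: (k, k); (k, j); (j, k); (k, i); (i, o)];
       [:: (k, k); (j, k); (j, j); (i, o)]].

Fixpoint mem_germ (g : germ) (l : seq germ) :=
  if l is g' :: l' then eq_germ g g' || mem_germ g l' else false.
Fixpoint add_germs (l1 l2 : seq germ) :=
  if l1 is g :: l1' then
    let l := add_germs l1' l2 in if mem_germ g l then l else g :: l
  else l2.

(** The reasons at the two corners are supplied by the invariant, not chosen, so every combination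
    of them must be served by some chain. *)
Definition check_leaf bx (cs : seq (seq germ)) :=
  let p := par bx in
  let GL := low_corner p ([::], [::]) in
  let inf := child_infos bx (foldr add_germs [::] cs) in
  let oRs := corner_options bx (high_corner p ([::], [::])) in
  all (fun oL => all (fun oR =>
    has (check_chain bx oL oR inf [:: option_point oL GL]) cs) oRs) (corner_options bx GL).

Fixpoint select_chains (k : nat) (cs : seq (seq germ)) : seq (seq germ) :=
  if cs is c :: cs' then
    if odd k then c :: select_chains k./2 cs' else select_chains k./2 cs'
  else [::].

Definition midpoint a b := Z.div2 (a + b).

(** The hull ratio is bisected when its width relative to [w1] is at least a quarter of both slope
    widths, these being measured in units of [tscale]. *)
Definition split_axis a0 a1 b0 b1 w0 w1 : nat :=
  let da := a1 - a0 in let db := b1 - b0 in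
  let dw := (w1 - w0) * 1024 in
  if (w1 * da <=? dw) && (w1 * db <=? dw) then 2%N
  else if db <=? da then 0%N else 1%N.

(* The code [l] lists the tree of boxes in preorder: 0 bisects the box, 1 claims that no linked
   pair has these parameters, and k + 2 claims that the chains selected by the binary digits of
   k + 1 suffice. *)
Fixpoint check_cover (n : nat) (l : seq nat) p a0 a1 b0 b1 w0 w1 : option (seq nat) :=
  if n is n'.+1 then
    match l with
    | 0%N :: l =>
        match split_axis a0 a1 b0 b1 w0 w1 with
        | 0%N => let c := midpoint a0 a1 in
           if check_cover n' l p a0 c b0 b1 w0 w1 is Some l then check_cover n' l p c a1 b0 b1 w0 w1
           else None
        | 1%N => let c := midpoint b0 b1 in
           if check_cover n' l p a0 a1 b0 c w0 w1 is Some l then check_cover n' l p a0 a1 c b1 w0 w1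
           else None
        | _ => let c := midpoint w0 w1 in
           if check_cover n' l p a0 a1 b0 b1 w0 c is Some l then check_cover n' l p a0 a1 b0 b1 c w1
           else None
        end
    | 1%N :: l => if unlinked (mkbox p a0 a1 b0 b1 w0 w1) then Some l else None
    | k.+2 :: l =>
        if check_leaf (mkbox p a0 a1 b0 b1 w0 w1) (select_chains k.+1 (chains p)) then Some l else
          None
    | [::] => None
    end
  else None.
End Checker.

(** A certificate in the code of [check_cover]; nothing is assumed about it, since the computation
    replays every claim. *)
Definition cover_opposite : seq nat := [::
  0; 0; 0; 1; 0; 1; 0; 1; 0; 0; 0; 1; 0; 1; 1; 0; 1; 0; 1; 1; 1; 0; 0; 0; 0; 0; 0; 0; 0; 0; 0;
  0; 1; 2; 0; 1; 2; 0; 0; 1; 2; 0; 1; 2; 2; 0; 2; 2; 0; 0; 0; 0; 0; 1; 2; 0; 1; 2; 0; 0; 1; 2;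
  0; 1; 2; 2; 0; 2; 2; 0; 9; 0; 2; 2; 0; 2; 0; 0; 0; 0; 9; 2; 9; 0; 0; 0; 2; 2; 2; 0; 9; 0; 2;
  2; 2; 0; 0; 0; 0; 0; 0; 0; 0; 1; 2; 0; 1; 2; 0; 0; 1; 0; 2; 2; 0; 1; 2; 2; 0; 2; 2; 0; 0; 0;
  0; 0; 1; 0; 2; 2; 0; 1; 2; 0; 0; 1; 0; 0; 0; 1; 2; 2; 0; 0; 1; 2; 2; 0; 1; 2; 2; 0; 0; 2; 2;
  2; 2; 0; 0; 2; 2; 2; 0; 0; 0; 9; 9; 0; 0; 9; 0; 9; 0; 0; 9; 2; 9; 9; 0; 0; 0; 9; 2; 9; 0; 2;
  0; 9; 0; 2; 2; 0; 0; 9; 0; 9; 9; 17; 0; 0; 0; 0; 17; 0; 17; 0; 17; 17; 17; 0; 0; 0; 0; 0; 0;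
  3; 0; 0; 5; 3; 3; 3; 3; 0; 0; 5; 0; 0; 0; 3; 3; 3; 5; 0; 5; 3; 0; 0; 0; 3; 0; 0; 0; 3; 0; 0;
  0; 3; 0; 17; 3; 17; 3; 17; 3; 0; 3; 0; 17; 3; 3; 0; 3; 0; 17; 3; 0; 0; 0; 5; 0; 0; 0; 5; 0; 3;
  5; 3; 5; 0; 5; 3; 5]%N.

Definition cover_same : seq nat := [::
  0; 0; 0; 1; 0; 1; 0; 1; 0; 0; 0; 1; 0; 1; 1; 0; 1; 0; 1; 1; 1; 0; 0; 0; 0; 0; 0; 0; 0; 0; 0;
  0; 1; 17; 17; 0; 0; 1; 17; 17; 17; 0; 17; 17; 0; 0; 0; 0; 0; 1; 17; 17; 17; 17; 17; 0; 0; 0;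
  0; 0; 0; 17; 0; 0; 17; 17; 17; 0; 17; 0; 9; 17; 17; 0; 0; 0; 0; 0; 0; 0; 9; 17; 9; 9; 17; 0;
  9; 0; 0; 17; 9; 9; 9; 0; 17; 17; 0; 0; 0; 0; 17; 9; 9; 17; 0; 9; 9; 0; 17; 17; 0; 17; 0; 9;
  17; 0; 0; 0; 0; 0; 0; 17; 17; 17; 17; 0; 0; 17; 17; 17; 17; 17; 0; 0; 0; 0; 0; 0; 0; 9; 0; 0;
  0; 9; 17; 9; 9; 9; 9; 0; 0; 0; 0; 17; 17; 17; 0; 0; 0; 0; 9; 17; 9; 9; 0; 17; 9; 0; 0; 9; 17;
  9; 0; 0; 0; 9; 9; 9; 9; 0; 0; 9; 9; 9; 0; 0; 0; 0; 17; 17; 17; 0; 0; 0; 0; 0; 0; 17; 9; 9; 17;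
  0; 9; 9; 9; 0; 17; 17; 0; 17; 9; 0; 0; 0; 0; 0; 9; 0; 0; 9; 9; 9; 9; 9; 0; 0; 0; 9; 9; 0; 9;
  0; 9; 9; 9; 0; 0; 9; 9; 9; 0; 0; 0; 0; 0; 0; 0; 0; 9; 0; 0; 9; 9; 9; 0; 9; 33; 9; 0; 0; 0; 0;
  33; 0; 0; 9; 33; 33; 33; 33; 0; 0; 0; 0; 9; 9; 9; 33; 33; 0; 0; 0; 0; 9; 33; 9; 9; 0; 0; 0;
  33; 0; 0; 0; 33; 0; 2; 2; 0; 0; 2; 2; 2; 33; 0; 0; 0; 33; 0; 9; 0; 2; 2; 33; 0; 0; 2; 6; 0;
  33; 0; 33; 0; 2; 2; 33; 0; 0; 9; 0; 0; 0; 9; 0; 33; 9; 33; 0; 9; 9; 0; 9; 33; 0; 0; 0; 0; 0;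
  0; 33; 0; 0; 0; 33; 0; 2; 2; 0; 2; 0; 2; 2; 33; 0; 0; 0; 33; 0; 0; 2; 2; 2; 33; 0; 0; 2; 2; 0;
  2; 0; 2; 2; 33; 0; 0; 0; 0; 0; 0; 2; 0; 2; 2; 2; 0; 0; 33; 2; 2; 0; 0; 2; 8; 0; 2; 2; 0; 0; 0;
  8; 6; 0; 0; 0; 2; 2; 2; 2; 0; 8; 0; 2; 8; 0; 0; 33; 0; 0; 2; 2; 0; 33; 2; 0; 0; 0; 2; 0; 2; 0;
  2; 2; 33; 0; 0; 0; 0; 2; 2; 2; 2; 0; 2; 0; 2; 0; 2; 2; 0; 0; 0; 0; 0; 6; 0; 33; 0; 2; 2; 0; 0;
  6; 6; 0; 2; 6; 0; 0; 6; 0; 0; 0; 2; 2; 2; 6; 0; 6; 0; 6; 6; 0; 0; 33; 0; 0; 2; 0; 2; 2; 33; 0;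
  0; 0; 33; 0; 33; 0; 2; 2; 33; 0; 0; 0; 0; 2; 2; 2; 6; 0; 2; 0; 2; 0; 2; 2; 0; 0; 0; 0; 6; 0;
  6; 6; 6; 6; 0; 0; 0; 0; 2; 6; 0; 2; 0; 2; 2; 0; 6; 0; 2; 6; 0; 0; 0; 6; 6; 0; 2; 6; 0; 6; 6;
  0; 0; 0; 33; 33; 0; 0; 33; 0; 33; 0; 0; 2; 2; 33; 33; 0; 33; 0; 0; 0; 33; 0; 0; 2; 0; 0; 2; 2;
  2; 33; 0; 0; 0; 0; 2; 0; 2; 2; 0; 2; 2; 33; 0; 0; 2; 6; 0; 0; 2; 0; 2; 2; 0; 0; 2; 2; 2; 0;
  33; 33; 0; 0; 0; 0; 0; 0; 0; 0; 8; 0; 2; 2; 8; 8; 0; 0; 0; 0; 2; 0; 0; 2; 2; 2; 2; 0; 0; 0; 0;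
  2; 2; 2; 2; 0; 2; 0; 0; 2; 2; 2; 0; 0; 8; 0; 0; 0; 2; 2; 2; 2; 8; 0; 8; 0; 0; 0; 8; 0; 0; 0;
  2; 2; 2; 2; 8; 8; 0; 0; 0; 8; 0; 0; 0; 7; 0; 0; 0; 7; 0; 0; 7; 7; 7; 5; 7; 6; 7; 0; 8; 6; 72;
  0; 0; 0; 0; 0; 0; 0; 33; 2; 33; 0; 2; 2; 0; 0; 0; 2; 0; 2; 0; 2; 2; 2; 0; 0; 0; 0; 2; 2; 2; 2;
  0; 2; 0; 2; 2; 0; 0; 33; 0; 0; 33; 2; 33; 0; 33; 0; 2; 0; 2; 2; 0; 0; 0; 0; 0; 2; 0; 0; 2; 2;
  2; 2; 0; 0; 0; 0; 2; 2; 2; 2; 0; 2; 0; 0; 2; 2; 2; 0; 0; 8; 0; 0; 0; 2; 2; 2; 2; 8; 0; 0; 0;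
  2; 0; 2; 2; 2; 0; 0; 0; 2; 0; 0; 2; 2; 2; 2; 0; 0; 0; 0; 2; 2; 2; 8; 0; 2; 0; 0; 2; 2; 2; 0;
  0; 0; 0; 0; 0; 2; 8; 0; 0; 2; 0; 2; 2; 0; 0; 2; 2; 2; 8; 0; 0; 6; 0; 8; 6; 8; 0; 0; 0; 2; 33;
  0; 0; 0; 2; 0; 2; 2; 0; 0; 2; 2; 2; 0; 2; 0; 2; 0; 2; 2; 0; 0; 0; 0; 2; 2; 0; 0; 2; 0; 2; 2;
  2; 0; 2; 0; 2; 0; 2; 2; 0; 8; 0; 0; 0; 2; 2; 2; 8; 0; 8; 0; 0; 0; 8; 0; 0; 2; 2; 8; 8; 8; 0;
  72; 0; 0; 0; 0; 0; 0; 8; 0; 0; 0; 2; 2; 2; 2; 8; 8; 0; 0; 0; 0; 2; 0; 0; 2; 2; 2; 0; 2; 2; 0;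
  0; 0; 0; 2; 2; 2; 2; 0; 2; 2; 0; 0; 8; 0; 2; 8; 8; 0; 8; 0; 0; 0; 8; 0; 0; 0; 2; 2; 2; 8; 8;
  8; 8]%N.

(** The root box in fixed point: both slopes in [0, 1] and the ratio of [hull_den] in [0, 1]. *)
Lemma check_cover_opposite :
  check_cover 20 cover_opposite true Z0 tscale Z0 tscale Z0 wscale = Some [::].
Proof. by vm_compute. Qed.

Lemma check_cover_same : check_cover 20 cover_same false Z0 tscale Z0 tscale Z0 wscale = Some [::].
Proof. by vm_compute. Qed.

(** * Scaled integers as elements of an ordered field *)

Section ZR.
Variable R : realFieldType.

Definition ZR (z : Z) : R := (int_of_Z z)%:~R.

Lemma ZRD a b : ZR (Z.add a b) = ZR a + ZR b.
Proof. by rewrite -[Z.add a b]/(a + b) /ZR rmorphD intrD. Qed.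
Lemma ZRM a b : ZR (Z.mul a b) = ZR a * ZR b.
Proof. by rewrite -[Z.mul a b]/(a * b) /ZR rmorphM intrM. Qed.
Lemma ZRB a b : ZR (Z.sub a b) = ZR a - ZR b.
Proof.
by rewrite (_ : Z.sub a b = Z.add a (Z.opp b)) // -[Z.add a _]/(a - b) /ZR rmorphB intrB.
Qed.
Lemma ZR_le a b : Z.leb a b -> ZR a <= ZR b.
Proof. by move=> h; rewrite ler_int; lia. Qed.
Lemma ZR_ge0 a : Z.leb Z0 a -> 0 <= ZR a.
Proof. by move=> h; rewrite ler0z; lia. Qed.
Lemma ZR_nat n : ZR (Z.of_nat n) = n%:R.
Proof. by rewrite /ZR (_ : int_of_Z (Z.of_nat n) = n) //; lia. Qed.
Lemma ZR_gt0 a : 0 < ZR a -> Z.ltb Z0 a.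
Proof. by rewrite ltr0z => h; lia. Qed.
Lemma ZR1 : ZR (Zpos xH) = 1.
Proof. by []. Qed.
Lemma ZR_pos p : ZR (Zpos p) = (Pos.to_nat p)%:R.
Proof. by rewrite -ZR_nat; congr ZR; lia. Qed.
Lemma ZR_div a b : Z.ltb Z0 b -> ZR (Z.div a b) * ZR b <= ZR a < (ZR (Z.div a b) + 1) * ZR b.
Proof.
move=> b0; rewrite -ZR1 -ZRD -!ZRM; have := Z.mul_div_le a b; have := Z.mul_succ_div_gt a b.
move=> h1 h2; apply/andP; split; first by apply: ZR_le; lia.
by rewrite ltr_int; lia.
Qed.
Lemma ZR_shiftr a n : ZR (Z.shiftr a (Z.of_nat n)) * 2 ^+ n <= ZR a <
  (ZR (Z.shiftr a (Z.of_nat n)) + 1) * 2 ^+ n.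
Proof.
rewrite Z.shiftr_div_pow2; last by lia.
have E : ZR (Z.pow (Zpos 2) (Z.of_nat n)) = 2 ^+ n.
  elim: n => [|n IH]; first by rewrite expr0.
  by rewrite Nat2Z.inj_succ Z.pow_succ_r ?ZRM ?IH ?exprS ?ZR_pos //; lia.
by rewrite -E; apply: ZR_div; apply/Z.ltb_lt; apply: Z.pow_pos_nonneg; lia.
Qed.
Lemma ZR_ge0_of_lt a : 0 < ZR a + 1 -> 0 <= ZR a.
Proof. by rewrite -ZR1 -ZRD !(ltr0z, ler0z); lia. Qed.
Lemma ZR_shiftr_ge0 a n : 0 <= ZR a -> 0 <= ZR (Z.shiftr a (Z.of_nat n)).
Proof.
move=> a0; have /andP[_ h] := ZR_shiftr a n; apply: ZR_ge0_of_lt.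
by rewrite -(@pmulr_lgt0 _ (2 ^+ n)) ?exprn_gt0 //; exact: le_lt_trans h.
Qed.

(* Locked, because proof search would evaluate large numerals. *)
Definition PS : R := locked (ZR pscale).
Definition TS : R := locked (ZR tscale).
Definition SS : R := locked (2 ^+ 11).

Lemma ZR_pscale : ZR pscale = PS. Proof. by rewrite /PS -lock. Qed.
Lemma ZR_tscale : ZR tscale = TS. Proof. by rewrite /TS -lock. Qed.
Lemma PS_gt0 : 0 < PS. Proof. by rewrite -ZR_pscale ZR_pos ltr0n; lia. Qed.
Lemma TS_gt0 : 0 < TS. Proof. by rewrite -ZR_tscale ZR_pos ltr0n; lia. Qed.
Lemma SS_gt0 : 0 < SS. Proof. by rewrite /SS -lock exprn_gt0. Qed.
Lemma PS_ge0 : 0 <= PS. Proof. exact/ltW/PS_gt0. Qed.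
Lemma TS_ge0 : 0 <= TS. Proof. exact/ltW/TS_gt0. Qed.
Lemma SS_ge0 : 0 <= SS. Proof. exact/ltW/SS_gt0. Qed.
Lemma ZR_shiftr11 a :
  ZR (Z.shiftr a (Zpos 11)) * SS <= ZR a < (ZR (Z.shiftr a (Zpos 11)) + 1) * SS.
Proof. by rewrite /SS -lock; exact: (ZR_shiftr a 11). Qed.
End ZR.

Definition digits3 (w : seq nat) := all (fun d => 0 < d <= 3)%N w.

Lemma digits3_positive w : digits3 w -> positive w.
Proof. by apply: sub_all => d /andP[]. Qed.

Lemma digits3_cat u w : digits3 (u ++ w) = digits3 u && digits3 w.
Proof. exact: all_cat. Qed.

(** * Enclosures of end points of cylinders *)

Section Enclosures.
Variables (R : realFieldType) (m : R).
Hypotheses (m_gt0 : 0 < m) (m_eq : 3 * m ^+ 2 + 3 * m = 1).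

Definition pt (w : seq nat) : R := cfval w m.

(** 3 x^2 + 3 S x increases for x >= 0 and takes the value S^2 at S m, so comparing m with a
    rational becomes an integer test. *)
Lemma m_root_lt (S x : R) : 0 <= x -> S ^+ 2 < 3 * x ^+ 2 + 3 * S * x -> 0 < S -> S * m < x.
Proof.
move=> x0 hx S0; rewrite ltNge; apply/negP => h.
have E : S ^+ 2 = 3 * (S * m) ^+ 2 + 3 * S * (S * m).
  by rewrite -[LHS]mulr1 -[X in _ * X = _]m_eq; ring.
move: hx; rewrite E ltNge => /negP; apply.
have h2 : x ^+ 2 <= (S * m) ^+ 2 by rewrite lerXn2r ?nnegrE // (le_trans x0).
have h1 : S * x <= S * (S * m) by rewrite ler_pM2l.
by rewrite -!mulrA; move: h1 h2; move: (x ^+ 2) ((S * m) ^+ 2) (S * x) (S * (S * m)) => a b c d;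
  lra.
Qed.

Lemma m_root_gt (S x : R) : 0 <= x -> 3 * x ^+ 2 + 3 * S * x < S ^+ 2 -> 0 < S -> x < S * m.
Proof.
move=> x0 hx S0; rewrite ltNge; apply/negP => h.
have E : S ^+ 2 = 3 * (S * m) ^+ 2 + 3 * S * (S * m).
  by rewrite -[LHS]mulr1 -[X in _ * X = _]m_eq; ring.
move: hx; rewrite E ltNge => /negP; apply.
have Sm : 0 <= S * m by rewrite mulr_ge0 // ltW.
have h2 : (S * m) ^+ 2 <= x ^+ 2 by rewrite lerXn2r ?nnegrE.
have h1 : S * (S * m) <= S * x by rewrite ler_pM2l.
by rewrite -!mulrA; move: h1 h2; move: (x ^+ 2) ((S * m) ^+ 2) (S * x) (S * (S * m)) => a b c d;
  lra.
Qed.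

Lemma m_bounds : ZR R (Zpos 17285) < PS R * m < ZR R (Zpos 17286).
Proof.
pose f (S x : Z) := Z.add (Z.mul (Zpos 3) (Z.mul x x)) (Z.mul (Z.mul (Zpos 3) S) x).
have fE S x : ZR R (f S x) = 3 * ZR R x ^+ 2 + 3 * ZR R S * ZR R x.
  by rewrite /f ZRD !ZRM !expr2 ZR_pos.
have sE S : ZR R (Z.mul S S) = ZR R S ^+ 2 by rewrite ZRM expr2.
have ltZ a b : Z.ltb a b -> ZR R a < ZR R b by move=> h; rewrite ltr_int; lia.
have ge0 k : 0 <= ZR R (Zpos k) by rewrite ZR_pos.
have c1 : Z.ltb (f pscale (Zpos 17285)) (Z.mul pscale pscale) by vm_compute.
have c2 : Z.ltb (Z.mul pscale pscale) (f pscale (Zpos 17286)) by vm_compute.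
have {c1} := ltZ _ _ c1; have {c2} := ltZ _ _ c2; have := ge0 17285%positive;
  have := ge0 17286%positive.
rewrite !fE !sE ZR_pscale => x0 y0 h1 h2.
by rewrite (m_root_gt y0 h2 (PS_gt0 R)) (m_root_lt x0 h1 (PS_gt0 R)).
Qed.

(** 91/345 and the 24/91 of [m_gt] are consecutive convergents of [0; 3, 1, 3, 1, ...]. *)
Lemma m_lt : m < 91 / 345.
Proof.
rewrite ltr_pdivlMr ?ltr0n // mulrC.
by apply: m_root_lt; rewrite ?ler0n ?ltr0n //; lra.
Qed.

Lemma m_gt : 24 / 91 < m.
Proof.
rewrite ltr_pdivrMr ?ltr0n // mulrC.
by apply: m_root_gt; rewrite ?ler0n ?ltr0n //; lra.
Qed.

Local Ltac mlra := move: m_gt m_lt m_gt0 => ? ? ?; lra.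

Lemma pt_nil : pt [::] = m. Proof. by []. Qed.

Lemma pt_cons d w : pt (d :: w) = (d%:R + pt w)^-1.
Proof. by []. Qed.

(** From 3 m (1 + m) = 1. Thus the largest value with digits at most 3 is three times the smallest,
    and every hull has tails m and 3 m. *)
Lemma pt1 : pt [:: 1%N] = 3 * m.
Proof.
by rewrite pt_cons pt_nil; apply: mulr1_eq; move: m_eq; rewrite expr2; mlra.
Qed.

Lemma pt_cat u w : pt (u ++ w) = cfval u (pt w).
Proof. exact: cfval_cat. Qed.

Lemma pt_bounds w : digits3 w -> m <= pt w <= 3 * m.
Proof.
elim: w => [_|d w IH /= /andP[/andP[d0 d3] /IH/andP[h1 h2]]]; first by apply/andP; split;
  rewrite ?pt_nil; mlra.
have h0 : 0 < d%:R + pt w by rewrite ltr_wpDr ?ltr0n //; mlra.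
have d1 : 1 <= d%:R :> R by rewrite ler1n.
have d2 : d%:R <= 3 :> R by rewrite ler_nat.
have E1 : m = (3 + 3 * m)^-1.
  by apply/esym/mulr1_eq; move: m_eq; rewrite expr2; mlra.
have E2 : 3 * m = (1 + m)^-1 by exact/esym/pt1.
by rewrite E2 {1}E1 !lef_pV2 ?posrE //; mlra.
Qed.

Lemma pt_ge0 w : digits3 w -> 0 <= pt w.
Proof. by move=> /pt_bounds /andP[h _]; apply: le_trans h; apply: ltW. Qed.

Lemma pt_nil31 : pt [:: 3; 1]%N = m.
Proof.
by rewrite pt_cons pt1; apply: mulr1_eq; move: m_eq; rewrite expr2; mlra.
Qed.

Lemma enclose_sound w : digits3 w ->
  [/\ 0 <= ZR R (enclose w).1, ZR R (enclose w).1 <= PS R * pt w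
    & PS R * pt w <= ZR R (enclose w).2].
Proof.
have PS0 := PS_gt0 R; elim: w => [_|d w IH /= /andP[/andP[d0 d3] gw]].
  have ge0 k : 0 <= ZR R (Zpos k) by rewrite ZR_pos.
  have /andP[/ltW h1 /ltW h2] := m_bounds.
  rewrite -[(enclose [::]).1]/(Zpos 17285) -[(enclose [::]).2]/(Zpos 17286) pt_nil.
  by split; [exact: ge0|exact: h1|exact: h2].
have [] := IH gw; case: (enclose w) => l h /= l0 lw wh.
have p0 := pt_ge0 gw.
have d1 : 1 <= d%:R :> R by rewrite ler1n.
have E : pt (d :: w) * (d%:R + pt w) = 1 by rewrite pt_cons mulVf // gt_eqF // ltr_wpDr // ltr0n.
have e0 : 0 <= pt (d :: w) by rewrite pt_cons invr_ge0 addr_ge0.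
have Dx x : ZR R (Z.add (Z.mul (Z.of_nat d) pscale) x) = d%:R * PS R + ZR R x.
  by rewrite ZRD ZRM ZR_nat ZR_pscale.
have Dx0 x : 0 <= ZR R x -> 0 < d%:R * PS R + ZR R x.
  by move=> x0; rewrite ltr_wpDr // mulr_gt0 // ltr0n.
have h0 : 0 <= ZR R h by apply: le_trans wh; rewrite mulr_ge0 // ltW.
have hb : Z.ltb Z0 (Z.add (Z.mul (Z.of_nat d) pscale) h) by apply: (@ZR_gt0 R); rewrite Dx Dx0.
have lb : Z.ltb Z0 (Z.add (Z.mul (Z.of_nat d) pscale) l) by apply: (@ZR_gt0 R); rewrite Dx Dx0.
have := ZR_div R (Z.mul pscale pscale) hb; have := ZR_div R (Z.mul pscale pscale) lb.
have q0 b : Z.ltb Z0 b -> 0 <= ZR R (Z.div (Z.mul pscale pscale) b).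
  move=> b0; apply: ZR_ge0; apply/Z.leb_le.
  by apply: Z.div_pos; [exact: Z.square_nonneg | exact/Z.ltb_lt].
have := q0 _ hb; have := q0 _ lb.
rewrite ZRM !ZR_pscale !Dx ZRD ZR1.
set ql := ZR R (Z.div _ _); set qh := ZR R (Z.div _ _).
move=> ql0 qh0 /andP[_ l2] /andP[h1 _].
have {}E : PS R * pt (d :: w) * (d%:R * PS R + PS R * pt w) = PS R * PS R.
  by rewrite -[RHS]mulr1 -[in RHS]E; move: (pt (d :: w)) (pt w) => a b; ring.
have {}e0 : 0 <= PS R * pt (d :: w) by rewrite mulr_ge0 // ltW.
have P : 0 < d%:R * PS R + PS R * pt w.
  by rewrite ltr_wpDr ?mulr_gt0 ?ltr0n // mulr_ge0 // ltW.
split => //; rewrite -(ler_pM2r P) E.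
  by rewrite (le_trans _ h1) // ler_wpM2l // lerD2l.
by rewrite ltW // (lt_le_trans l2) // ler_wpM2l ?lerD2l // addr_ge0.
Qed.
End Enclosures.

Lemma eq_wordP u v : eq_word u v -> u = v.
Proof.
elim: u v => [|d u IH] [|e v] //= /andP[/PeanoNat.Nat.eqb_eq-> /IH->] //.
Qed.

Lemma find_bounds_mktrie n p w b : find_bounds (mktrie n p) w = Some b -> b = enclose (p ++ w).
Proof.
elim: n p w => // n IH p [|d w] /=; first by move=> [<-]; rewrite cats0.
by case: d => [|[|[|[|d]]]] // /IH ->; rewrite cat_rcons.
Qed.

Lemma boundsE w : bounds w = enclose w.
Proof.
rewrite /bounds; have -> : trie5 = mktrie 5 [::] by vm_compute.
by case E: (find_bounds _ _) => [b|] //; rewrite (find_bounds_mktrie E).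
Qed.

(* Unfolding [bounds] would expose the evaluated table [trie5]. *)
Opaque bounds.
Arguments pt : simpl never.

(** * Soundness of the interval tests *)

Section HalfBox.
Variables (R : realFieldType) (m : R).
Hypotheses (m_gt0 : 0 < m) (m_eq : 3 * m ^+ 2 + 3 * m = 1).
Local Notation pt := (pt m).
Local Notation PS := (PS R).
Local Notation TS := (TS R).
Local Notation SS := (SS R).
Local Notation ZR := (ZR R).

Definition encloses (b : Z * Z) (x : R) :=
  [/\ 0 <= ZR b.1, ZR b.1 <= PS * x & PS * x <= ZR b.2].

Lemma bounds_sound w : digits3 w -> encloses (bounds w) (pt w).
Proof. by move=> gw; rewrite boundsE; apply: enclose_sound. Qed.

Definition slope w : R := (cfd1 w)%:R / (cfd0 w)%:R.

Lemma slope_ge0 w : 0 <= slope w.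
Proof. by rewrite divr_ge0. Qed.

Lemma slope_le1 w : positive w -> slope w <= 1.
Proof.
move=> pw; rewrite ler_pdivrMr ?ltr0n ?cfd0_gt0 // mul1r ler_nat.
exact: cfd1_le_cfd0.
Qed.

Lemma denE w x : positive w -> den w x = (cfd0 w)%:R * (1 + slope w * x).
Proof.
move=> pw; have := cfd0_gt0 pw; rewrite -(@ltr0n R) => h; rewrite /den /slope; field.
by rewrite gt_eqF.
Qed.

(* The hull of the cylinder [u] has length 2 m / hull_den u. *)
Definition hull_den u : R := den u m * den u (3 * m).

Lemma hull_den_gt0 u : positive u -> 0 < hull_den u.
Proof. by move=> pu; rewrite mulr_gt0 // den_gt0 // ?mulr_ge0 // ltW. Qed.

Definition in_half (h : halfbox) u v :=
  [/\ positive u /\ positive v,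
      0 <= ZR (lo1 h) /\ 0 <= ZR (lo2 h),
      ZR (lo1 h) <= TS * slope u <= ZR (hi1 h),
      ZR (lo2 h) <= TS * slope v <= ZR (hi2 h) &
      [/\ 0 <= ZR (wt1 h), 0 < ZR (wt2 h) &
      ZR (wt1 h) * (1 + ZR (lo2 h) / TS * m) * (1 + ZR (hi2 h) / TS * (3 * m)) * hull_den u
      <= ZR (wt2 h) * (1 + ZR (hi1 h) / TS * m) * (1 + ZR (lo1 h) / TS * (3 * m)) * hull_den v]].

Lemma ZR_lin t x : ZR (lin t x) = TS * PS + ZR t * ZR x.
Proof. by rewrite /lin ZRD !ZRM ZR_tscale ZR_pscale. Qed.

Lemma linl_le t x y : 0 <= ZR t -> ZR x <= PS * y ->
  ZR (linl t x) * SS <= TS * PS * (1 + ZR t / TS * y).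
Proof.
move=> t0 xy; have /andP[h _] := ZR_shiftr11 R (lin t x).
apply: (le_trans h); rewrite ZR_lin mulrDr mulr1 lerD2l.
have -> : TS * PS * (ZR t / TS * y) = ZR t * (PS * y) by field; rewrite gt_eqF ?TS_gt0.
by rewrite ler_wpM2l.
Qed.

Lemma linh_ge t x y : 0 <= ZR t -> PS * y <= ZR x ->
  TS * PS * (1 + ZR t / TS * y) <= ZR (linh t x) * SS.
Proof.
move=> t0 xy; have /andP[_ h] := ZR_shiftr11 R (lin t x).
rewrite /linh ZRD ZR1; apply: le_trans (ltW h); rewrite ZR_lin mulrDr mulr1 lerD2l.
have -> : TS * PS * (ZR t / TS * y) = ZR t * (PS * y) by field; rewrite gt_eqF ?TS_gt0.
by rewrite ler_wpM2l.
Qed.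

Lemma linl_ge0 t x : 0 <= ZR t -> 0 <= ZR x -> 0 <= ZR (linl t x).
Proof.
move=> t0 x0; have /andP[_ h] := ZR_shiftr11 R (lin t x).
have {h} : 0 < (ZR (linl t x) + 1) * SS.
  by apply: le_lt_trans h; rewrite ZR_lin addr_ge0 ?mulr_ge0 ?TS_ge0 ?PS_ge0.
by rewrite pmulr_lgt0 ?SS_gt0 //; exact: ZR_ge0_of_lt.
Qed.

Lemma mono_ratio (s t x y : R) : s <= t -> x <= y ->
  (1 + s * y) * (1 + t * x) <= (1 + s * x) * (1 + t * y).
Proof.
move=> st xy; rewrite -subr_ge0.
have -> : (1 + s * x) * (1 + t * y) - (1 + s * y) * (1 + t * x) = (t - s) * (y - x) by ring.
by rewrite mulr_ge0 // subr_ge0.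
Qed.

Lemma den_test_core (cA cB k1 k2 F G A B X Y T S q1 q2 : R) :
  0 <= cA -> 0 <= cB -> 0 <= k1 -> 0 < k2 -> 0 < A -> 0 < B -> 0 < S ->
  0 <= T -> 0 <= Y -> 0 <= q1 ->
  cB * k2 * F <= cA * k1 * G -> k1 * B * (q1 * T) <= k2 * A * (q2 * S) ->
  A * X <= T * F -> G * S <= Y * B -> cB * (q1 * X) <= cA * (q2 * Y).
Proof.
move=> cA0 cB0 k10 k20 A0 B0 S0 T0 Y0 q10 h1 h2 M1 M2.
rewrite -(@ler_pM2r _ (A * k2 * S * B)) ?mulr_gt0 //.
apply: (@le_trans _ _ (cB * k2 * F * (q1 * T * S * B))).
  rewrite (_ : _ * (_ * X) * _ = cB * q1 * k2 * S * B * (A * X)); last by ring.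
  rewrite (_ : cB * k2 * F * _ = cB * q1 * k2 * S * B * (T * F)); last by ring.
  by rewrite ler_wpM2l // !mulr_ge0 // ltW.
apply: (@le_trans _ _ (cA * k1 * G * (q1 * T * S * B))).
  by rewrite ler_wpM2r // !mulr_ge0 // ltW.
apply: (@le_trans _ _ (cA * Y * B * (k1 * B * (q1 * T)))).
  rewrite (_ : cA * k1 * G * _ = cA * k1 * q1 * T * B * (G * S)); last by ring.
  rewrite (_ : cA * Y * B * _ = cA * k1 * q1 * T * B * (Y * B)); last by ring.
  by rewrite ler_wpM2l // !mulr_ge0 // ltW.
rewrite (_ : cA * (_ * Y) * _ = cA * Y * B * (k2 * A * (q2 * S))); last by ring.
by rewrite ler_wpM2l // !mulr_ge0 // ltW.
Qed.

(** Divided by [hull_den u], the product for [u] is (1 + s Xa)/(1 + s m) times (1 + s Xb)/(1 + 3 s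
    m) with s the slope. The first factor increases in s as Xa >= m, the second decreases as Xb <= 3
    m; hence [hi1] for one and [lo1] for the other. For [v] a lower bound is wanted and the ends are
    exchanged. *)
Lemma den_test_sound h u v cA cB xa xb ya yb Xa Xb Ya Yb :
  in_half h u v -> 0 <= ZR cA -> 0 <= ZR cB ->
  encloses xa Xa -> encloses xb Xb -> encloses ya Ya -> encloses yb Yb ->
  m <= Xa <= 3 * m -> m <= Xb <= 3 * m -> m <= Ya <= 3 * m -> m <= Yb <= 3 * m ->
  den_test h cA xa xb cB ya yb ->
  ZR cB * (den u Xa * den u Xb) <= ZR cA * (den v Ya * den v Yb).
Proof.
move=> [[pu pv] [l1 l2] /andP[u1 u2] /andP[v1 v2] [k1 k2 K]] cA0 cB0.
move=> [xa0 _ xa2] [xb0 _ xb2] [ya0 ya1 _] [yb0 yb1 _] /andP[Xa1 Xa2] /andP[Xb1 Xb2].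
move=> /andP[Ya1 Ya2] /andP[Yb1 Yb2]; rewrite /den_test => /(ZR_le R); rewrite !ZRM.
move=> test.
have m0 := ltW m_gt0; have PS0 := PS_gt0 R.
have u3 : 0 <= ZR (hi1 h) by lra.
have v3 : 0 <= ZR (hi2 h) by lra.
have c0 : 0 < TS * PS by rewrite mulr_gt0 ?TS_gt0 ?PS_gt0.
have lin_gt0 t x : 0 <= t -> 0 <= x -> 0 < 1 + t / TS * x.
  by move=> t0 x0; rewrite ltr_wpDr // mulr_ge0 // divr_ge0 ?TS_ge0.
have [Xa0 Xb0 Ya0 Yb0] : [/\ 0 <= Xa, 0 <= Xb, 0 <= Ya & 0 <= Yb].
  by split; apply: le_trans m0 _.
have M0 : 0 <= 3 * m by rewrite mulr_ge0.
set F := (1 + ZR (hi1 h) / TS * Xa) * (1 + ZR (lo1 h) / TS * Xb).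
set G := (1 + ZR (lo2 h) / TS * Ya) * (1 + ZR (hi2 h) / TS * Yb).
have {}test : ZR cB * ZR (wt2 h) * F <= ZR cA * ZR (wt1 h) * G.
  rewrite -(@ler_pM2r _ ((TS * PS) ^+ 2)) ?exprn_gt0 //.
  have hF : (TS * PS) ^+ 2 * F <=
      ZR (linh (hi1 h) xa.2) * ZR (linh (lo1 h) xb.2) * SS ^+ 2.
    rewrite /F !expr2 mulrACA [leRHS]mulrACA ler_pM ?linh_ge //.
    - by rewrite mulr_ge0 ?ltW // lin_gt0.
    - by rewrite mulr_ge0 ?ltW // lin_gt0.
  have hG : ZR (linl (lo2 h) ya.1) * ZR (linl (hi2 h) yb.1) * SS ^+ 2 <=
      (TS * PS) ^+ 2 * G.
    rewrite /G !expr2 mulrACA [leRHS]mulrACA; apply: ler_pM; rewrite ?linl_le //.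
    - by rewrite mulr_ge0 ?SS_ge0 ?linl_ge0.
    - by rewrite mulr_ge0 ?SS_ge0 ?linl_ge0.
  rewrite -[leLHS]mulrA -[leRHS]mulrA [F * _]mulrC [G * _]mulrC.
  have wB : 0 <= ZR cB * ZR (wt2 h) by rewrite mulr_ge0 // ltW.
  have wA : 0 <= ZR cA * ZR (wt1 h) by rewrite mulr_ge0.
  apply: le_trans (ler_wpM2l wB hF) _; apply: le_trans (ler_wpM2l wA hG).
  by rewrite [leLHS]mulrA [leRHS]mulrA ler_wpM2r // exprn_ge0 // SS_ge0.
rewrite !denE // (_ : _ * (1 + _ * Xa) * _ =
  (cfd0 u)%:R ^+ 2 * ((1 + slope u * Xa) * (1 + slope u * Xb))); last by ring.
rewrite (_ : _ * (1 + _ * Ya) * _ =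
  (cfd0 v)%:R ^+ 2 * ((1 + slope v * Ya) * (1 + slope v * Yb))); last by ring.
have lo (x s : R) : x <= TS * s -> x / TS <= s by move=> xs; rewrite ler_pdivrMr ?TS_gt0 // mulrC.
have hi (x s : R) : TS * s <= x -> s <= x / TS by move=> xs; rewrite ler_pdivlMr ?TS_gt0 // mulrC.
have /lo lu := u1; have /hi hu := u2; have /lo lv := v1; have /hi hv := v2.
have su := slope_ge0 u; have sv := slope_ge0 v.
have gt1 s x : 0 <= s -> 0 <= x -> 0 < 1 + s * x :> R.
  by move=> s0 x0; rewrite ltr_wpDr // mulr_ge0.
have q0 : 0 <= (cfd0 u)%:R ^+ 2 :> R by rewrite exprn_ge0.
have Ku : hull_den u = (cfd0 u)%:R ^+ 2 * ((1 + slope u * m) * (1 + slope u * (3 * m))).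
  by rewrite /hull_den !denE //; ring.
have Kv : hull_den v = (cfd0 v)%:R ^+ 2 * ((1 + slope v * m) * (1 + slope v * (3 * m))).
  by rewrite /hull_den !denE //; ring.
apply: (den_test_core (k1 := ZR (wt1 h)) (k2 := ZR (wt2 h)) (F := F) (G := G)
  (A := (1 + ZR (hi1 h) / TS * m) * (1 + ZR (lo1 h) / TS * (3 * m)))
  (B := (1 + ZR (lo2 h) / TS * m) * (1 + ZR (hi2 h) / TS * (3 * m)))
  (S := (1 + slope v * m) * (1 + slope v * (3 * m)))
  (T := (1 + slope u * m) * (1 + slope u * (3 * m)))) => //.
- by rewrite mulr_gt0 ?lin_gt0.
- by rewrite mulr_gt0 ?lin_gt0.
- by rewrite mulr_gt0 ?gt1.
- by rewrite ltW // mulr_gt0 ?gt1.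
- by rewrite ltW // mulr_gt0 ?gt1.
- by move: K; rewrite Ku Kv !mulrA.
- rewrite /F mulrACA [leRHS]mulrACA; apply: ler_pM.
  + by rewrite ltW // mulr_gt0 ?lin_gt0 ?gt1.
  + by rewrite ltW // mulr_gt0 ?lin_gt0 ?gt1.
  + by rewrite [leLHS]mulrC mono_ratio.
  + by rewrite [leRHS]mulrC mono_ratio.
- rewrite /G mulrACA [leRHS]mulrACA; apply: ler_pM.
  + by rewrite ltW // mulr_gt0 ?lin_gt0 ?gt1.
  + by rewrite ltW // mulr_gt0 ?lin_gt0 ?gt1.
  + by rewrite [leRHS]mulrC mono_ratio.
  + by rewrite [leLHS]mulrC mono_ratio.
Qed.
End HalfBox.

Lemma positive_cat_digits3 u w : positive u -> digits3 w -> positive (u ++ w).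
Proof. by move=> pu /digits3_positive pw; rewrite /positive all_cat; apply/andP. Qed.

Section LengthTest.
Variables (R : realFieldType) (m : R).
Hypotheses (m_gt0 : 0 < m) (m_eq : 3 * m ^+ 2 + 3 * m = 1).
Local Notation pt := (pt m).
Local Notation PS := (PS R).
Local Notation TS := (TS R).
Local Notation SS := (SS R).
Local Notation ZR := (ZR R).
Local Notation hull_den := (hull_den m).
Local Notation in_half := (in_half m).

Lemma encloses_nil : encloses (bounds [::]) m.
Proof. exact: (bounds_sound m_gt0 m_eq (w := [::])). Qed.

Lemma encloses_one : encloses (bounds [:: 1%N]) (3 * m).
Proof. by rewrite -(pt1 m_gt0 m_eq); apply: bounds_sound. Qed.

Lemma mkhalf_sound u v a0 a1 b0 b1 kn kd : positive u -> positive v ->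
  0 <= ZR a0 -> 0 <= ZR b0 -> 0 <= ZR kn -> 0 <= ZR kd ->
  ZR a0 <= TS * slope R u <= ZR a1 -> ZR b0 <= TS * slope R v <= ZR b1 ->
  ZR kd * hull_den u <= ZR kn * hull_den v -> in_half (mkhalf a0 a1 b0 b1 kn kd) u v.
Proof.
move=> pu pv a00 b00 kn0 kd0 ha hb hk; rewrite /mkhalf.
have := encloses_nil; have := encloses_one.
generalize (bounds [:: 1%N]); generalize (bounds [::]) => -[ml mh] [Ml Mh].
rewrite /encloses !/fst !/snd => -[M0 M1 M2] [m0 m1 m2].
have a10 : 0 <= ZR a1 by lra.
have b10 : 0 <= ZR b1 by lra.
have m_ge0 := ltW m_gt0.
have c0 : 0 <= TS * PS by rewrite mulr_ge0 ?TS_ge0 ?PS_ge0.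
have lin_ge0 (t x : R) : 0 <= t -> 0 <= x -> 0 <= 1 + t / TS * x.
  by move=> t0 x0; rewrite addr_ge0 // mulr_ge0 // divr_ge0 ?TS_ge0.
have M_ge0 : 0 <= 3 * m by rewrite mulr_ge0.
set L := Z.mul kd _; set H := Z.mul kn _.
have hL : ZR L * SS ^+ 2 <=
    ZR kd * ((TS * PS) ^+ 2 * ((1 + ZR a1 / TS * m) * (1 + ZR a0 / TS * (3 * m)))).
  rewrite /L !ZRM -mulrA ler_wpM2l // !expr2 mulrACA [leRHS]mulrACA.
  apply: ler_pM; [| |exact: linl_le|exact: linl_le].
    by apply: mulr_ge0; [exact: linl_ge0|exact: SS_ge0].
  by apply: mulr_ge0; [exact: linl_ge0|exact: SS_ge0].
have hH : ZR kn * ((TS * PS) ^+ 2 * ((1 + ZR b0 / TS * m) * (1 + ZR b1 / TS * (3 * m)))) <=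
    ZR H * SS ^+ 2.
  rewrite /H !ZRM -[leRHS]mulrA ler_wpM2l // !expr2 mulrACA [leRHS]mulrACA.
  by apply: ler_pM; rewrite ?linh_ge // mulr_ge0 // lin_ge0.
have L0 : 0 <= ZR L.
  by rewrite /L !ZRM; apply: mulr_ge0 => //; apply: mulr_ge0; apply: linl_ge0.
have H0 : 0 <= ZR H.
  have: 0 <= ZR H * SS ^+ 2.
    apply: le_trans hH; apply: mulr_ge0 => //; apply: mulr_ge0; first exact: exprn_ge0.
    by apply: mulr_ge0; apply: lin_ge0.
  by rewrite pmulr_lge0 // exprn_gt0 // SS_gt0.
have [X X0 [sL sH]] : exists2 X : R, 0 < X &
    ZR (Z.shiftr L 24) * X <= ZR L /\ ZR H <= (ZR (Z.shiftr H 24) + 1) * X.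
  exists (2 ^+ 24); first exact: exprn_gt0.
  have /andP[h1 _] := ZR_shiftr R L 24; have /andP[_ /ltW h2] := ZR_shiftr R H 24.
  by split.
have w0 : 0 <= ZR (Z.shiftr L 24) := ZR_shiftr_ge0 24 L0.
have w1 : 0 <= ZR (Z.shiftr H 24) := ZR_shiftr_ge0 24 H0.
move: (Z.shiftr L 24) (Z.shiftr H 24) w0 w1 sL sH => wL wH w0 w1 sL sH.
have [Y Y0 [{}hL {}hH]] : exists2 Y : R, 0 < Y &
    ZR L * Y <= ZR kd * ((TS * PS) ^+ 2 *
      ((1 + ZR a1 / TS * m) * (1 + ZR a0 / TS * (3 * m)))) /\
    ZR kn * ((TS * PS) ^+ 2 *
      ((1 + ZR b0 / TS * m) * (1 + ZR b1 / TS * (3 * m)))) <= ZR H * Y.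
  by exists (SS ^+ 2); first by rewrite exprn_gt0 // SS_gt0.
have C0 : 0 < (TS * PS) ^+ 2 by rewrite exprn_gt0 // mulr_gt0 ?TS_gt0 ?PS_gt0.
move: ((TS * PS) ^+ 2) C0 hL hH => C C0 hL hH.
have w2 : ZR (Z.add wH (Zpos xH)) = ZR wH + 1 by rewrite ZRD ZR1.
split=> //; split=> //=; rewrite w2; first by rewrite ltr_wpDl.
set A := (1 + ZR a1 / TS * m) * (1 + ZR a0 / TS * (3 * m)) in hL *.
set B := (1 + ZR b0 / TS * m) * (1 + ZR b1 / TS * (3 * m)) in hH *.
have A0 : 0 <= A by apply: mulr_ge0; apply: lin_ge0.
have B0 : 0 <= B by apply: mulr_ge0; apply: lin_ge0.
rewrite -[_ * _ * _ * hull_den u]mulrA -[_ * _ * _ * hull_den v]mulrA -!mulrA.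
rewrite -(@ler_pM2r _ (X * Y)) ?mulr_gt0 //.
have hu := ltW (hull_den_gt0 m_gt0 pu); have hv := ltW (hull_den_gt0 m_gt0 pv).
apply: (@le_trans _ _ (ZR kd * (C * A) * (B * hull_den u))).
  rewrite (_ : _ * (X * Y) = ZR wL * X * Y * (B * hull_den u)); last by rewrite /B; ring.
  apply: ler_wpM2r; first exact: mulr_ge0.
  by apply: le_trans hL; rewrite ler_wpM2r // ltW.
apply: (@le_trans _ _ (ZR kn * (C * B) * (A * hull_den v))).
  rewrite (_ : _ * (C * A) * _ = C * A * B * (ZR kd * hull_den u)); last by ring.
  rewrite (_ : _ * (C * B) * _ = C * A * B * (ZR kn * hull_den v)); last by ring.
  have CAB : 0 <= C * A * B by do 2 apply: mulr_ge0 => //; exact: ltW.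
  exact: ler_wpM2l.
rewrite [leRHS](_ : _ = (ZR wH + 1) * X * Y * (A * hull_den v)); last by rewrite /A; ring.
apply: ler_wpM2r; first exact: mulr_ge0.
by apply: (le_trans hH); rewrite ler_wpM2r // ltW.
Qed.

Definition len u a b : R := `|pt (u ++ a) - pt (u ++ b)|.

Arguments len : simpl never.

Lemma lenE u a b : positive u -> digits3 a -> digits3 b ->
  len u a b = `|pt a - pt b| / (den u (pt a) * den u (pt b)).
Proof.
by move=> pu ga gb; rewrite /len !pt_cat dist_cfval ?pt_ge0.
Qed.

Lemma lenC u a b : len u a b = len u b a.
Proof. by rewrite /len distrC. Qed.

Lemma len_ge0 u a b : 0 <= len u a b.
Proof. exact: normr_ge0. Qed.

Lemma den_test_len h n d u v xa xb ya yb x x' y y' :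
  in_half h u v -> positive u -> positive v -> digits3 x -> digits3 x' -> digits3 y -> digits3 y' ->
  0 <= ZR n -> 0 <= ZR d ->
  encloses xa (pt x) -> encloses xb (pt x') -> encloses ya (pt y) -> encloses yb (pt y') ->
  Z.leb ya.1 yb.1 -> Z.leb Z0 (Z.sub xb.1 xa.2) -> Z.leb ya.2 yb.2 ->
  den_test h (Z.mul d (Z.sub xb.1 xa.2)) xa xb (Z.mul n (Z.sub yb.2 ya.1)) ya yb ->
  ZR n * len v y y' <= ZR d * len u x x'.
Proof.
move=> hh gu gv gx gx' gy gy' n0 d0 ex ex' ey ey' c1 c2 c3.
have PS0 := PS_gt0 R.
have L : PS * `|pt y - pt y'| <= ZR (Z.sub yb.2 ya.1).
  case: ey ey' => _ h1 h2 [_ h3 h4]; move: c1 c3 => /(ZR_le R) c1 /(ZR_le R) c3.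
  rewrite -[PS in leLHS]gtr0_norm // -normrM ZRB ler_norml mulrBr; apply/andP; split; lra.
have G : ZR (Z.sub xb.1 xa.2) <= PS * `|pt x - pt x'|.
  case: ex ex' => _ h1 h2 [_ h3 h4]; move: c2 => /(ZR_ge0 R) c2.
  rewrite -[PS in leRHS]gtr0_norm // -normrM ZRB ler_normr mulrBr; apply/orP; right; lra.
have n0' : 0 <= ZR (Z.mul n (Z.sub yb.2 ya.1)).
  by rewrite ZRM mulr_ge0 // (le_trans _ L) // mulr_ge0 // ltW.
have d0' : 0 <= ZR (Z.mul d (Z.sub xb.1 xa.2)) by rewrite ZRM mulr_ge0 // ZR_ge0.
have bds w : digits3 w -> m <= pt w <= 3 * m by move=> gw; apply: (pt_bounds m_gt0 m_eq).
move=> t; have := den_test_sound m_gt0 hh d0' n0' ex ex' ey ey' (bds _ gx) (bds _ gx') (bds _ gy)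
  (bds _ gy') t.
rewrite !ZRM !lenE // => T.
have p0 w : digits3 w -> 0 <= pt w by move=> gw; apply: (pt_ge0 m_gt0 m_eq).
have DU : 0 < den u (pt x) * den u (pt x').
  by apply: mulr_gt0; apply: den_gt0; [|exact: p0| |exact: p0].
have DV : 0 < den v (pt y) * den v (pt y').
  by apply: mulr_gt0; apply: den_gt0; [|exact: p0| |exact: p0].
rewrite !mulrA ler_pdivrMr // mulrAC ler_pdivlMr //.
move: (den u _ * _) (den v _ * _) DU DV T => DU DV DU0 DV0 T.
rewrite -(ler_pM2l PS0).
apply: (@le_trans _ _ (ZR n * ZR (Z.sub yb.2 ya.1) * DU)).
  rewrite (_ : PS * _ = ZR n * (PS * `|pt y - pt y'|) * DU); last by ring.
  by apply: ler_wpM2r; [exact: ltW|exact: ler_wpM2l].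
apply: (le_trans T).
rewrite (_ : PS * _ = ZR d * (PS * `|pt x - pt x'|) * DV); last by ring.
by apply: ler_wpM2r; [exact: ltW|exact: ler_wpM2l].
Qed.

Lemma len_test_sound h n d u v x x' y y' :
  in_half h u v -> positive u -> positive v -> digits3 x -> digits3 x' -> digits3 y -> digits3 y' ->
  Z.leb Z0 n -> Z.leb Z0 d -> len_test h n d x x' y y' ->
  ZR n * len v y y' <= ZR d * len u x x'.
Proof.
move=> hh gu gv gx gx' gy gy' /(ZR_ge0 R) n0 /(ZR_ge0 R) d0; rewrite /len_test /sort_bounds.
have := bounds_sound m_gt0 m_eq gx; have := bounds_sound m_gt0 m_eq gx'.
have := bounds_sound m_gt0 m_eq gy; have := bounds_sound m_gt0 m_eq gy'.
generalize (bounds x) (bounds x') (bounds y) (bounds y') => bx bx' by_ by' ey' ey ex' ex.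
have Zle a b : Z.leb a b = false -> Z.leb b a by move/Z.leb_gt => ?; apply/Z.leb_le; lia.
case: (Z.leb bx.1 bx'.1); case E: (Z.leb by_.1 by'.1); try (move/Zle: E => E);
  case/and3P => c1 c2; rewrite ?[len u x x']lenC ?[len v y y']lenC => t.
- by rewrite [len u _ _]lenC [len v _ _]lenC; apply: den_test_len t.
- by rewrite [len u _ _]lenC; apply: den_test_len t.
- by rewrite [len v _ _]lenC; apply: den_test_len t.
- by apply: den_test_len t.
Qed.
End LengthTest.

(** * Gaps bridged at all scales near a corner *)

Section Zoom.
Variables (R : realFieldType) (m : R).
Hypotheses (m_gt0 : 0 < m) (m_eq : 3 * m ^+ 2 + 3 * m = 1).
Local Notation pt := (pt m).
Local Notation PS := (PS R).
Local Notation TS := (TS R).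
Local Notation SS := (SS R).
Local Notation ZR := (ZR R).
Local Notation len := (len m).
Local Notation in_half := (in_half m).

Lemma pt21 : pt [:: 2; 1]%N = (1 + 3 * m) / 5.
Proof.
have := m_lt m_eq; have := m_gt m_gt0 m_eq; have := m_eq;
  rewrite expr2 pt_cons (pt1 m_gt0 m_eq) => h1 h2 h3.
by apply: mulr1_eq; lra.
Qed.

Lemma pt3 : pt [:: 3%N] = (6 - 3 * m) / 17.
Proof.
have := m_lt m_eq; have := m_gt m_gt0 m_eq; have := m_eq; rewrite expr2 pt_cons pt_nil => h1 h2 h3.
by apply: mulr1_eq; lra.
Qed.

Lemma digits3_pt w : digits3 w -> positive w /\ 0 <= pt w.
Proof. by move=> gw; split; [exact: digits3_positive|exact: (pt_ge0 m_gt0 m_eq)]. Qed.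

Lemma den_pt_gt0 u w : positive u -> digits3 w -> 0 < den u (pt w).
Proof. by move=> pu /digits3_pt[_ w0]; apply: den_gt0. Qed.

Lemma den_pt_cat u U x : positive u -> digits3 U -> digits3 x ->
  den (u ++ U) (pt x) = den u (pt (U ++ x)) * den U (pt x).
Proof.
move=> pu /digits3_pt[pU _] /digits3_pt[_ x0].
by rewrite den_cat // pt_cat.
Qed.

Lemma ZR_den_bound U x : ZR (den_bound U x) = (cfd0 U)%:R * PS + (cfd1 U)%:R * ZR x.
Proof. by rewrite /den_bound ZRD !ZRM !ZR_nat ZR_pscale. Qed.

Lemma den_bound_le U x y : ZR x <= PS * y -> ZR (den_bound U x) <= PS * den U y.
Proof.
move=> h; rewrite ZR_den_bound /den mulrDr [PS * _]mulrC lerD2l mulrCA; exact: ler_wpM2l.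
Qed.

Lemma den_bound_ge U x y : PS * y <= ZR x -> PS * den U y <= ZR (den_bound U x).
Proof.
move=> h; rewrite ZR_den_bound /den mulrDr [PS * _]mulrC lerD2l mulrCA; exact: ler_wpM2l.
Qed.

Lemma den_bound_ge0 U x : 0 <= ZR x -> 0 <= ZR (den_bound U x).
Proof.
by move=> h; rewrite ZR_den_bound; apply: addr_ge0; apply: mulr_ge0 => //; apply/ltW/PS_gt0.
Qed.

Lemma den_ratio_test_sound h u v U V x :
  in_half h u v -> positive u -> positive v -> digits3 U -> digits3 V -> digits3 x ->
  den_ratio_test h U V x -> 100 * den (u ++ U) (pt x) <= 91 * den (v ++ V) (pt x).
Proof.
move=> hh gu gv gU gV gx; rewrite /den_ratio_test.
have := bounds_sound m_gt0 m_eq gx; move: (bounds x) => bx [b0 bl bh].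
set l := Z.shiftr _ _; set r := Z.add _ _ => t.
have pi91 : ZR (Zpos 91) = 91 by rewrite ZR_pos.
have pi100 : ZR (Zpos 100) = 100 by rewrite ZR_pos.
have l0 : 0 <= ZR l.
  have p : 0 <= ZR (Z.mul (Zpos 91) (den_bound V bx.1)).
    by rewrite ZRM pi91; apply: mulr_ge0 => //; exact: den_bound_ge0.
  exact: (ZR_shiftr_ge0 12 p).
have h0 : 0 <= ZR bx.2 by lra.
have r0 : 0 <= ZR r.
  have p : 0 <= ZR (Z.mul (Zpos 100) (den_bound U bx.2)).
    by rewrite ZRM pi100; apply: mulr_ge0 => //; exact: den_bound_ge0.
  rewrite ZRD ZR1; apply: addr_ge0 => //; exact: (ZR_shiftr_ge0 12 p).
have [K K0 [hl hr]] : exists2 K : R, 0 < K & ZR l * K <= 91 * (PS * den V (pt x)) /\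
    100 * (PS * den U (pt x)) <= ZR r * K.
  exists (2 ^+ 12); first exact: exprn_gt0.
  have /andP[h1 _] := ZR_shiftr R (Z.mul (Zpos 91) (den_bound V bx.1)) 12.
  have /andP[_ h2] := ZR_shiftr R (Z.mul (Zpos 100) (den_bound U bx.2)) 12.
  split; first by apply: (le_trans h1); rewrite ZRM pi91 ler_wpM2l // den_bound_le.
  rewrite /r ZRD ZR1; apply: le_trans (ltW h2).
  by rewrite ZRM pi100 ler_wpM2l // den_bound_ge.
move: l r l0 r0 hl hr t => l r l0 r0 hl hr t.
have gUx : digits3 (U ++ x) by rewrite digits3_cat gU.
have gVx : digits3 (V ++ x) by rewrite digits3_cat gV.
have eU := bounds_sound m_gt0 m_eq gUx; have eV := bounds_sound m_gt0 m_eq gVx.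
have bU := pt_bounds m_gt0 m_eq gUx; have bV := pt_bounds m_gt0 m_eq gVx.
have ll0 : 0 <= ZR (Z.mul l l) by rewrite ZRM mulr_ge0.
have rr0 : 0 <= ZR (Z.mul r r) by rewrite ZRM mulr_ge0.
have := den_test_sound m_gt0 hh ll0 rr0 eU eU eV eV bU bU bV bV t.
rewrite !den_pt_cat // !ZRM.
have := den_pt_gt0 gu gUx; have := den_pt_gt0 gv gVx.
move: (den u _) (den v _) => du dv dv0 du0 T.
have {}T : ZR r * du <= ZR l * dv.
  rewrite -ler_sqr ?nnegrE ?mulr_ge0 // ?(ltW du0) ?(ltW dv0) //.
  by move: T; rewrite !exprMn !expr2.
have dU := den_pt_gt0 (digits3_positive gU) gx; have dV := den_pt_gt0 (digits3_positive gV) gx.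
rewrite -(ler_pM2l (PS_gt0 R)).
apply: (@le_trans _ _ (ZR r * K * du)).
  rewrite (_ : _ * (100 * _) = 100 * (PS * den U (pt x)) * du); last by ring.
  by apply: ler_wpM2r => //; exact: ltW.
apply: (@le_trans _ _ (ZR l * K * dv)).
  by rewrite ![_ * K]mulrC -!mulrA ler_wpM2l // ltW.
rewrite (_ : _ * (91 * _) = 91 * (PS * den V (pt x)) * dv); last by ring.
by apply: ler_wpM2r => //; exact: ltW.
Qed.

Lemma zoom_word_digits3 w : zoom_word w -> digits3 w.
Proof.
(* Induction on the size, since [zoom_word] consumes one or two letters at a time. *)
have [n] := ubnP (size w); elim: n w => // n IH [|[|[|[|[|d]]]] [|[|[|e]] w]] //= /ltnSE lw h.
- by apply: (IH w) => //; apply: leq_trans lw.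
- by have := IH [:: e.+2 & w]; apply.
Qed.
Lemma zoom_word_cat w w' : zoom_word w -> zoom_word w' -> zoom_word (w ++ w').
Proof.
have [n] := ubnP (size w); elim: n w => // n IH [|[|[|[|[|d]]]] [|[|[|e]] w]] //= /ltnSE lw h h'.
- by case: w' h' {IH} => [|[|[|[]]]] // .
- by apply: (IH w) => //; apply: leq_trans lw.
- by have := IH [:: e.+2 & w]; apply.
Qed.

(* At every scale [w] of the zoom, the gap of [V] between the digits 3 and 2 is not longer than
   the hull of the part of [U] with digit 3. *)
Definition expands U V := forall w, zoom_word w ->
  len (V ++ w) [:: 2; 1]%N [:: 3%N] <= len (U ++ w) [:: 3%N] [::].

(* (x21 - x3)/(x3 - m) < 28/23, den U (pt w)/den U (pt (w ++ [2; 1])) < 96/95 and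
   den w m / den w x21 < 46/47, where x21 = pt [2; 1], x3 = pt [3]. *)
Lemma zoom_const : 28 / 23 * (91 / 100) * (91 / 100) * (96 / 95) * (46 / 47) <= 1 :> R.
Proof. lra. Qed.

Lemma mul4_le (e a b c x y A2 A3 Am B2 B3 d2 dm : R) :
  0 <= a -> 0 <= b ->
  0 <= x -> 0 <= y -> 0 <= A3 -> 0 <= Am -> 0 <= B2 -> 0 <= B3 -> 0 <= d2 -> 0 <= dm ->
  e * a * a * b * c <= 1 ->
  A2 <= a * B2 -> A3 <= a * B3 -> Am <= b * A2 -> dm <= c * d2 -> x <= e * y ->
  x * (A3 * (Am * dm)) <= y * (B3 * (B2 * d2)).
Proof.
move=> a0 b0 x0 y0 A30 Am0 B20 B30 d20 dm0 K h2 h3 hA hd hx.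
have {}hA : Am <= b * (a * B2) by apply: (le_trans hA); exact: ler_wpM2l.
have h1 : Am * dm <= (b * (a * B2)) * (c * d2) by exact: ler_pM.
have h4 : A3 * (Am * dm) <= (a * B3) * (b * (a * B2) * (c * d2)).
  by apply: ler_pM => //; apply: mulr_ge0.
have h5 : x * (A3 * (Am * dm)) <= (e * y) * ((a * B3) * (b * (a * B2) * (c * d2))).
  by apply: ler_pM => //; apply: mulr_ge0 => //; apply: mulr_ge0.
apply: (le_trans h5).
have -> : (e * y) * ((a * B3) * (b * (a * B2) * (c * d2))) =
   (e * a * a * b * c) * (y * (B3 * (B2 * d2))) by ring.
by rewrite ler_piMl //; apply: mulr_ge0 => //; apply: mulr_ge0 => //; apply: mulr_ge0.
Qed.

Lemma affine_le (x y a0 a1 : R) : 0 <= y -> 0 <= x -> 0 <= a1 -> a1 <= a0 ->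
  x - y <= 1 / 95 -> a0 + a1 * x <= 96 / 95 * (a0 + a1 * y).
Proof.
move=> y0 x0 a10 a01 xy.
have : 0 <= a1 * (1 / 95 - (x - y)) by apply: mulr_ge0 => //; lra.
have : 0 <= a1 * y by apply: mulr_ge0.
rewrite !mulrBr; lra.
Qed.

(** A nonempty zoom word begins with 3, which keeps all its points in the cylinder of 3 and its
    denominator at least 3. *)
Lemma zoom_tail w : zoom_word w -> w != [::] ->
  [/\ forall a, digits3 a ->
    m <= pt (w ++ a) <= pt [:: 3%N], (3 <= cfd0 w)%N & (cfd0 w <= 4 * cfd1 w)%N].
Proof.
move=> zw; have gw := zoom_word_digits3 zw; move: gw zw.
case: w => // d w /= /andP[_ gw] zw _.
have d3 : d = 3%N by move: zw; case: (d) => [|[|[|[|[]]]]].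
rewrite d3; split.
- move=> a ga; have gwa : digits3 (w ++ a) by rewrite digits3_cat gw.
  have gd : digits3 ((3 :: w) ++ a) by rewrite /= gwa.
  have /andP[h0 _] := pt_bounds m_gt0 m_eq gd.
  have /andP[h1 h2] := pt_bounds m_gt0 m_eq gwa.
  apply/andP; split; first exact: h0.
  rewrite ?cat_cons !pt_cons pt_nil lef_pV2 ?posrE ?lerD2l //; apply: ltr_wpDr => //;
    last exact: ltW.
  by apply: le_trans h1; exact: ltW.
- by rewrite cfd0_cons (leq_trans _ (leq_addr _ _)) // leq_pmulr // cfd0_gt0 // digits3_positive.
- apply: cfd0_le_4cfd1 => //; first by apply: sub_all gw => c /andP[].
  exact: digits3_positive.
Qed.

(** By [den_cat] every denominator is one of [u ++ U] or [v ++ V] times one of [w]. The factor of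
    [w] at [pt [:: 3]] cancels, and the others differ at most by the constants of [zoom_const],
    uniformly in [w]: finitely many tests settle all scales. *)
Lemma expands_test_sound h u v U V : in_half h u v -> positive u -> positive v -> digits3 U ->
  digits3 V ->
  expands_test h U V -> expands (u ++ U) (v ++ V).
Proof.
move=> hh gu gv gU gV /and3P[c1 /(den_ratio_test_sound hh gu gv gU gV) r0 /(den_ratio_test_sound
  hh gu gv gU gV) r3] w zw.
have {}r0 := r0 isT; have {}r3 := r3 isT.
have g (x : seq nat) : digits3 x -> digits3 (U ++ x) by rewrite digits3_cat gU.
have g' (x : seq nat) : digits3 x -> digits3 (V ++ x) by rewrite digits3_cat gV.
have [->|w0] := eqVneq w [::].
  have := len_test_sound m_gt0 m_eq (n := Zpos xH) (d := Zpos xH) hh gu gv gU (g [:: 3%N] isT)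
    (g' [:: 3%N] isT) (g' [:: 2; 1]%N isT) isT isT c1.
  rewrite ZR1 !mul1r !cats0 lenC [leRHS]lenC /len !catA !cats0; exact.
have [tb c3 c4] := zoom_tail zw w0; have gw := zoom_word_digits3 zw.
have guU : positive (u ++ U) by exact: positive_cat_digits3.
have gvV : positive (v ++ V) by exact: positive_cat_digits3.
have gwa a : digits3 a -> digits3 (w ++ a) by rewrite digits3_cat gw.
have guw : positive ((u ++ U) ++ w) by exact: positive_cat_digits3.
have gvw : positive ((v ++ V) ++ w) by exact: positive_cat_digits3.
have lin a : digits3 a -> 100 * den (u ++ U) (pt (w ++ a)) <= 91 * den (v ++ V) (pt (w ++ a)).
  move=> /tb; rewrite pt3 // => /andP[h1 h2]; move: r0 r3; rewrite pt_nil pt3 // /den.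
  move: (pt (w ++ a)) h1 h2 => z h1 h2.
  set a0 := (cfd0 _)%:R; set a1 := (cfd1 _)%:R; set b0 := (cfd0 _)%:R; set b1 := (cfd1 _)%:R.
  move: a0 a1 b0 b1 => a0 a1 b0 b1 r0 r3.
  have L : 0 < (6 - 3 * m) / 17 - m by have := m_lt m_eq; lra.
  rewrite -(ler_pM2r L); move: ((6 - 3 * m) / 17) L h1 h2 r0 r3 => y L h1 h2 r0 r3.
  (* The two end inequalities are combined with the barycentric weights of z between m and [pt
     [:: 3]]. *)
  have e0 : 0 <= (y - z) * (91 * (b0 + b1 * m) - 100 * (a0 + a1 * m)) by apply: mulr_ge0; lra.
  have e3 : 0 <= (z - m) * (91 * (b0 + b1 * y) - 100 * (a0 + a1 * y)) by apply: mulr_ge0; lra.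
  by move: e0 e3; lra.
rewrite !lenE // !(den_pt_cat guU gw) ?(den_pt_cat gvV gw) //.
have pw a : digits3 a -> 0 < den w (pt a) by move=> ga; apply: den_pt_gt0 => //;
  exact: digits3_positive.
have pA a : digits3 a -> 0 < den (u ++ U) (pt (w ++ a)).
  by move=> ga; apply: den_pt_gt0 => //; exact: gwa.
have pB a : digits3 a -> 0 < den (v ++ V) (pt (w ++ a)).
  by move=> ga; apply: den_pt_gt0 => //; exact: gwa.
have [g0 g2 g3] : [/\ digits3 [::], digits3 [:: 2; 1]%N & digits3 [:: 3%N]] by [].
rewrite ler_pdivrMr; last by apply: mulr_gt0; apply: mulr_gt0;
  [exact: pB|exact: pw|exact: pB|exact: pw].
rewrite mulrAC ler_pdivlMr; last by apply: mulr_gt0; apply: mulr_gt0;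
  [exact: pA|exact: pw|exact: pA|exact: pw].
have := m_lt m_eq; have := m_gt m_gt0 m_eq => m1 m2.
have hx : `|pt [:: 2; 1]%N - pt [:: 3%N]| <= 28 / 23 * `|pt [:: 3%N] - pt [::]|.
  rewrite pt21 pt3 pt_nil ger0_norm; last by lra.
  by rewrite ger0_norm; lra.
have hd : den w (pt [::]) <= 46 / 47 * den w (pt [:: 2; 1]%N).
  rewrite pt21 pt_nil /den;
    have {c4} : (cfd0 w)%:R <= 4 * (cfd1 w)%:R :> R by rewrite -natrM ler_nat.
  have : 0 <= (cfd1 w)%:R :> R by [].
  move: (cfd0 w)%:R (cfd1 w)%:R => e0 e1 e10 e04.
  have : 0 <= e1 * (46 * ((1 + 3 * m) / 5) - 47 * m - 4) by apply: mulr_ge0 => //; lra.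
  lra.
have hA : den (u ++ U) (pt (w ++ [::])) <= 96 / 95 * den (u ++ U) (pt (w ++ [:: 2; 1]%N)).
  (* The distance of the tails is [pt [:: 2; 1]] - m < 9/95, and both denominators of [w] are at
     least 3. *)
  have : `|pt (w ++ [::]) - pt (w ++ [:: 2; 1]%N)| <= 1 / 95.
    rewrite -/(len w [::] [:: 2; 1]%N) lenE ?digits3_positive // ler_pdivrMr;
      last by rewrite mulr_gt0 ?pw.
    rewrite pt21 pt_nil ltr0_norm; last by lra.
    have d3 a : digits3 a -> 3 <= den w (pt a).
      move=> /digits3_pt[_ a0]; apply: le_trans (den_ge_cfd0 _ a0); by rewrite ler_nat.
    have : 3 * 3 <= den w (pt [::]) * den w (pt [:: 2; 1]%N) by apply: ler_pM => //; apply: d3.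
    rewrite pt21 pt_nil; move: (den w _ * _) => D; lra.
  have := cfd1_le_cfd0 guU; rewrite -(ler_nat R) /den.
  have : 0 <= (cfd1 (u ++ U))%:R :> R by [].
  have [_] := digits3_pt (gwa [::] isT); have [_] := digits3_pt (gwa [:: 2; 1]%N isT).
  move: (pt _) (pt _) (cfd0 _)%:R (cfd1 _)%:R => x y a0 a1 y0 x0 a10 a01 .
  by rewrite ler_norml => /andP[_]; apply: affine_le.
rewrite [leLHS](_ : _ = `|pt [:: 2; 1]%N - pt [:: 3%N]| * (den (u ++ U) (pt (w ++ [:: 3%N])) *
  (den (u ++ U) (pt (w ++ [::])) * den w (pt [::]))) * den w (pt [:: 3%N])); last by ring.
rewrite [leRHS](_ : _ = `|pt [:: 3%N] - pt [::]| * (den (v ++ V) (pt (w ++ [:: 3%N])) *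
  (den (v ++ V) (pt (w ++ [:: 2; 1]%N)) * den w (pt [:: 2; 1]%N))) * den w (pt [:: 3%N]));
    last by ring.
apply: ler_wpM2r; first by apply/ltW/pw.
have L a : digits3 a -> den (u ++ U) (pt (w ++ a)) <= 91 / 100 * den (v ++ V) (pt (w ++ a)).
  by move=> /lin; move: (den _ _) (den _ _) => a0 a1; lra.
apply: (mul4_le _ _ _ _ _ _ _ _ _ _ zoom_const (L _ g2) (L _ g3) hA hd hx);
  first [exact: normr_ge0 | exact/ltW/pA | exact/ltW/pB | exact/ltW/pw | exact: divr_ge0].
Qed.
End Zoom.

Lemma strip_cat u v w : strip u v = Some w -> v = u ++ w.
Proof.
elim: u v => [|d u IH] [|e v] //=; try by case.
by case E: (PeanoNat.Nat.eqb d e) => // /IH ->; rewrite (PeanoNat.Nat.eqb_eq d e).1.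
Qed.

Lemma eq_germP g h : eq_germ g h -> g = h.
Proof. by case: g h => [a b] [c d] /andP[/= /eq_wordP -> /eq_wordP ->]. Qed.

(** * The invariant and its refinement *)

Section Corners.
Variables (R : realFieldType) (m : R).
Hypotheses (m_gt0 : 0 < m) (m_eq : 3 * m ^+ 2 + 3 * m = 1).
Local Notation pt := (pt m).
Local Notation ZR := (ZR R).
Local Notation len := (len m).
Local Notation in_half := (in_half m).
Local Notation expands := (expands m).
Local Notation hull_den := (hull_den m).

Lemma len_gt0 u a b : positive u -> digits3 a -> digits3 b -> pt a != pt b -> 0 < len u a b.
Proof.
move=> gu ga gb ab; rewrite lenE // divr_gt0 ?normr_gt0 ?subr_eq0 //.
by apply: mulr_gt0; apply: (den_pt_gt0 m_gt0 m_eq).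
Qed.

Lemma len_cat u w a b : len (u ++ w) a b = len u (w ++ a) (w ++ b).
Proof. by rewrite /len -!catA. Qed.

Lemma sign_len u a b : positive u -> digits3 a -> digits3 b -> pt a <= pt b ->
  (-1) ^+ odd (size u) * (pt (u ++ b) - pt (u ++ a)) = len u a b.
Proof.
move=> gu ga gb ab; rewrite lenC lenE // !pt_cat.
have [_ a0] := digits3_pt m_gt0 m_eq ga; have [_ b0] := digits3_pt m_gt0 m_eq gb.
rewrite cfvalB // signr_odd 2!mulrA -signr_odd -expr2 sqrr_sign mul1r.
by rewrite ger0_norm // subr_ge0.
Qed.

Definition pos u v (g : germ) : R := pt (u ++ g.1) + pt (v ++ g.2).

Definition beyond (b : bool) (z x : R) := 0 <= (-1) ^+ b * (z - x).

(* [b] is the direction: [false] for the lower corner, [true] for the upper one. *)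
Definition corner b U V z :=
  [\/ (expands U V \/ expands V U) /\ beyond b z (pos U V ([::], [::])),
      beyond b z (pos U V ([:: 2; 1]%N, [::])) | beyond b z (pos U V ([::], [:: 2; 1]%N))].

(* The gap between the digits 2 and 1 is the largest one; the factor 6/5 is the margin that
   makes the invariant survive refinement. *)
Definition link u v :=
  6 * len v [:: 2%N] [:: 1; 1]%N <= 5 * len u [::] [:: 1%N] /\
  6 * len u [:: 2%N] [:: 1; 1]%N <= 5 * len v [::] [:: 1%N].

Definition parity (u v : seq nat) := odd (size u) (+) odd (size v).

(** The two corners are named after the tail of [u], m for the first and 3 m for the second, and
    [parity] selects the matching end of [v]. Nothing here says that z is a sum: z lies between the
    corners, at each of them for a reason that can be passed on. *)
Definition covers u v z :=
  [/\ positive u, positive v, link u v,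
      corner (odd (size u)) u (v ++ end1 (parity u v)) z &
      corner (~~ odd (size u)) (u ++ [:: 1%N]) (v ++ end1 (~~ parity u v)) z].

Lemma corner_sym b U V z : corner b U V z -> corner b V U z.
Proof.
by rewrite /corner /pos /= !cats0; case=> [[[e|e] h]|h|h];
  [apply: Or31|apply: Or31|apply: Or33|apply: Or32]; rewrite addrC //; auto.
Qed.

Lemma covers_sym u v z : covers u v z -> covers v u z.
Proof.
move=> [gu gv [l1 l2] /corner_sym c1 /corner_sym c2]; split => //.
  move: c1 c2; rewrite /parity; case: (odd (size u)); case: (odd (size v)); rewrite /= ?cats0 //.
move: c1 c2; rewrite /parity; case: (odd (size u)); case: (odd (size v)); rewrite /= ?cats0 //.
Qed.

Definition in_box bx u v :=
  [/\ par bx = parity u v, in_half (hA bx) u v & in_half (hB bx) v u].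

Definition germ3 (g : germ) := digits3 g.1 && digits3 g.2.

Section Box.
Variables (bx : box) (u v : seq nat) (z : R).
Hypotheses (gu : positive u) (gv : positive v) (ib : in_box bx u v).

Lemma len_testA_sound n d x x' y y' : Z.leb Z0 n -> Z.leb Z0 d ->
  digits3 x -> digits3 x' -> digits3 y -> digits3 y' -> len_testA bx n d x x' y y' ->
  ZR n * len v y y' <= ZR d * len u x x'.
Proof. by case: ib => _ h _ n0 d0 gx gx' gy gy'; apply: (len_test_sound m_gt0 m_eq h). Qed.

Lemma len_testB_sound n d x x' y y' : Z.leb Z0 n -> Z.leb Z0 d ->
  digits3 x -> digits3 x' -> digits3 y -> digits3 y' -> len_testB bx n d x x' y y' ->
  ZR n * len u x x' <= ZR d * len v y y'.
Proof. by case: ib => _ _ h n0 d0 gx gx' gy gy'; apply: (len_test_sound m_gt0 m_eq h). Qed.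

Lemma link_test_sound a b : digits3 a -> digits3 b -> link_test bx a b -> link (u ++ a) (v ++ b).
Proof.
move=> ga gb /andP[] h1 h2; split; rewrite !len_cat !cats0.
  by have := len_testA_sound (n := Zpos 6) (d := Zpos 5) isT isT _ _ _ _ h1;
    rewrite !ZR_pos !digits3_cat ga gb /=; apply.
by have := len_testB_sound (n := Zpos 6) (d := Zpos 5) isT isT _ _ _ _ h2;
  rewrite !ZR_pos !digits3_cat ga gb /=; apply.
Qed.

Lemma unlinked_sound : unlinked bx -> ~ link u v.
Proof.
have l1 w : positive w -> 0 < len w [::] [:: 1%N].
  by move=> gw; apply: len_gt0 => //; rewrite pt_nil pt1 // lt_eqF //; move: m_gt0; lra.
have [lu lv] := (l1 u gu, l1 v gv).
have E1 : ZR (Zpos 5005) = 1001 * 5 by rewrite ZR_pos -natrM.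
have E2 : ZR (Zpos 6000) = 1000 * 6 by rewrite ZR_pos -natrM.
case/orP => h [k1 k2].
  have := len_testB_sound (n := Zpos 5005) (d := Zpos 6000) isT isT _ _ _ _ h.
  by rewrite E1 E2 => /(_ isT isT isT isT); lra.
have := len_testA_sound (n := Zpos 5005) (d := Zpos 6000) isT isT _ _ _ _ h.
by rewrite E1 E2 => /(_ isT isT isT isT); lra.
Qed.

Lemma corner_cert_sound g : germ3 g -> corner_cert bx g ->
  expands (u ++ g.1) (v ++ g.2) \/ expands (v ++ g.2) (u ++ g.1).
Proof.
case: ib => _ hA hB /andP[g1 g2] /orP[] h.
  by left; apply: (expands_test_sound m_gt0 m_eq hA).
by right; apply: (expands_test_sound m_gt0 m_eq hB).
Qed.

Definition option_holds b o g :=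
  [/\ beyond b z (pos u v (option_point o g)),
      is_full o -> expands (u ++ g.1) (v ++ g.2) \/ expands (v ++ g.2) (u ++ g.1),
      (if o is Plus then expands (u ++ g.1) (v ++ g.2) else True) &
      (if o is Minus then expands (v ++ g.2) (u ++ g.1) else True)].

Lemma pos_cat U V h : pos (u ++ U) (v ++ V) h = pos u v (U ++ h.1, V ++ h.2).
Proof. by rewrite /pos -!catA. Qed.

Definition oriented b (g : germ) := (odd (size (u ++ g.1)) == b) && (odd (size (v ++ g.2)) == b).

Lemma beyond_trans (b : bool) (x y : R) : 0 <= (-1) ^+ b * (y - x) -> beyond b z y -> beyond b z x.
Proof.
rewrite /beyond => h1 h2; have -> : z - x = (z - y) + (y - x) by ring.
by rewrite mulrDr addr_ge0.
Qed.

Lemma beyond_cut1 b g : germ3 g -> oriented b g ->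
  beyond b z (pos u v (cut1 g)) -> beyond b z (pos u v g).
Proof.
move=> /andP[g1 g2] /andP[/eqP b1 _]; apply: beyond_trans.
rewrite /pos /= catA opprD addrACA subrr addr0 -b1.
have := @sign_len (u ++ g.1) [::] [:: 2; 1]%N; rewrite !cats0 positive_cat_digits3 // => -> //;
  first exact: len_ge0.
by rewrite pt_nil pt21 //; move: (m_lt m_eq); lra.
Qed.

Lemma beyond_cut2 b g : germ3 g -> oriented b g ->
  beyond b z (pos u v (cut2 g)) -> beyond b z (pos u v g).
Proof.
move=> /andP[g1 g2] /andP[_ /eqP b2]; apply: beyond_trans.
rewrite /pos /= catA opprD addrACA subrr add0r -b2.
have := @sign_len (v ++ g.2) [::] [:: 2; 1]%N; rewrite !cats0 positive_cat_digits3 // => -> //;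
  first exact: len_ge0.
by rewrite pt_nil pt21 //; move: (m_lt m_eq); lra.
Qed.

Lemma expands_nil U V : expands U V -> len V [:: 2; 1]%N [:: 3%N] <= len U [:: 3%N] [::].
Proof. by move/(_ [::] isT); rewrite !cats0. Qed.

Lemma corner_options_sound b g : germ3 g -> oriented b g -> corner b (u ++ g.1) (v ++ g.2) z ->
  exists2 o, List.In o (corner_options bx g) & option_holds b o g.
Proof.
case: g => U V gg og; have /andP[/= g1 g2] := gg; rewrite /corner !pos_cat /= !cats0.
have D a : positive a -> 0 < len a [::] [:: 3%N].
  move=> ga; apply: len_gt0 => //; rewrite pt_nil pt3 // lt_eqF //.
  by move: (m_lt m_eq); lra.
rewrite /corner_options; case E: (corner_cert bx _) => h.
  (* A point beyond a first gap is a fortiori beyond the corner, so bridging by computation covers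
     all three cases. *)
  exists Cert; first by left.
  have cs := corner_cert_sound gg E; split=> //.
  by case: h => [[_ h]|h|h]; [exact: h|exact: (beyond_cut1 gg og)|exact: (beyond_cut2 gg og)].
have K (a c : R) : 0 < a -> 1001 * a <= 1000 * c -> c <= a -> False by lra.
have E1 : ZR (Zpos 1001) = 1001 by rewrite ZR_pos.
have E2 : ZR (Zpos 1000) = 1000 by rewrite ZR_pos.
case: h => [[[e|e] h]|h|h].
- exists Plus; last by split=> //; left.
  case F: len_testB; last by left.
  have := len_testB_sound (n := Zpos 1001) (d := Zpos 1000) isT isT _ _ _ _ F;
    rewrite E1 E2 !digits3_cat g1 g2 /= => /(_ isT isT isT isT).
  have := expands_nil e; rewrite !len_cat !cats0 [X in _ <= X]lenC [X in X <= _]lenC => h1 h2.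
  case: (K _ _ _ h2 h1); have := D (u ++ U); rewrite positive_cat_digits3 // len_cat cats0; exact.
- exists Minus; last by split=> //; right.
  case G: (len_testB _ _ _ _ _ _ _); case F: len_testA; rewrite /=; try by [left | right; left].
  + have := len_testA_sound (n := Zpos 1001) (d := Zpos 1000) isT isT _ _ _ _ F;
    rewrite E1 E2 !digits3_cat g1 g2 /= => /(_ isT isT isT isT).
    have := expands_nil e; rewrite !len_cat !cats0 [X in _ <= X]lenC [X in X <= _]lenC => h1 h2.
    case: (K _ _ _ h2 h1); have := D (v ++ V); rewrite positive_cat_digits3 // len_cat cats0; exact.
  + have := len_testA_sound (n := Zpos 1001) (d := Zpos 1000) isT isT _ _ _ _ F;
    rewrite E1 E2 !digits3_cat g1 g2 /= => /(_ isT isT isT isT).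
    have := expands_nil e; rewrite !len_cat !cats0 [X in _ <= X]lenC [X in X <= _]lenC => h1 h2.
    case: (K _ _ _ h2 h1); have := D (v ++ V); rewrite positive_cat_digits3 // len_cat cats0; exact.
- by exists Cut1; first by case: len_testB; case: len_testA => /=; tauto.
- by exists Cut2; first by case: len_testB; case: len_testA => /=; tauto.
Qed.

Lemma expands_cat U V w : zoom_word w -> expands U V -> expands (U ++ w) (V ++ w).
Proof. by move=> zw e w' zw'; rewrite -!catA; apply: e; apply: zoom_word_cat. Qed.

Definition germ_expands g := expands (u ++ g.1) (v ++ g.2) \/ expands (v ++ g.2) (u ++ g.1).

Lemma inherits_sound g h : inherits g h -> germ_expands h -> germ_expands g.
Proof.
rewrite /inherits; case E1: (strip _ _) => [w|//]; case E2: (strip _ _) => [w'|//].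
case/andP => /eq_wordP ww zw; rewrite /germ_expands (strip_cat E1) (strip_cat E2) -ww !catA.
by case=> e; [left|right]; apply: expands_cat.
Qed.

Lemma pt_canon w : pt (canon w) = pt w.
Proof. by rewrite /canon; case E: (eq_word _ _) => //; rewrite (eq_wordP E) pt_nil31. Qed.

Lemma digits3_canon w : digits3 w -> digits3 (canon w).
Proof. by rewrite /canon; case: (eq_word _ _). Qed.

Lemma cmp_wordP x y : digits3 x -> digits3 y ->
  match cmp_word x y with
  | Some Eq => x = y | Some Lt => pt x <= pt y | Some Gt => pt y <= pt x | None => True
  end.
Proof.
move=> gx gy; rewrite /cmp_word; case E: (eq_word x y); first exact: eq_wordP.
have [_ x1 x2] := bounds_sound m_gt0 m_eq gx; have [_ y1 y2] := bounds_sound m_gt0 m_eq gy.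
case F: Z.leb.
  move/(ZR_le R): F => F; rewrite -(ler_pM2l (PS_gt0 R)); lra.
case G: Z.leb => //.
by move/(ZR_le R): G => G; rewrite -(ler_pM2l (PS_gt0 R)); lra.
Qed.

Lemma sign_parity : (-1) ^+ odd (size u) = (-1) ^+ parity u v * (-1) ^+ odd (size v) :> R.
Proof. by rewrite -signr_addb /parity -addbA addbb addbF. Qed.

Lemma pos_test_sound q r : germ3 q -> germ3 r -> pos_test bx q r ->
  0 <= (-1) ^+ odd (size u) * (pos u v r - pos u v q).
Proof.
case: ib => pb _ _; move: q r => [x y] [x' y'] /andP[/= gx gy] /andP[/= gx' gy'].
rewrite /pos_test /pos /=.
rewrite ![pt (_ ++ _)]pt_cat -(pt_canon x) -(pt_canon y) -(pt_canon x') -(pt_canon y') -!pt_cat.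
move: (digits3_canon gx) (digits3_canon gy) (digits3_canon gx') (digits3_canon gy').
move: (canon x) (canon y) (canon x') (canon y') => {gx gy gx' gy'} {}x {}y {}x' {}y' gx gy gx' gy'.
rewrite opprD addrACA mulrDr {2}sign_parity -mulrA pb.
have := cmp_wordP gx gx'; have := cmp_wordP gy gy'.
have lu := len_ge0 m u x x'; have lv := len_ge0 m v y y'.
have Lu : pt x <= pt x' -> (-1) ^+ odd (size u) * (pt (u ++ x') - pt (u ++ x)) = len u x x'.
  by move=> h; apply: sign_len.
have Gu : pt x' <= pt x -> (-1) ^+ odd (size u) * (pt (u ++ x') - pt (u ++ x)) = - len u x x'.
  by move=> h; rewrite -opprB mulrN sign_len // lenC.
have Lv : pt y <= pt y' -> (-1) ^+ odd (size v) * (pt (v ++ y') - pt (v ++ y)) = len v y y'.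
  by move=> h; apply: sign_len.
have Gv : pt y' <= pt y -> (-1) ^+ odd (size v) * (pt (v ++ y') - pt (v ++ y)) = - len v y y'.
  by move=> h; rewrite -opprB mulrN sign_len // lenC.
have GA : len_testA bx 1 1 x x' y y' -> len v y y' <= len u x x'.
  by move/(len_testA_sound (n := Zpos 1) (d := Zpos 1) isT isT gx gx' gy gy'); rewrite !ZR1 !mul1r.
have GB : len_testB bx 1 1 x x' y y' -> len u x x' <= len v y y'.
  by move/(len_testB_sound (n := Zpos 1) (d := Zpos 1) isT isT gx gx' gy gy'); rewrite !ZR1 !mul1r.
case: (cmp_word x x') => [[]|] //; case: (cmp_word y y') => [[]|] //=; case: (parity u v) => //=;
  rewrite ?expr0 ?expr1 ?mul1r ?mulN1r => h1 h2 h3.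
all: first [rewrite (Lu h2)|rewrite (Gu h2)|rewrite h2 subrr mulr0];
  first [rewrite (Lv h1)|rewrite (Gv h1)|rewrite h1 subrr mulr0];
  try move: (GA h3); try move: (GB h3); move: lu lv; move: (len u _ _) (len v _ _) => lu lv; lra.
Qed.

(** The difference of the two sums is the hull of the digit 3 in one summand minus the gap between 3
    and 2 in the other: the bridging hypothesis at the empty zoom word. *)
Lemma hyp_test_sound b oL q r : option_holds b oL (low_corner (par bx) ([::], [::])) ->
  hyp_test bx oL q r ->
  0 <= (-1) ^+ odd (size u) * (pos u v r - pos u v q).
Proof.
case: ib => pb _ _ [_ _] hp hm; rewrite /hyp_test => /and3P[/negbTE np /eq_germP ->].
move: hp hm; rewrite np => hp hm; rewrite pb in np.
have sp : (-1) ^+ odd (size u) = (-1) ^+ odd (size v) :> R by rewrite sign_parity np mul1r.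
have x3 : pt [::] <= pt [:: 3%N] by rewrite pt_nil pt3 //; move: (m_lt m_eq); lra.
have x2 : pt [:: 3%N] <= pt [:: 2; 1]%N.
  by rewrite pt21 // pt3 //; move: (m_gt m_gt0 m_eq); lra.
have E w : pt (w ++ [:: 3; 1]%N) = pt (w ++ [::]) by rewrite !pt_cat pt_nil31.
have C w : positive w -> 
   (-1) ^+ odd (size w) * (pt (w ++ [:: 3%N]) - pt (w ++ [:: 2; 1]%N)) = - len w [:: 2;
     1]%N [:: 3%N].
  by move=> gw; rewrite -opprB mulrN sign_len // lenC.
have C' w : positive w -> 
   (-1) ^+ odd (size w) * (pt (w ++ [:: 3%N]) - pt (w ++ [::])) = len w [:: 3%N] [::].
  by move=> gw; rewrite sign_len // lenC.
move: hp hm; rewrite /= !cats0; case: oL => // hp hm /eq_germP ->;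
  rewrite /pos /= E opprD addrACA mulrDr.
  by rewrite C' // sp C // subr_ge0; apply: expands_nil.
by rewrite C // sp C' // addrC subr_ge0; apply: expands_nil.
Qed.

Lemma find_info_sound c l lk cl ch : find_info c (child_infos bx l) = (lk, cl, ch) ->
  [/\ lk -> link_test bx c.1 c.2, cl -> corner_cert bx (low_corner (par bx) c) & ch ->
    corner_cert bx (high_corner (par bx) c)].
Proof.
elim: l => [|d l IH] /=; first by move=> [<- <- <-].
case E: (eq_germ c d) => //; rewrite (eq_germP E);
  case: (link_test bx d.1 d.2) => /= -[<- <- <-] //.
Qed.

Lemma covers_child c : germ3 c -> link (u ++ c.1) (v ++ c.2) ->
  corner (odd (size u)) (u ++ (low_corner (parity u v) c).1) (v ++ (low_corner (parity u v) c).2)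
    z ->
  corner (~~ odd (size u)) (u ++ (high_corner (parity u v) c).1) (v ++ (high_corner (parity u v)
    c).2) z ->
  covers (u ++ c.1) (v ++ c.2) z.
Proof.
case: c => a b /andP[/= ga gb] lk; rewrite /low_corner /high_corner /= !catA => lo hi.
split; rewrite ?positive_cat_digits3 //; move: lo hi; rewrite /parity !size_cat !oddD;
  case: (odd (size u)); case: (odd (size v)); case: (odd (size a)); case: (odd (size b));
  rewrite /= ?cats0 //.
Qed.

Lemma low_corner_germ3 p c : germ3 c -> germ3 (low_corner p c).
Proof.
case: c => a b /andP[/= ga gb]; rewrite /germ3 /low_corner /= !digits3_cat ga gb.
by case: (odd _); case: (p (+) _).
Qed.

Lemma high_corner_germ3 p c : germ3 c -> germ3 (high_corner p c).
Proof.
case: c => a b /andP[/= ga gb]; rewrite /germ3 /high_corner /= !digits3_cat ga gb.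
by case: (odd _); case: (p (+) _).
Qed.

Lemma child_points_germ3 (full_corner : bool) g : germ3 g -> all germ3 (child_points full_corner g).
Proof.
by case: full_corner; case: g => a b /andP[/= ga gb]; rewrite /= /germ3 /= ?digits3_cat ?ga ?gb.
Qed.

Lemma option_point_germ3 o g : germ3 g -> germ3 (option_point o g).
Proof. by case: o; case: g => a b /andP[/= ga gb]; rewrite /= /germ3 /= ?digits3_cat ?ga ?gb. Qed.

Lemma full_corner_sound bL bR oL oR (crt : bool) g : germ3 g -> (crt -> corner_cert bx g) ->
  option_holds bL oL (low_corner (par bx) ([::], [::])) ->
    option_holds bR oR (high_corner (par bx) ([::], [::])) ->
  full_corner (par bx) oL oR crt g -> germ_expands g.
Proof.
move=> gg hc [_ hL _ _] [_ hR _ _] /or3P[/hc|/andP[/hL h /inherits_sound]|/andP[/hR h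
  /inherits_sound]].
- exact: corner_cert_sound.
- exact.
- exact.
Qed.

Lemma child_points_corner b g (full_corner : bool) s : germ3 g -> (full_corner -> germ_expands g) ->
  s \in child_points full_corner g -> beyond b z (pos u v s) -> corner b (u ++ g.1) (v ++ g.2) z.
Proof.
case: g => U V gg fe; rewrite /corner !pos_cat /= !cats0; case: full_corner fe => fe /=.
  by rewrite inE => /eqP -> h; apply: Or31; split => //; exact: fe.
by rewrite !inE => /orP[] /eqP -> h; [apply: Or32|apply: Or33].
Qed.

Lemma check_chain_sound oL oR cs l prevs : all germ3 l -> all germ3 prevs ->
  option_holds (odd (size u)) oL (low_corner (par bx) ([::], [::])) ->
  option_holds (~~ odd (size u)) oR (high_corner (par bx) ([::], [::])) ->
  {in prevs, forall e, beyond (odd (size u)) z (pos u v e)} ->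
  check_chain bx oL oR (child_infos bx cs) prevs l ->
  exists2 c, c \in l & covers (u ++ c.1) (v ++ c.2) z.
Proof.
have [pb _ _] := ib; move=> + + hL hR; elim: l prevs => // c l IH prevs /andP[gc gl] gp hp.
rewrite [check_chain _ _ _ _ _ _]/=; case E: (find_info _ _) => [[lk cl] ch].
have [hk hcl hch] := find_info_sound E.
set ss := child_points _ _;
  set es := child_points _ _ => /and3P[/hk lkb /hasP[s s_in /hasP[e e_in se]] next].
have gL := low_corner_germ3 (par bx) gc; have gH := high_corner_germ3 (par bx) gc.
have fL := full_corner_sound gL hcl hL hR; have fH := full_corner_sound gH hch hL hR.
have /allP gss : all germ3 ss by exact: child_points_germ3.
have /allP ges : all germ3 es by exact: child_points_germ3.
have bs : beyond (odd (size u)) z (pos u v s).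
  apply: beyond_trans (hp _ e_in); case/orP: se => [|/(hyp_test_sound hL)] //.
  by apply: pos_test_sound; [exact: gss|exact: (allP gp)].
have cL := child_points_corner gL fL s_in bs.
have [/hasP[x x_in bx_]|/hasPn nb] := boolP (has (fun x => ~~ (0 <= (-1) ^+ odd (size u) * (z -
  pos u v x))) es).
  exists c; first exact: mem_head.
  have /andP[g1 g2] := gc.
  apply: covers_child => //; first exact: link_test_sound; rewrite -pb //.
  apply: (child_points_corner gH fH x_in); move: bx_;
    rewrite -ltNge /beyond signrN mulNr oppr_ge0; exact: ltW.
have {}nb : {in es, forall x, beyond (odd (size u)) z (pos u v x)} by move=> x /nb; rewrite negbK.
case: l gl next IH => [_|d l gl] next IH.
  (* For the last child, the bound on z comes from the reason at the high corner of the parent. *)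
  case/hasP: next => x x_in /pos_test_sound h; exists c; first exact: mem_head.
  have /andP[g1 g2] := gc; have gO : germ3 (option_point oR (high_corner (par bx) ([::], [::]))).
    by apply: option_point_germ3; apply: high_corner_germ3.
  apply: covers_child => //; first exact: link_test_sound; rewrite -pb //.
  apply: (child_points_corner gH fH x_in); case: hR => hR _ _ _; apply: beyond_trans hR.
  by rewrite signrN mulNr -mulrN opprB; apply: h => //; exact: ges.
have ges' : all germ3 es by apply/allP.
have [x x_in ix] := IH es gl ges' nb next.
by exists x => //; rewrite in_cons x_in orbT.
Qed.

Lemma all_In T (P : pred T) s x : all P s -> List.In x s -> P x.
Proof. by elim: s => //= y s IH /andP[py /IH h] [<-|/h]. Qed.

Lemma check_leaf_sound cs : all (all germ3) cs -> check_leaf bx cs -> covers u v z ->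
  exists l c, [/\ l \in cs, c \in l & covers (u ++ c.1) (v ++ c.2) z].
Proof.
have [pb _ _] := ib; move=> gcs lf [_ _ _ cL cR].
have gL : germ3 (low_corner (par bx) ([::], [::])) by exact: low_corner_germ3.
have gR : germ3 (high_corner (par bx) ([::], [::])) by exact: high_corner_germ3.
have [oL oL_in hL] : exists2 o, List.In o (corner_options bx (low_corner (par bx) ([::], [::]))) &
    option_holds (odd (size u)) o (low_corner (par bx) ([::], [::])).
  apply: corner_options_sound => //; rewrite ?/oriented pb /= ?cats0 ?addbF //.
  by rewrite size_cat oddD eqxx /parity; case: (odd (size u)); case: (odd (size v)).
have [oR oR_in hR] : exists2 o, List.In o (corner_options bx (high_corner (par bx) ([::], [::]))) &
    option_holds (~~ odd (size u)) o (high_corner (par bx) ([::], [::])).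
  apply: corner_options_sound => //; rewrite ?/oriented pb /= ?addbF //.
  by rewrite !size_cat !oddD /parity; case: (odd (size u)); case: (odd (size v)).
have := all_In (all_In lf oL_in) oR_in => /hasP[l l_in ch].
have gl := allP gcs _ l_in.
have p1 : {in [:: option_point oL (low_corner (par bx) ([::], [::]))], forall e, beyond (odd (size
  u)) z (pos u v e)}.
  by move=> e; rewrite inE => /eqP ->; case: hL.
have gp : all germ3 [:: option_point oL (low_corner (par bx) ([::], [::]))] by rewrite /= andbT
  option_point_germ3.
have [c c_in ic] := check_chain_sound gl gp hL hR p1 ch.
by exists l, c.
Qed.
End Box.

Lemma select_chains_mem k cs l : l \in select_chains k cs -> l \in cs.
Proof.
elim: cs k => // c cs IH k; rewrite /= !inE; case: odd; rewrite ?inE.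
  by case/orP => [->//|/IH ->]; rewrite orbT.
by move/IH ->; rewrite orbT.
Qed.

Definition proper_germ (c : germ) := germ3 c && (c != ([::], [::])).

Lemma chains_proper p : all (all proper_germ) (chains p).
Proof. by case: p. Qed.

Lemma midpoint_ge0 a b : 0 <= ZR a -> 0 <= ZR b -> 0 <= ZR (midpoint a b).
Proof.
rewrite /midpoint !ler0z => a0 b0; have := Z.div2_nonneg (Z.add a b); lia.
Qed.

Lemma mkbox_sound p u v a0 a1 b0 b1 w0 w1 : positive u -> positive v -> p = parity u v ->
  0 <= ZR a0 -> 0 <= ZR b0 -> 0 <= ZR w0 ->
  ZR a0 <= TS R * slope R u <= ZR a1 -> ZR b0 <= TS R * slope R v <= ZR b1 ->
  ZR w0 * hull_den v <= ZR wscale * hull_den u <= ZR w1 * hull_den v ->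
  in_box (mkbox p a0 a1 b0 b1 w0 w1) u v.
Proof.
move=> gu gv pp a00 b00 w00 ha hb /andP[h0 h1].
have s0 : 0 < ZR wscale by rewrite ZR_pos ltr0n.
have w10 : 0 <= ZR w1.
  have hv := hull_den_gt0 m_gt0 gv; have hu := hull_den_gt0 m_gt0 gu.
  by rewrite -(pmulr_lge0 _ hv); apply: le_trans h1; rewrite mulr_ge0 // ltW.
by split=> //; apply: mkhalf_sound => //; exact: ltW.
Qed.

Lemma check_cover_sound n l l' p u v z a0 a1 b0 b1 w0 w1 : positive u -> positive v ->
  p = parity u v ->
  0 <= ZR a0 -> 0 <= ZR b0 -> 0 <= ZR w0 -> 0 <= ZR a1 -> 0 <= ZR b1 -> 0 <= ZR w1 ->
  ZR a0 <= TS R * slope R u <= ZR a1 -> ZR b0 <= TS R * slope R v <= ZR b1 ->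
  ZR w0 * hull_den v <= ZR wscale * hull_den u <= ZR w1 * hull_den v ->
  check_cover n l p a0 a1 b0 b1 w0 w1 = Some l' -> covers u v z ->
  exists2 c, proper_germ c & covers (u ++ c.1) (v ++ c.2) z.
Proof.
move=> gu gv pp; elim: n l l' a0 a1 b0 b1 w0 w1 => // n IH [|[|[|k]] l] l' a0 a1 b0 b1 w0 w1
  a00 b00 w00 a10 b10 w10 ha hb hw //.
- rewrite [check_cover _ _ _ _ _ _ _ _ _]/=.
  case: split_axis => [|[|_]].
  + case E: (check_cover n l _ _ _ _ _ _ _) => [l1|//] E' iv.
    have m0 := midpoint_ge0 a00 a10; move: (midpoint a0 a1) m0 E E' => c m0 E E'.
    have [hc|hc] := leP (TS R * slope R u) (ZR c).
      by apply: IH E iv => //; rewrite hc; case/andP: ha => ->.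
    by apply: IH E' iv => //; rewrite (ltW hc); case/andP: ha => _ ->.
  + case E: (check_cover n l _ _ _ _ _ _ _) => [l1|//] E' iv.
    have m0 := midpoint_ge0 b00 b10; move: (midpoint b0 b1) m0 E E' => c m0 E E'.
    have [hc|hc] := leP (TS R * slope R v) (ZR c).
      by apply: IH E iv => //; rewrite hc; case/andP: hb => ->.
    by apply: IH E' iv => //; rewrite (ltW hc); case/andP: hb => _ ->.
  + case E: (check_cover n l _ _ _ _ _ _ _) => [l1|//] E' iv.
    have m0 := midpoint_ge0 w00 w10; move: (midpoint w0 w1) m0 E E' => c m0 E E'.
    have [hc|hc] := leP (ZR wscale * hull_den u) (ZR c * hull_den v).
      by apply: IH E iv => //; rewrite hc; case/andP: hw => ->.
    by apply: IH E' iv => //; rewrite (ltW hc); case/andP: hw => _ ->.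
- rewrite [check_cover _ _ _ _ _ _ _ _ _]/=; case E: unlinked => // _ [_ _ lk _ _].
  by case: (unlinked_sound gu gv (mkbox_sound gu gv pp a00 b00 w00 ha hb hw) E lk).
- rewrite [check_cover _ _ _ _ _ _ _ _ _]/=; case E: check_leaf => // _ iv.
  have := check_leaf_sound gu gv (mkbox_sound gu gv pp a00 b00 w00 ha hb hw) _ E iv.
  have pr c d : c \in select_chains k.+1 (chains p) -> d \in c -> proper_germ d.
    by move/select_chains_mem => /(allP (chains_proper p)) /allP; apply.
  case.
    by apply/allP => c c_in; apply/allP => d d_in; have /andP[] := pr c d c_in d_in.
  by move=> c [d [c_in d_in iv']]; exists d => //; exact: pr c_in d_in.
Qed.
End Corners.

Section Step.
Variables (R : realFieldType) (m : R).
Hypotheses (m_gt0 : 0 < m) (m_eq : 3 * m ^+ 2 + 3 * m = 1).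
Local Notation covers := (covers m).
Local Notation hull_den := (hull_den m).

Lemma covers_step u v z : covers u v z -> exists2 c, proper_germ c & covers (u ++ c.1) (v ++ c.2) z.
Proof.
(* By symmetry the hull of [u] may be taken as the longer one, which bounds the third parameter by
   1. *)
wlog uv : u v / hull_den u <= hull_den v => [W|iv].
  have [/W|/ltW /W H iv] := leP (hull_den u) (hull_den v); first exact.
  have [[a b] /andP[/andP[/= ga gb] n0] iv'] := H (covers_sym iv).
  exists (b, a); last exact: covers_sym.
  by rewrite /proper_germ /germ3 /= gb ga; move: n0; rewrite !xpair_eqE andbC.
have [gu gv _ _ _] := iv.
have s0 : 0 <= ZR R wscale by rewrite ZR_pos ler0n.
have b w : positive w -> ZR R Z0 <= TS R * slope R w <= ZR R tscale.
  move=> pw; rewrite ZR_tscale mulr_ge0 ?slope_ge0 ?TS_ge0 //=.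
  by rewrite ler_piMr ?TS_ge0 // slope_le1.
have hw : ZR R Z0 * hull_den v <= ZR R wscale * hull_den u <= ZR R wscale * hull_den v.
  by rewrite mul0r mulr_ge0 ?ler_wpM2l // ltW // hull_den_gt0.
have t0 : 0 <= ZR R tscale by rewrite ZR_tscale TS_ge0.
have z0 : 0 <= ZR R Z0 by [].
case p: (parity u v).
  exact: (check_cover_sound m_gt0 m_eq gu gv (esym p) z0 z0 z0 t0 t0 s0 (b _ gu) (b _ gv) hw
    check_cover_opposite iv).
exact: (check_cover_sound m_gt0 m_eq gu gv (esym p) z0 z0 z0 t0 t0 s0 (b _ gu) (b _ gv) hw
  check_cover_same iv).
Qed.
End Step.

(** * Infinite continued fractions *)

Section Infinite.
Variable R : realType.
Implicit Types a : nat -> nat.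

Definition shift (a : nat -> nat) n := fun i => a (n + i)%N.
Definition pos_digits a := forall i, (0 < a i)%N.

Lemma pos_shift a n : pos_digits a -> pos_digits (shift a n).
Proof. by move=> pa i; apply: pa. Qed.

Lemma positive_mkseq a n : pos_digits a -> positive (mkseq a n).
Proof. by move=> pa; apply/allP => d /mapP[i _ ->]; apply: pa. Qed.

Lemma mkseqS_shift a n : mkseq a n.+1 = a 0%N :: mkseq (shift a 1) n.
Proof. rewrite /mkseq /=; congr (_ :: _).
by have := iotaDl 1 0 n; rewrite addn0 => ->; rewrite -map_comp. Qed.

Lemma mkseqD a n k : mkseq a (n + k) = mkseq a n ++ mkseq (shift a n) k.
Proof. rewrite /mkseq iotaD map_cat add0n; congr (_ ++ _).
by have := iotaDl n 0 k; rewrite addn0 => ->; rewrite -map_comp. Qed.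

Lemma cf_tailE a n : cf_tail R a n = cfval (mkseq a n) 0.
Proof. by elim: n a => // n IH a; rewrite mkseqS_shift /= IH. Qed.

Lemma cf_tailD a n k : cf_tail R a (n + k) = cfval (mkseq a n) (cf_tail R (shift a n) k).
Proof. by rewrite !cf_tailE mkseqD cfval_cat. Qed.

Lemma cf_tail_itv a n : pos_digits a -> 0 <= cf_tail R a n <= 1.
Proof.
move=> pa; have pm := positive_mkseq n pa.
by rewrite cf_tailE cfval_ge0 // cfval_le1 // lexx ler01.
Qed.

Lemma cf_tail_dist a n k : pos_digits a ->
  `|cf_tail R a n.+1 - cf_tail R a (n.+1 + k)| <= (n.+1%:R)^-1.
Proof.
move=> pa; have pm := positive_mkseq n.+1 pa.
rewrite -[n.+1 in X in `|X - _|]addn0 !cf_tailD.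
apply: le_trans (dist_cfval_le pm _ _) _; rewrite ?cf_tail_itv //; try exact: pos_shift.
have := cfd0_ge_size pm; rewrite size_mkseq -(ler_nat R) => h.
have n1 : 1 <= n.+1%:R :> R by rewrite ler1n.
have c0 := lt_le_trans ltr01 (le_trans n1 h).
rewrite lef_pV2 ?posrE ?exprn_gt0 //; apply: (le_trans h).
by rewrite expr2 ler_peMr; [|exact: ltW|exact: le_trans h].
Qed.

Lemma cf_tail_cvg a : pos_digits a -> cvgn (cf_tail R a).
Proof.
move=> pa; apply: cauchy_cvg; apply: cauchy_exP => e e0.
have [N hN] : exists N, (N.+1%:R)^-1 < e.
  by exists (Num.trunc e^-1); rewrite invf_plt ?posrE //; exact: truncnS_gt.
exists (cf_tail R a N.+1); exists N.+1 => // n /= Nn.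
by rewrite -(subnKC Nn) /ball_ /=; apply: le_lt_trans (cf_tail_dist _ _ pa) hN.
Qed.

Definition cfv a : R := lim (cf_tail R a n @[n --> \oo]).

Lemma cfv_cvg a : pos_digits a -> cf_tail R a n @[n --> \oo] --> cfv a.
Proof. by move/cf_tail_cvg. Qed.

Lemma cfv_itv a : pos_digits a -> 0 <= cfv a <= 1.
Proof.
move=> pa; apply/andP; split.
  by apply: limr_ge; [exact: cf_tail_cvg|apply: nearW => n; case/andP: (cf_tail_itv n pa)].
by apply: limr_le; [exact: cf_tail_cvg|apply: nearW => n; case/andP: (cf_tail_itv n pa)].
Qed.

Lemma cfv_rec a : pos_digits a -> cfv a = ((a 0%N)%:R + cfv (shift a 1))^-1.
Proof.
move=> pa; have ps := pos_shift 1 pa; have /andP[v0 _] := cfv_itv ps.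
apply: cvg_lim => //; rewrite -(cvg_shiftS (cf_tail R a)) /=.
apply: cvgV; first by rewrite gt_eqF // ltr_wpDr // ltr0n.
by apply: cvgD; [exact: cvg_cst|exact: cfv_cvg].
Qed.

Lemma cfvE a n : pos_digits a -> cfv a = cfval (mkseq a n) (cfv (shift a n)).
Proof.
elim: n a => [|n IH] a pa; first by rewrite /shift /=; congr cfv.
by rewrite mkseqS_shift cfv_rec //= IH; [|exact: pos_shift].
Qed.
End Infinite.

(** * Sums of two infinite continued fractions *)

Lemma word_limit (W : nat -> seq nat) :
  (forall n, prefix (W n) (W n.+1)) -> (forall N, exists n, (N < size (W n))%N) ->
  exists a : nat -> nat, forall n, W n = mkseq a (size (W n)).
Proof.
move=> Wp Wi; have [g hg] := choice Wi.
have pre n k : prefix (W n) (W (n + k)%N).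
  elim: k => [|k IH]; first by rewrite addn0 prefix_refl.
  by rewrite addnS (prefix_trans IH).
have nthW n k i : (i < size (W n))%N -> nth 0%N (W (n + k)%N) i = nth 0%N (W n) i.
  by have /prefixP[s ->] := pre n k => h; rewrite nth_cat h.
exists (fun i => nth 0%N (W (g i)) i) => n.
apply: (@eq_from_nth _ 0%N); rewrite ?size_mkseq // => i hi.
by rewrite nth_mkseq // -(nthW (g i) n i) // -(nthW n (g i) i) // addnC.
Qed.

Lemma cfd0_le_expn k w : positive w -> all (leq^~ k) w -> (cfd0 w <= k.+1 ^ size w)%N.
Proof.
elim/last_ind: w => // w d IH; rewrite positive_rcons all_rcons => /andP[d0 pw] /andP[dk kw].
have h := IH pw kw; have h1 := cfd1_le_cfd0 pw.
rewrite cfd0_rcons size_rcons expnS mulSn addnC leq_add ?(leq_trans h1) //.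
by rewrite leq_mul.
Qed.

Lemma mkseq_tail (a : nat -> nat) n u w i :
  mkseq a n = u ++ w -> digits3 w -> (size u <= i < n)%N -> (0 < a i <= 3)%N.
Proof.
move=> E gw /andP[ui i_n]; have := allP gw (a i); apply.
have sz : n = (size u + size w)%N by rewrite -size_cat -E size_mkseq.
rewrite -(nth_mkseq 0%N a i_n) E nth_cat ltnNge ui /= mem_nth //.
by rewrite ltn_subLR // -sz.
Qed.

Section Sum.
Variables (R : realType) (m : R).
Hypotheses (m_gt0 : 0 < m) (m_eq : 3 * m ^+ 2 + 3 * m = 1).
Local Notation covers := (covers m).
Local Notation pt := (pt m).
Local Notation len := (len m).

Lemma pt_itv w : digits3 w -> 0 <= pt w <= 1.
Proof.
move=> gw; rewrite (pt_ge0 m_gt0 m_eq) //=.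
by have /andP[_] := pt_bounds m_gt0 m_eq gw; move: (m_lt m_eq) => ? ?; lra.
Qed.

Lemma corner_point b u v U V z : digits3 U -> digits3 V -> corner m b (u ++ U) (v ++ V) z ->
  exists c, germ3 c /\ beyond b z (pos m u v c).
Proof.
rewrite /corner !pos_cat /= !cats0 => gU gV [[_ h]|h|h].
- by exists (U, V); rewrite /germ3 /= gU gV.
- by exists (U ++ [:: 2; 1]%N, V); rewrite /germ3 /= digits3_cat gU gV.
- by exists (U, V ++ [:: 2; 1]%N); rewrite /germ3 /= digits3_cat gU gV.
Qed.

(** Each corner supplies a point of the sum of the two cylinders, z lies between these two points,
    and both are this close to any other point of the sum. *)
Lemma covers_dist u v z x y : 0 <= x <= 1 -> 0 <= y <= 1 -> covers u v z ->
  `|z - (cfval u x + cfval v y)| <= ((cfd0 u)%:R ^+ 2)^-1 + ((cfd0 v)%:R ^+ 2)^-1.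
Proof.
move=> hx hy [pu pv _ lo hi].
have P c : germ3 c -> `|pos m u v c - (cfval u x + cfval v y)| <=
    ((cfd0 u)%:R ^+ 2)^-1 + ((cfd0 v)%:R ^+ 2)^-1.
  move=> /andP[g1 g2]; rewrite /pos !pt_cat opprD addrACA (le_trans (ler_normD _ _)) //.
  by apply: lerD; apply: dist_cfval_le => //; exact: pt_itv.
have e (b : bool) : digits3 (end1 b) by case: b.
rewrite -[u in corner _ _ u]cats0 in lo.
have [c1 [/P h1]] := corner_point (U := [::]) isT (e _) lo.
have [c2 [/P h2]] := corner_point (U := [:: 1%N]) isT (e _) hi.
move: h1 h2; rewrite /beyond; move: (pos m u v c1) (pos m u v c2) => q p.
set s := cfval u x + _; set t := _^-1 + _ => + + + +.
move: s t => s t; rewrite !ler_norml; case: (odd _);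
  rewrite /= ?expr0 ?expr1 ?mul1r ?mulN1r => /andP[a1 a2] /andP[a3 a4] b1 b2; apply/andP; split;
    lra.
Qed.

(** A refinement step may lengthen only one word. If [u] is short, its middle gap is bounded below,
    and [link] then bounds the hull of [v] below, hence the length of [v] above. So both words grow
    without bound. *)
Lemma link_size N : exists B, forall u v,
  positive u -> all (leq^~ 4) u -> positive v -> link m u v ->
  (size u <= N)%N -> (size v <= B)%N.
Proof.
pose d : R := `|pt [:: 2%N] - pt [:: 1; 1]%N|.
have d0 : 0 < d.
  have := m_lt m_eq; have := m_gt m_gt0 m_eq => h1 h2.
  rewrite normr_gt0 subr_eq0 pt_cons (pt_cons _ 1) pt1 // pt_nil (inj_eq invr_inj).
  by apply/eqP => h; lra.
pose D : R := 2 * (5 ^ N)%:R; have D0 : 0 < D by rewrite mulr_gt0 // ltr0n expn_gt0.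
exists (Num.trunc (5 * D ^+ 2 / (6 * d))) => u v pu u4 pv [_ lk] su.
rewrite truncn_ge_nat; last by apply: divr_ge0; apply: mulr_ge0 => //; rewrite ?exprn_ge0 // ltW.
have dD w : digits3 w -> den u (pt w) <= D.
  move=> /pt_itv /andP[w0 w1]; rewrite /den /D (mulr_natl _ 2) mulr2n.
  have h : (cfd0 u)%:R <= (5 ^ N)%:R :> R.
    by rewrite ler_nat (leq_trans (cfd0_le_expn pu u4)) // leq_exp2l.
  apply: lerD => //; apply: le_trans h.
  apply: (@le_trans _ _ (cfd1 u)%:R); first by rewrite ler_piMr.
  by rewrite ler_nat; exact: cfd1_le_cfd0.
have lu : d / D ^+ 2 <= len u [:: 2%N] [:: 1; 1]%N.
  rewrite lenE //; apply: ler_pM; [exact: ltW|by rewrite invr_ge0 exprn_ge0 // ltW|exact: lexx|].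
  rewrite lef_pV2 ?posrE; [|by rewrite exprn_gt0|by apply: mulr_gt0;
    apply: (den_pt_gt0 m_gt0 m_eq)].
  by rewrite expr2; apply: ler_pM; rewrite ?dD // ltW // (den_pt_gt0 m_gt0 m_eq).
have lv : len v [::] [:: 1%N] <= ((cfd0 v)%:R ^+ 2)^-1.
  by rewrite /len !pt_cat; apply: dist_cfval_le => //; exact: pt_itv.
have c1 : 1 <= (cfd0 v)%:R :> R by rewrite ler1n cfd0_gt0.
have sv : (size v)%:R <= (cfd0 v)%:R :> R by rewrite ler_nat cfd0_ge_size.
have {}lv : len v [::] [:: 1%N] * (size v)%:R <= 1.
  apply: (@le_trans _ _ (((cfd0 v)%:R ^+ 2)^-1 * (cfd0 v)%:R)).
    by apply: ler_pM => //; exact: len_ge0.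
  by rewrite expr2 invfM -mulrA mulVf ?mulr1 ?invf_le1 // ?gt_eqF // (lt_le_trans ltr01).
rewrite ler_pdivlMr ?mulr_gt0 // mulrCA.
have : 6 * (d / D ^+ 2) * (size v)%:R <= 5.
  apply: (@le_trans _ _ (5 * (len v [::] [:: 1%N] * (size v)%:R))); last first.
    by rewrite -[leRHS]mulr1 ler_wpM2l.
  rewrite [5 * _]mulrA; apply: ler_wpM2r => //; apply: le_trans lk; exact: ler_wpM2l.
have -> : 6 * (d / D ^+ 2) * (size v)%:R = 6 * d * (size v)%:R / D ^+ 2.
  by field; rewrite gt_eqF.
by rewrite ler_pdivrMr ?exprn_gt0 // => h; move: h; rewrite mulrA [_ * d]mulrC; lra.
Qed.

Lemma covers_seq u v z : covers u v z -> exists W : nat -> seq nat * seq nat,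
  [/\ W 0%N = (u, v), forall n, covers (W n).1 (W n).2 z &
    forall n, exists2 c, proper_germ c & W n.+1 = ((W n).1 ++ c.1, (W n).2 ++ c.2)].
Proof.
move=> iv; pose S := {s : seq nat * seq nat | covers s.1 s.2 z}.
have nx (s : S) : {t : S | exists2 c, proper_germ c & sval t = ((sval s).1 ++ c.1, (sval s).2 ++
  c.2)}.
  apply: cid; have [c pc ic] := covers_step m_gt0 m_eq (svalP s).
  by exists (exist _ ((sval s).1 ++ c.1, (sval s).2 ++ c.2) ic); exists c.
exists (fun n => sval (iter n (fun s => sval (nx s)) (exist _ (u, v) iv))).
split=> // n; first by case: (iter _ _ _).
by rewrite iterS; case: (nx _).
Qed.

Lemma eq_of_dist (x y : R) : (forall n, `|x - y| <= 2 * (n.+1%:R)^-1) -> x = y.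
Proof.
move=> h; apply/eqP; rewrite -subr_eq0 -normr_le0 leNgt; apply/negP => p.
have := h (Num.trunc (2 / `|x - y|)); rewrite -ler_pdivrMl // mulrC leNgt => /negP; apply.
rewrite invf_plt ?posrE // ?divr_gt0 //.
by apply: le_lt_trans (truncnS_gt _); rewrite invf_div.
Qed.

Lemma covers_sum u v z : covers u v z -> all (leq^~ 4) u -> all (leq^~ 4) v -> exists X Y,
  [/\ pos_digits X /\ pos_digits Y,
     forall i, (size u <= i)%N -> (X i <= 3)%N, forall i, (size v <= i)%N -> (Y i <= 3)%N,
     mkseq X (size u) = u /\ mkseq Y (size v) = v & z = cfv R X + cfv R Y].
Proof.
move=> /covers_seq [W [W0 Wi Wn]] u4 v4.
have Ws n : (n <= size (W n).1 + size (W n).2)%N.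
  elim: n => // n IH; have [[a b] /andP[_ ab] ->] := Wn n; rewrite /= !size_cat.
  have {ab} : (0 < size a + size b)%N by case: a b ab => [|? ?] [|? ?].
  by move: IH; move: (size _) (size _) (size a) (size b); lia.
have lk n : link m (W n).1 (W n).2 by case: (Wi n).
have q1 n : positive (W n).1 by case: (Wi n).
have q2 n : positive (W n).2 by case: (Wi n).
have g1 n : exists2 a, digits3 a & (W n).1 = u ++ a.
  elim: n => [|n [a ga Ea]]; first by exists [::]; rewrite // W0 cats0.
  by have [c /andP[/andP[gc _] _] ->] := Wn n; exists (a ++ c.1);
    rewrite ?digits3_cat ?ga //= Ea catA.
have g2 n : exists2 a, digits3 a & (W n).2 = v ++ a.
  elim: n => [|n [a ga Ea]]; first by exists [::]; rewrite // W0 cats0.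
  by have [c /andP[/andP[_ gc] _] ->] := Wn n; exists (a ++ c.2);
    rewrite ?digits3_cat ?ga //= Ea catA.
have g4 w a : digits3 a -> all (leq^~ 4) w -> all (leq^~ 4) (w ++ a).
  by move=> ga w4; rewrite all_cat w4; apply: sub_all ga => d /andP[_ /leq_trans]; apply.
have r1 n : all (leq^~ 4) (W n).1 by have [a ga ->] := g1 n; exact: g4.
have r2 n : all (leq^~ 4) (W n).2 by have [a ga ->] := g2 n; exact: g4.
have inf1 N : exists n, (N < size (W n).1)%N.
  have [B hB] := link_size N; exists (N + B).+1; rewrite ltnNge; apply/negP => h.
  by have := hB _ _ (q1 _) (r1 _) (q2 _) (lk _) h; have := Ws (N + B).+1; lia.
have inf2 N : exists n, (N < size (W n).2)%N.
  have [B hB] := link_size N; exists (N + B).+1; rewrite ltnNge; apply/negP => h.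
  have lk' : link m (W (N + B).+1).2 (W (N + B).+1).1 by case: (lk (N + B).+1).
  by have := hB _ _ (q2 _) (r2 _) (q1 _) lk' h; have := Ws (N + B).+1; lia.
have p1 n : prefix (W n).1 (W n.+1).1 by have [c _ ->] := Wn n; rewrite prefix_prefix.
have p2 n : prefix (W n).2 (W n.+1).2 by have [c _ ->] := Wn n; rewrite prefix_prefix.
have [X hX] := word_limit p1 inf1; have [Y hY] := word_limit p2 inf2.
have pX : pos_digits X.
  move=> i; have [n hn] := inf1 i; have := q1 n; rewrite hX => /allP; apply.
  by apply/mapP; exists i; rewrite ?mem_iota.
have pY : pos_digits Y.
  move=> i; have [n hn] := inf2 i; have := q2 n; rewrite hY => /allP; apply.
  by apply/mapP; exists i; rewrite ?mem_iota.
have dX i : (size u <= i)%N -> (X i <= 3)%N.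
  move=> ui; have [n hn] := inf1 i; have [a ga] := g1 n; rewrite hX => Ea.
  by have /andP[] : (0 < X i <= 3)%N by apply: (mkseq_tail Ea ga); rewrite ui.
have dY i : (size v <= i)%N -> (Y i <= 3)%N.
  move=> vi; have [n hn] := inf2 i; have [a ga] := g2 n; rewrite hY => Ea.
  by have /andP[] : (0 < Y i <= 3)%N by apply: (mkseq_tail Ea ga); rewrite vi.
exists X, Y; split=> //.
  by split; [have := hX 0%N|have := hY 0%N]; rewrite W0.
have mono1 n k : (size (W n).1 <= size (W (n + k)%N).1)%N.
  by elim: k => [|k IH]; rewrite ?addn0 // addnS (leq_trans IH) // (size_prefix (p1 _)).
have mono2 n k : (size (W n).2 <= size (W (n + k)%N).2)%N.
  by elim: k => [|k IH]; rewrite ?addn0 // addnS (leq_trans IH) // (size_prefix (p2 _)).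
apply: eq_of_dist => N; have [n1 h1] := inf1 N; have [n2 h2] := inf2 N.
pose n := (n1 + n2)%N.
have {}h1 : (N < size (W n).1)%N by apply: leq_trans (mono1 n1 n2).
have {}h2 : (N < size (W n).2)%N by rewrite /n addnC; apply: leq_trans (mono2 n2 n1).
rewrite (cfvE R (size (W n).1) pX) (cfvE R (size (W n).2) pY) -hX -hY.
have b w : positive w -> (N < size w)%N -> ((cfd0 w)%:R ^+ 2)^-1 <= (N.+1%:R)^-1 :> R.
  move=> pw hw.
  have c1 : 1 <= (cfd0 w)%:R :> R by rewrite ler1n cfd0_gt0.
  rewrite lef_pV2 ?posrE; [|by rewrite exprn_gt0 // (lt_le_trans ltr01)|by rewrite ltr0n].
  apply: (@le_trans _ _ (cfd0 w)%:R); first by rewrite ler_nat (leq_trans hw) // cfd0_ge_size.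
  by rewrite expr2 ler_peMr // (le_trans _ c1).
apply: le_trans (covers_dist _ _ (Wi n)) _; try exact: cfv_itv (pos_shift _ _).
by rewrite mulr_natl mulr2n; apply: lerD; apply: b.
Qed.
End Sum.

(** * From sums of two tails to the decomposition of gamma *)

Section Glue.
Variables (R : realType) (m : R).
Hypotheses (m_gt0 : 0 < m) (m_eq : 3 * m ^+ 2 + 3 * m = 1).
Local Notation covers := (covers m).
Local Notation pt := (pt m).
Local Notation len := (len m).

Lemma pt_cons_bounds w (l h a b : R) d :
  a <= pt w <= b -> 0 < a -> 0 <= l -> 0 <= h ->
  l * (d%:R + b) <= 1 -> 1 <= h * (d%:R + a) -> l <= pt (d :: w) <= h.
Proof.
move=> /andP[wa wb] a0 l0 h0 hl hh.
have d0 : 0 <= d%:R :> R by [].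
have p0 : 0 < d%:R + pt w by lra.
rewrite pt_cons -[_^-1]mul1r ler_pdivlMr // ler_pdivrMr //; apply/andP; split.
  by apply: le_trans hl; rewrite ler_wpM2l // lerD2l.
by apply: (le_trans hh); rewrite ler_wpM2l // lerD2l.
Qed.

Let B0 : 24 / 91 <= pt [::] <= 91 / 345.
Proof. by have := m_lt m_eq; have := m_gt m_gt0 m_eq; rewrite pt_nil => h1 h2; apply/andP; split;
  lra. Qed.

Local Ltac step H := by apply: (pt_cons_bounds H); lra.

Let B1 : 72 / 91 <= pt [:: 1%N] <= 19 / 24. Proof. step B0. Qed.
Let B2 : 34 / 77 <= pt [:: 2%N] <= 19 / 43. Proof. step B0. Qed.
Let B3 : 15 / 49 <= pt [:: 3%N] <= 19 / 62. Proof. step B0. Qed.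
Let B4 : 15 / 64 <= pt [:: 4%N] <= 19 / 81. Proof. step B0. Qed.
Let B11 : 24 / 43 <= pt [:: 1; 1]%N <= 43 / 77. Proof. step B1. Qed.
Let B21 : 24 / 67 <= pt [:: 2; 1]%N <= 19 / 53. Proof. step B1. Qed.
Let B31 : 24 / 91 <= pt [:: 3; 1]%N <= 19 / 72. Proof. step B1. Qed.
Let B41 : 5 / 24 <= pt [:: 4; 1]%N <= 19 / 91. Proof. step B1. Qed.
Let B22 : 9 / 22 <= pt [:: 2; 2]%N <= 34 / 83. Proof. step B2. Qed.
Let B32 : 9 / 31 <= pt [:: 3; 2]%N <= 25 / 86. Proof. step B2. Qed.
Let B42 : 9 / 40 <= pt [:: 4; 2]%N <= 16 / 71. Proof. step B2. Qed.
Let B211 : 34 / 87 <= pt [:: 2; 1; 1]%N <= 9 / 23. Proof. step B11. Qed.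
Let B311 : 25 / 89 <= pt [:: 3; 1; 1]%N <= 9 / 32. Proof. step B11. Qed.
Let B411 : 16 / 73 <= pt [:: 4; 1; 1]%N <= 9 / 41. Proof. step B11. Qed.
Let B121 : 53 / 72 <= pt [:: 1; 2; 1]%N <= 67 / 91. Proof. step B21. Qed.
Let B221 : 39 / 92 <= pt [:: 2; 2; 1]%N <= 14 / 33. Proof. step B21. Qed.
Let B321 : 25 / 84 <= pt [:: 3; 2; 1]%N <= 14 / 47. Proof. step B21. Qed.
Let B2121 : 19 / 52 <= pt [:: 2; 1; 2; 1]%N <= 34 / 93. Proof. step B121. Qed.
Let B3121 : 19 / 71 <= pt [:: 3; 1; 2; 1]%N <= 15 / 56. Proof. step B121. Qed.

Lemma len_le u a b (c : R) :
  pt (u ++ a) - pt (u ++ b) <= c -> pt (u ++ b) - pt (u ++ a) <= c -> len u a b <= c.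
Proof. by move=> h1 h2; rewrite /len ler_norml; apply/andP; split; lra. Qed.

Lemma len_ge1 u a b (c : R) : c <= pt (u ++ a) - pt (u ++ b) -> c <= len u a b.
Proof. by move=> h; apply: le_trans (ler_norm _). Qed.

Lemma len_ge2 u a b (c : R) : c <= pt (u ++ b) - pt (u ++ a) -> c <= len u a b.
Proof. by move=> h; rewrite lenC; apply: len_ge1. Qed.

Lemma hulls : [/\ 1 / 2 <= len [::] [::] [:: 1%N], 1 / 24 <= len [:: 3%N] [::] [:: 1%N],
  1 / 40 <= len [:: 4%N] [::] [:: 1%N] & 1 / 13 <= len [:: 2%N] [::] [:: 1%N]].
Proof.
split.
- by apply: len_ge2 => /=; move: B0 B1 => /andP[? ?] /andP[? ?]; lra.
- by apply: len_ge1 => /=; move: B3 B31 => /andP[? ?] /andP[? ?]; lra.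
- by apply: len_ge1 => /=; move: B4 B41 => /andP[? ?] /andP[? ?]; lra.
- by apply: len_ge1 => /=; move: B2 B21 => /andP[? ?] /andP[? ?]; lra.
Qed.

Lemma gaps : [/\ len [::] [:: 2%N] [:: 1; 1]%N <= 1 / 8, len [:: 3%N] [:: 2%N] [:: 1;
  1]%N <= 1 / 99,
  len [:: 4%N] [:: 2%N] [:: 1; 1]%N <= 1 / 99 & len [:: 2%N] [:: 2%N] [:: 1; 1]%N <= 4 / 210].
Proof.
split; apply: len_le => /=.
- by move: B2 B11 => /andP[? ?] /andP[? ?]; lra.
- by move: B2 B11 => /andP[? ?] /andP[? ?]; lra.
- by move: B32 B311 => /andP[? ?] /andP[? ?]; lra.
- by move: B32 B311 => /andP[? ?] /andP[? ?]; lra.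
- by move: B42 B411 => /andP[? ?] /andP[? ?]; lra.
- by move: B42 B411 => /andP[? ?] /andP[? ?]; lra.
- by move: B22 B211 => /andP[? ?] /andP[? ?]; lra.
- by move: B22 B211 => /andP[? ?] /andP[? ?]; lra.
Qed.

(** At both corners z is taken beyond the first gap of the first summand; the lower bound is the
    threshold of the theorem. *)
Lemma covers_nil z : m + pt [:: 2; 1]%N <= z <= 3 * m + pt [:: 1; 2; 1]%N -> covers [::] [::] z.
Proof.
move=> /andP[z1 z2]; have [h _ _ _] := hulls; have [g _ _ _] := gaps.
split=> //; first by split; lra.
  by apply: Or32; rewrite /beyond /pos /= expr0 mul1r pt_nil; lra.
by apply: Or32; rewrite /beyond /pos /= expr1 mulN1r -[pt [:: 1%N]]/(pt [:: 1%N]) pt1 //; lra.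
Qed.

(** Values too small for [covers_nil] are reached by prescribing first digits: 3 and 4, then 3 and
    3, then 2 and 4, on intervals that leave no hole. *)
Lemma covers34 z : 1 / 2 <= z <= 25 / 47 -> covers [:: 3%N] [:: 4%N] z.
Proof.
move=> /andP[z1 z2]; have [_ h3 h4 _] := hulls; have [_ g3 g4 _] := gaps.
split=> //; first by split; lra.
  apply: Or32; rewrite /beyond /pos /= expr1 mulN1r.
  by move: B321 B4 => /andP[? ?] /andP[? ?]; lra.
apply: Or32; rewrite /beyond /pos /= expr0 mul1r.
by move: B3121 B41 => /andP[? ?] /andP[? ?]; lra.
Qed.

Lemma covers33 z : 25 / 47 <= z <= 601 / 1000 -> covers [:: 3%N] [:: 3%N] z.
Proof.
move=> /andP[z1 z2]; have [_ h3 h4 _] := hulls; have [_ g3 g4 _] := gaps.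
split=> //; first by split; lra.
  apply: Or32; rewrite /beyond /pos /= expr1 mulN1r.
  by move: B321 B3 => /andP[? ?] /andP[? ?]; lra.
apply: Or32; rewrite /beyond /pos /= expr0 mul1r.
by move: B3121 B31 => /andP[? ?] /andP[? ?]; lra.
Qed.

Lemma covers24 z : 3 / 5 <= z <= 65 / 100 -> covers [:: 2%N] [:: 4%N] z.
Proof.
move=> /andP[z1 z2]; have [_ _ h4 h2] := hulls; have [_ _ g4 g2] := gaps.
split=> //; first by split; lra.
  apply: Or32; rewrite /beyond /pos /= expr1 mulN1r.
  by move: B221 B4 => /andP[? ?] /andP[? ?]; lra.
apply: Or32; rewrite /beyond /pos /= expr0 mul1r.
by move: B2121 B41 => /andP[? ?] /andP[? ?]; lra.
Qed.

Lemma decompose g : 4 + m + pt [:: 2; 1]%N <= g -> exists N X Y,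
  [/\ pos_digits X /\ pos_digits Y, forall i, (X i <= 3)%N, forall i, (0 < i)%N -> (Y i <= 3)%N,
      (N = 4 /\ (Y 0 <= 3) \/ 5 <= N /\ (Y 0 <= 4))%N & g = N%:R + cfv R X + cfv R Y].
Proof.
move=> g0; have [g1|g1] := leP g (4 + (3 * m + pt [:: 1; 2; 1]%N)).
  have /covers_nil iv : m + pt [:: 2; 1]%N <= g - 4 <= 3 * m + pt [:: 1; 2; 1]%N by apply/andP;
    split; lra.
  have [X [Y [pXY hX hY _ E]]] := covers_sum m_gt0 m_eq iv isT isT.
  exists 4%N, X, Y; split=> //; first by move=> i; apply: hX.
  - by move=> i _; apply: hY.
  - by left; split=> //; apply: hY.
  - by rewrite -addrA -E; ring.
move: B1 B121; rewrite pt1 // => /andP[b1 b2] /andP[b3 b4].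
(* Then g - N runs over a unit interval starting at 1/2, cut below at 25/47, 3/5 and 65/100; the
   rest lies in the range of [covers_nil], which reaches beyond 3/2. Also N >= 5, because g exceeds
   5 + 1/2 here. *)
pose N := Num.trunc (g - 1 / 2).
have N5 : (5 <= N)%N by rewrite truncn_ge_nat; lra.
have /andP[N1 N2] : N%:R <= g - 1 / 2 < N.+1%:R by apply: truncn_itv; lra.
move: (N) N5 N1 N2 => {}N N5 N1; rewrite -(natr1 N) => N2.
have {}N2 : g - N%:R <= 3 / 2 by lra.
have {}N1 : 1 / 2 <= g - N%:R by lra.
have hd X : mkseq X 1 = [:: X 0%N] by [].
suff [u [v [iv u3 v4 [su sv]]]] : exists u v, [/\ covers u v (g - N%:R), all (leq^~ 3) u, all
  (leq^~ 4) v &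
     (size u <= 1)%N /\ (size v <= 1)%N].
  have u4 : all (leq^~ 4) u by apply: sub_all u3 => d /leq_trans; apply.
  have [X [Y [pXY hX hY [Eu Ev] E]]] := covers_sum m_gt0 m_eq iv u4 v4.
  exists N, X, Y; split=> //.
  - case=> [|i]; last by apply: hX; exact: leq_trans su _.
    by case: u su u3 Eu hX {iv u4} => [|d [|e u]] //= _; [move=> _ _;
      apply|rewrite andbT => d3 [->]].
  - by move=> i i0; apply: hY; exact: leq_trans sv _.
  - right; split=> //; case: v sv v4 Ev hY {iv} => [|d [|e v]] //= _.
      by move=> _ _ h; apply: leq_trans (h 0%N isT) _.
    by rewrite andbT => d4 [->].
  - by rewrite -addrA -E; ring.
have [z1|z1] := leP (g - N%:R) (25 / 47).
  by exists [:: 3%N], [:: 4%N]; split=> //; apply: covers34; apply/andP; split; lra.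
have [z2|z2] := leP (g - N%:R) (3 / 5).
  by exists [:: 3%N], [:: 3%N]; split=> //; apply: covers33; apply/andP; split; lra.
have [z3|z3] := leP (g - N%:R) (65 / 100).
  by exists [:: 2%N], [:: 4%N]; split=> //; apply: covers24; apply/andP; split; lra.
exists [::], [::]; split=> //; apply: covers_nil; move: B0 B21;
  rewrite pt_nil => /andP[? ?] /andP[? ?].
by apply/andP; split; lra.
Qed.
End Glue.

(** * The periodic continued fractions of the threshold *)

Section Markov.
Variable R : realType.

Lemma periodic_cfracE pre per : periodic_cfrac R 0 pre per = cfv R (eventually_periodic pre per).
Proof.
rewrite /periodic_cfrac /cfrac /cfv.
suff -> : cf_convergent R 0 (eventually_periodic pre per) = cf_tail R (eventually_periodic pre
  per) by [].
by apply/funext => n; rewrite /cf_convergent add0r.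
Qed.

Let a31 := eventually_periodic [::] [:: 3; 1]%N.

Let shift31 : shift a31 2 = a31.
Proof. by apply/funext => n; rewrite /shift /a31 /eventually_periodic /= !subn0 modnDl. Qed.

Let pos31 : pos_digits a31.
Proof.
move=> n; rewrite /a31 /eventually_periodic /=.
have : ((n - 0) %% 2 < 2)%N by rewrite ltn_mod.
by case: ((n - 0) %% 2)%N => [|[]].
Qed.

Definition markov_min : R := periodic_cfrac R 0 [::] [:: 3; 1]%N.

Lemma markov_minE : markov_min = (3 + (1 + markov_min)^-1)^-1.
Proof. by rewrite /markov_min periodic_cfracE {1}(cfvE R 2 pos31) shift31. Qed.

Lemma markov_min_gt0 : 0 < markov_min.
Proof.
have m0 : 0 <= markov_min by rewrite /markov_min periodic_cfracE; case/andP: (cfv_itv R pos31).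
by rewrite markov_minE invr_gt0 addr_gt0 // invr_gt0; lra.
Qed.

Lemma markov_min_eq : 3 * markov_min ^+ 2 + 3 * markov_min = 1.
Proof.
have m0 := markov_min_gt0; have := markov_minE; move: markov_min m0 => m m0 E.
have : m * (3 + (1 + m)^-1) = 1.
  by rewrite {1}E mulVf // gt_eqF // addr_gt0 // invr_gt0; lra.
have m1 : 1 + m != 0 by rewrite gt_eqF //; lra.
move=> {}E; have : m * (3 + (1 + m)^-1) * (1 + m) = 1 + m by rewrite E mul1r.
have -> : m * (3 + (1 + m)^-1) * (1 + m) = 3 * m ^+ 2 + 4 * m by field.
by rewrite expr2; lra.
Qed.

Lemma periodic_213 : periodic_cfrac R 0 [:: 2]%N [:: 1; 3]%N = pt markov_min [:: 2; 1]%N.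
Proof.
have E : shift (eventually_periodic [:: 2]%N [:: 1; 3]%N) 2 = a31.
  apply/funext => n; rewrite /shift /a31 /eventually_periodic /= subn0.
  have -> : ((2 + n - 1) %% 2 = (1 + n %% 2) %% 2)%N by rewrite modnDmr; congr (_ %% _)%N; lia.
  by have := ltn_mod n 2; case: (n %% 2)%N => [|[|//]].
rewrite periodic_cfracE (cfvE R 2); first by rewrite E /markov_min periodic_cfracE.
move=> n; rewrite /eventually_periodic /=; case: n => // n /=.
have : ((n.+1 - 1) %% 2 < 2)%N by rewrite ltn_mod.
by case: ((n.+1 - 1) %% 2)%N => [|[]].
Qed.
End Markov.

(** * Convergents *)

Lemma mkseq_rcons (a : nat -> nat) n : mkseq a n.+1 = rcons (mkseq a n) (a n).
Proof. by rewrite /mkseq -addn1 iotaD map_cat add0n cats1. Qed.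

Section Convergents.
Variable a : nat -> nat.
Hypothesis pa : pos_digits a.

Definition cfp n := cfn0 (mkseq a n).
Definition cfq n := cfd0 (mkseq a n).

Lemma cfd1_mkseq n : cfd1 (mkseq a n.+1) = cfq n.
Proof. by rewrite mkseq_rcons cfd1_rcons. Qed.

Lemma cfn1_mkseq n : cfn1 (mkseq a n.+1) = cfp n.
Proof. by rewrite mkseq_rcons cfn1_rcons. Qed.

Lemma cfq_gt0 n : (0 < cfq n)%N.
Proof. exact/cfd0_gt0/positive_mkseq. Qed.

Lemma cfq_ge n : (n <= cfq n)%N.
Proof. by have := cfd0_ge_size (positive_mkseq n pa); rewrite size_mkseq. Qed.

Lemma cf_det w : (cfn1 w * cfd0 w)%:Z - (cfn0 w * cfd1 w)%:Z = (-1) ^+ size w.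
Proof.
elim/last_ind: w => [|w d IH] //; rewrite size_rcons exprS -IH.
by rewrite cfd0_rcons cfd1_rcons cfn0_rcons cfn1_rcons !PoszM !PoszD !PoszM; ring.
Qed.

Lemma convergent_det n :
  (cfp n)%:Z * (cfq n.+1)%:Z - (cfp n.+1)%:Z * (cfq n)%:Z = (-1) ^+ n.+1.
Proof.
by have := cf_det (mkseq a n.+1); rewrite cfn1_mkseq cfd1_mkseq size_mkseq -!PoszM.
Qed.

Lemma coprime_convergent n : coprime (cfp n) (cfq n).
Proof.
suff : coprimez (cfp n)%:Z (cfq n)%:Z by rewrite coprimezE.
apply/coprimezP; exists ((-1) ^+ n.+1 * (cfq n.+1)%:Z, - ((-1) ^+ n.+1 * (cfp n.+1)%:Z)) => /=.
rewrite mulNr -!mulrA -mulrBr [_ * (cfp n)%:Z]mulrC convergent_det.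
by rewrite -expr2 sqrr_sign.
Qed.

Lemma cfq_between q : (0 < q)%N -> exists n, (cfq n <= q < cfq n.+1)%N.
Proof.
move=> q0; have ex : exists n, (q < cfq n)%N by exists q.+1; exact: cfq_ge.
case: (ex_minnP ex) => [[|n] hn mn]; first by move: hn; rewrite /cfq /= ltnNge q0.
by exists n; rewrite hn andbT leqNgt; apply/negP => /mn; rewrite ltnn.
Qed.
End Convergents.

Section Legendre.
Variables (R : realType) (a : nat -> nat).
Hypothesis pa : pos_digits a.
Local Notation q := (cfq a).
Local Notation p := (cfp a).

(** This is V_n. By [cfd1_cfd0] the last summand is the reversed fraction [0; a_(n-1), ..., a_0],
    equal to 0 for n = 0. *)
Definition approx_const n : R :=
  (a n)%:R + cfv R (shift a n.+1) + (cfd1 (mkseq a n))%:R / (q n)%:R.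

Lemma q_gt0 n : 0 < (q n)%:R :> R. Proof. by rewrite ltr0n; exact: cfq_gt0. Qed.

Lemma approx_const_ge1 n : 1 <= approx_const n.
Proof.
have /andP[h _] := cfv_itv R (pos_shift n.+1 pa).
have a1 : 1 <= (a n)%:R :> R by rewrite ler1n; exact: pa.
have : 0 <= (cfd1 (mkseq a n))%:R / (q n)%:R :> R by rewrite divr_ge0.
by rewrite /approx_const; lra.
Qed.

Lemma convergent_error n :
  (q n)%:R * cfv R a - (p n)%:R = (-1) ^+ n / ((q n)%:R * approx_const n).
Proof.
have q0 := q_gt0 n; have V1 := approx_const_ge1 n.
have ps := pos_shift n pa; set t := cfv R (shift a n).
have Et : t = ((a n)%:R + cfv R (shift a n.+1))^-1.
  rewrite /t cfv_rec // {1}/shift addn0; congr (_ + cfv R _)^-1.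
  by apply/funext => i; rewrite /shift addnA addn1.
have pw := positive_mkseq n pa.
have /andP[t0 _] := cfv_itv R (pos_shift n.+1 pa).
have A0 : 0 < (a n)%:R + cfv R (shift a n.+1) by rewrite ltr_wpDr // ltr0n; exact: pa.
have t_ge0 : 0 <= t by rewrite Et invr_ge0 ltW.
have E0 : (p n)%:R = (q n)%:R * cfval (mkseq a n) 0 :> R.
  by rewrite cfvalE // /num /den !mulr0 !addr0 mulrC divfK // gt_eqF.
rewrite E0 -mulrBr {1}(cfvE R n pa) cfvalB // size_mkseq subr0 -/t.
have D0 := den_gt0 pw t_ge0.
have -> : den (mkseq a n) 0 = (q n)%:R :> R by rewrite /den mulr0 addr0.
have E : t * ((q n)%:R * approx_const n) = den (mkseq a n) t.
  rewrite /approx_const /den -/(q n) Et; move: (_ + cfv R _) A0 => A A0.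
  by field; rewrite !gt_eqF.
have t_gt0 : 0 < t by rewrite Et invr_gt0.
have V0 := lt_le_trans ltr01 V1.
by rewrite -E; field; rewrite !gt_eqF.
Qed.

Lemma convergent_dist n :
  `|cfv R a - (p n)%:R / (q n)%:R| = ((q n)%:R ^+ 2 * approx_const n)^-1.
Proof.
have q0 := q_gt0 n; have V1 := lt_le_trans ltr01 (approx_const_ge1 n).
have -> : cfv R a - (p n)%:R / (q n)%:R = ((q n)%:R * cfv R a - (p n)%:R) / (q n)%:R.
  by field; rewrite gt_eqF.
rewrite convergent_error normrM normrM normrX normrN1 expr1n mul1r !normfV.
rewrite [`|(q n)%:R|]ger0_norm ?ltW // ger0_norm; last by rewrite mulr_ge0 // ltW.
by rewrite expr2; field; rewrite !gt_eqF.
Qed.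

(** Consecutive convergents form a basis of Z^2, so (P, Q) = u (p_n, q_n) + v (p_(n+1), q_(n+1))
    with integers u, v. As v is nonzero and 0 < Q < q_(n+1), u and v have opposite signs; the errors
    of the two convergents alternate as well, so their contributions add up. *)
Lemma best_approx n (P : int) (Q : nat) : (0 < Q < q n.+1)%N ->
  P * (q n)%:Z != (p n)%:Z * Q%:Z ->
  `|(q n)%:R * cfv R a - (p n)%:R| <= `|Q%:R * cfv R a - P%:~R|.
Proof.
move=> /andP[Q0 Qq] ne; have det := convergent_det a n.
set s : int := (-1) ^+ n.+1 in det; have ss : s * s = 1 by rewrite -expr2 sqrr_sign.
pose u := s * (P * (q n.+1)%:Z - Q%:Z * (p n.+1)%:Z).
pose v := s * (Q%:Z * (p n)%:Z - P * (q n)%:Z).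
have EQ : Q%:Z = u * (q n)%:Z + v * (q n.+1)%:Z.
  have -> : u * (q n)%:Z + v * (q n.+1)%:Z = s * ((p n)%:Z * (q n.+1)%:Z - (p n.+1)%:Z * (q n)%:Z)
    * Q%:Z.
    by rewrite /u /v; ring.
  by rewrite det ss mul1r.
have EP : P = u * (p n)%:Z + v * (p n.+1)%:Z.
  have -> : u * (p n)%:Z + v * (p n.+1)%:Z = s * ((p n)%:Z * (q n.+1)%:Z - (p n.+1)%:Z * (q n)%:Z)
    * P.
    by rewrite /u /v; ring.
  by rewrite det ss mul1r.
have v0 : v != 0.
  rewrite mulf_neq0 //; first by rewrite /s signr_eq0.
  by rewrite subr_eq0 mulrC eq_sym.
have q0 := cfq_gt0 pa n; have q1 := cfq_gt0 pa n.+1.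
have uv : (0 < v) && (u <= -1) || (v < 0) && (1 <= u).
  have [v_lt|v_gt|] := ltgtP v 0; last by move/eqP; rewrite (negbTE v0).
    rewrite /= -gtz0_ge1; have hv : v * (q n.+1)%:Z <= 0 by rewrite pmulr_lle0 // ltW.
    have : 0 < u * (q n)%:Z by rewrite -(ltrD2r (v * (q n.+1)%:Z)) -EQ add0r (le_lt_trans hv).
    by rewrite pmulr_lgt0.
  rewrite orbF andTb; have hv : (q n.+1)%:Z <= v * (q n.+1)%:Z by rewrite ler_peMl // -gtz0_ge1.
  have : u * (q n)%:Z < 0.
    by rewrite -(ltrD2r (v * (q n.+1)%:Z)) -EQ add0r (lt_le_trans _ hv).
  by rewrite pmulr_llt0 // => u0; rewrite lerNr -gtz0_ge1 oppr_gt0.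
have -> : Q%:R * cfv R a - P%:~R =
    u%:~R * ((q n)%:R * cfv R a - (p n)%:R) + v%:~R * ((q n.+1)%:R * cfv R a - (p n.+1)%:R).
  by rewrite -[Q%:R]/(Q%:Z%:~R) EQ EP !intrD !intrM /=; ring.
rewrite !convergent_error.
have e0 k : 0 < ((q k)%:R * approx_const k)^-1.
  by rewrite invr_gt0 mulr_gt0 ?q_gt0 // (lt_le_trans ltr01) // approx_const_ge1.
move: (e0 n) (e0 n.+1); move: (_^-1) (_^-1) => x y x0 y0.
rewrite exprS mulN1r mulNr mulrN !mulrA ![_ * (-1) ^+ n]mulrC -!mulrA -mulrBr !normrM.
rewrite normrX normrN1 expr1n !mul1r ger0_norm ?ltW //.
case/orP: uv => /andP[]; rewrite -(@ltr_int R) -?(@ler_int R) => h1 h2.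
  rewrite -normrN opprB ger0_norm; nra.
rewrite ger0_norm; nra.
Qed.

(** For q_n <= Q < q_(n+1), a fraction other than p_n/q_n is at distance at least 1/(Q q_n) from it,
    but by [best_approx] the distances of both fractions from alpha add up to less. *)
Lemma legendre (P : int) (Q : nat) : (0 < Q)%N ->
  `|cfv R a - P%:~R / Q%:R| < (2 * Q%:R ^+ 2)^-1 ->
  exists n, P * (q n)%:Z = (p n)%:Z * Q%:Z.
Proof.
move=> Q0 h; have [n /andP[qn Qn]] := cfq_between pa Q0.
exists n; apply/eqP; apply/negPn/negP => ne.
have Q0' : 0 < Q%:R :> R by rewrite ltr0n.
have q0 := q_gt0 n.
have hb : `|(q n)%:R * cfv R a - (p n)%:R| <= `|Q%:R * cfv R a - P%:~R|.
  by apply: best_approx => //; rewrite Q0.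
have E x (P' : R) (x0 : 0 < x) : x * cfv R a - P' = x * (cfv R a - P' / x).
  by field; rewrite gt_eqF.
move: hb; rewrite !E // !normrM (gtr0_norm q0) (gtr0_norm Q0') => hb.
have d : 1 <= `|P%:~R * (q n)%:R - (p n)%:R * Q%:R| :> R.
  have : 1 <= `|P * (q n)%:Z - (p n)%:Z * Q%:Z| by rewrite -gtz0_ge1 normr_gt0 subr_eq0.
  by rewrite -(@ler_int R) intr_norm intrB !intrM.
have Eq : P%:~R * (q n)%:R - (p n)%:R * Q%:R =
    Q%:R * (q n)%:R * ((cfv R a - (p n)%:R / (q n)%:R) - (cfv R a - P%:~R / Q%:R)).
  by field; rewrite !gt_eqF.
move: d; rewrite {}Eq normrM (gtr0_norm (mulr_gt0 Q0' q0)) => d.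
move: h hb d; set x := cfv R a - P%:~R / _; set y := cfv R a - _ / _ => h hb d.
have h2 : Q%:R * (Q%:R * `|x|) < 1 / 2.
  by move: h; rewrite invfM ltr_pdivlMr ?exprn_gt0 // mulrC expr2 mulrA mul1r.
have qQ : Q%:R * ((q n)%:R * `|x|) <= Q%:R * (Q%:R * `|x|).
  by rewrite ler_pM2l // ler_wpM2r // ler_nat.
have h3 : Q%:R * (q n)%:R * `|y - x| <= Q%:R * ((q n)%:R * `|y|) + Q%:R * ((q n)%:R * `|x|).
  by rewrite -mulrA -!mulrDr !ler_pM2l //; exact: ler_normB.
have h4 : Q%:R * ((q n)%:R * `|y|) <= Q%:R * (Q%:R * `|x|) by rewrite ler_pM2l.
by lra.
Qed.
End Legendre.

(** * Construction of alpha *)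

Section NonCentral.
Variables (R : realType) (a : nat -> nat).
Hypothesis pa : pos_digits a.

Lemma inv_natD_le b c (r : R) : (0 < c <= b)%N -> 0 <= r -> (b%:R + r)^-1 <= (c%:R)^-1.
Proof.
move=> /andP[c0 cb] r0; have c0' : 0 < c%:R :> R by rewrite ltr0n.
have bc : c%:R <= b%:R :> R by rewrite ler_nat.
by rewrite lef_pV2 ?posrE; lra.
Qed.

(** The extreme case is b1 = 1, b2 = K, r = s, with value (K + s)/(K + s + 1). *)
Lemma cfval2_le b1 b2 K (r s t : R) : (0 < b1)%N -> (0 < b2 <= K)%N -> 0 <= r <= s ->
  K%:R + s <= t * (K%:R + s + 1) -> cfval [:: b1; b2] r <= t.
Proof.
move=> b10 /andP[b20 b2K] /andP[r0 rs] ht /=.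
have h1 : 1 <= b1%:R :> R by rewrite ler1n.
have h2 : 1 <= b2%:R :> R by rewrite ler1n.
have h3 : b2%:R <= K%:R :> R by rewrite ler_nat.
have t0 : 0 < (b2%:R + r)^-1 by rewrite invr_gt0; lra.
apply: (@le_trans _ _ ((K%:R + s) / (K%:R + s + 1))); last by rewrite ler_pdivrMr //; lra.
rewrite -[_^-1]mul1r ler_pdivrMr; last by lra.
rewrite mulrAC ler_pdivlMr; last by lra.
have : 1 <= (K%:R + s) * (b2%:R + r)^-1 by rewrite ler_pdivlMr; lra.
have : (K%:R + s) * 1 <= (K%:R + s) * b1%:R by rewrite ler_wpM2l //; lra.
by rewrite mulrDr; lra.
Qed.

Lemma cfval_itv w (r : R) : positive w -> 0 <= r <= 1 -> 0 <= cfval w r <= 1.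
Proof. by move=> pw /andP[r0 r1]; rewrite cfval_ge0 //= cfval_le1 // r0. Qed.

(** Two uses of [cfval2_le]: K = 4, s = 1 gives 5/6, then K = 3, s = 5/6 gives 23/29. With the
    bounds 3 and 4 exchanged the values are 4/5 and 24/29. *)
Lemma cfval4_le33 b1 b2 b3 b4 (r : R) : (0 < b1 <= 3)%N -> (0 < b2 <= 3)%N ->
  (0 < b3 <= 4)%N -> (0 < b4 <= 4)%N -> 0 <= r <= 1 -> cfval [:: b1; b2; b3; b4] r <= 23 / 29.
Proof.
move=> /andP[b1_gt0 _] b2_3 b3_4 b4_4 r01; rewrite -[[:: _; _; _; _]]/([:: b1; b2] ++ [:: b3;
  b4]) cfval_cat.
have p34 : positive [:: b3; b4] by case/andP: b3_4 => h _; case/andP: b4_4 => h' _; apply/and3P.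
have /andP[s0 _] := cfval_itv p34 r01.
have s1 : cfval [:: b3; b4] r <= 5 / 6.
  case/andP: b3_4 => h _; apply: (cfval2_le h b4_4 r01); lra.
apply: (cfval2_le (s := 5 / 6) b1_gt0 b2_3); first by rewrite s0.
lra.
Qed.

Lemma cfval4_le43 b1 b2 b3 b4 (r : R) : (0 < b1)%N -> (0 < b2 <= 4)%N ->
  (0 < b3 <= 3)%N -> (0 < b4 <= 3)%N -> 0 <= r <= 1 -> cfval [:: b1; b2; b3; b4] r <= 24 / 29.
Proof.
move=> b1_gt0 b2_4 b3_3 b4_3 r01; rewrite -[[:: _; _; _; _]]/([:: b1; b2] ++ [:: b3; b4]) cfval_cat.
have p34 : positive [:: b3; b4] by case/andP: b3_3 => h _; case/andP: b4_3 => h' _; apply/and3P.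
have /andP[s0 _] := cfval_itv p34 r01.
have s1 : cfval [:: b3; b4] r <= 4 / 5.
  case/andP: b3_3 => h _; apply: (cfval2_le h b4_3 r01); lra.
apply: (cfval2_le (s := 4 / 5) b1_gt0 b2_4); first by rewrite s0.
lra.
Qed.

Lemma cfval4_le4 b1 b2 b3 b4 (r : R) : b1 = 4%N -> (0 < b2)%N -> (0 < b3)%N -> (0 < b4)%N ->
  0 <= r <= 1 -> cfval [:: b1; b2; b3; b4] r <= 1 / 4.
Proof.
move=> -> h2 h3 h4 r01; rewrite mul1r; apply: inv_natD_le => //.
have : positive [:: b2; b3; b4] by apply/and4P.
by move=> p; have /andP[] := cfval_itv p r01.
Qed.

Lemma approx_constE k : exists r s : R, [/\ 0 <= r <= 1, 0 <= s <= 1 &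
  approx_const R a (k + 4) = (a (k + 4)%N)%:R + cfval [:: a (k + 5); a (k + 6); a (k + 7);
    a (k + 8)]%N r
    + cfval [:: a (k + 3); a (k + 2); a (k + 1); a k]%N s].
Proof.
exists (cfv R (shift a (k + 9))), (cfval (rev (mkseq a k)) 0); split.
- exact/cfv_itv/pos_shift.
- by apply: cfval_itv; rewrite ?lexx ?ler01 // /positive all_rev; exact: positive_mkseq.
rewrite /approx_const cfd1_cfd0; last exact: positive_mkseq.
rewrite -cfval_cat; congr (_ + _ + cfval _ _).
  rewrite (cfvE R 4); last exact: pos_shift.
  congr (cfval _ _); first by rewrite /mkseq /= /shift; congr [:: a _; a _; a _; a _]; lia.
  by congr (cfv R _); apply/funext => i; rewrite /shift; congr (a _); lia.
by rewrite !addnS addn0 !mkseq_rcons !rev_rcons.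
Qed.

(** A 4 next to the letter makes its side at most 1/4. A 4 in second place can occur on one side
    only, which gives 24/29 + 23/29; otherwise both sides are at most 23/29. *)
Lemma approx_const_le_isolated k :
  (forall i, (a i <= 4)%N) -> (forall i j, (i < j)%N -> a i = 4%N -> a j = 4%N -> (i + 5 <= j)%N) ->
  (a (k + 4) <= 3)%N -> approx_const R a (k + 4) <= 3 + 47 / 29.
Proof.
move=> a4 iso ak3; have [r [s [r01 s01 ->]]] := approx_constE k.
have A : (a (k + 4)%N)%:R <= 3 :> R by rewrite ler_nat.
have d4 i : (0 < a i <= 4)%N by rewrite pa a4.
have d3 i : a i <> 4%N -> (0 < a i <= 3)%N by move=> h; have := d4 i; lia.
have far i j : a i = 4%N -> (i < j < i + 5)%N -> (0 < a j <= 3)%N.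
  by move=> ai /andP[h1 h2]; apply: d3 => /(iso _ _ h1 ai); lia.
have far' i j : a i = 4%N -> (j < i < j + 5)%N -> (0 < a j <= 3)%N.
  by move=> ai /andP[h1 h2]; apply: d3 => aj; have := iso _ _ h1 aj ai; lia.
suff : cfval [:: a (k + 5); a (k + 6); a (k + 7); a (k + 8)]%N r +
       cfval [:: a (k + 3); a (k + 2); a (k + 1); a k]%N s <= 47 / 29 by lra.
have U i j : (i < j < i + 5)%N -> a i = 4%N -> (0 < a j <= 3)%N by move=> h /far; apply.
have U' i j : (j < i < j + 5)%N -> a i = 4%N -> (0 < a j <= 3)%N by move=> h /far'; apply.
have [e3|/eqP/d3 n3] := eqVneq (a (k + 3)%N) 4%N.
  have h1 : cfval [:: a (k + 3); a (k + 2); a (k + 1); a k]%N s <= 1 / 4 by exact: cfval4_le4.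
  have h2 : cfval [:: a (k + 5); a (k + 6); a (k + 7); a (k + 8)]%N r <= 23 / 29.
    by apply: cfval4_le33 => //; apply: U e3; lia.
  by lra.
have [e5|/eqP/d3 n5] := eqVneq (a (k + 5)%N) 4%N.
  have h1 : cfval [:: a (k + 5); a (k + 6); a (k + 7); a (k + 8)]%N r <= 1 / 4 by exact: cfval4_le4.
  have h2 : cfval [:: a (k + 3); a (k + 2); a (k + 1); a k]%N s <= 23 / 29.
    by apply: cfval4_le33 => //; apply: U' e5; lia.
  by lra.
have [e2|/eqP/d3 n2] := eqVneq (a (k + 2)%N) 4%N.
  have h1 : cfval [:: a (k + 3); a (k + 2); a (k + 1); a k]%N s <= 24 / 29.
    by apply: cfval4_le43 => //; apply: U' e2; lia.
  have h2 : cfval [:: a (k + 5); a (k + 6); a (k + 7); a (k + 8)]%N r <= 23 / 29.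
    by apply: cfval4_le33 => //; apply: U e2; lia.
  by lra.
have h1 : cfval [:: a (k + 3); a (k + 2); a (k + 1); a k]%N s <= 23 / 29 by exact: cfval4_le33.
have [e6|/eqP/d3 n6] := eqVneq (a (k + 6)%N) 4%N.
  have h2 : cfval [:: a (k + 5); a (k + 6); a (k + 7); a (k + 8)]%N r <= 24 / 29.
    by apply: cfval4_le43 => //; apply: U e6; lia.
  by lra.
have h2 : cfval [:: a (k + 5); a (k + 6); a (k + 7);
  a (k + 8)]%N r <= 23 / 29 by exact: cfval4_le33.
by lra.
Qed.

Lemma approx_const_ubounds n : approx_const R a n <= (a n)%:R + 1 + 1 /\
  forall d, (0 < d <= a n.+1)%N -> approx_const R a n <= (a n)%:R + d%:R^-1 + 1.
Proof.
have pn := positive_mkseq n pa.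
have h : (cfd1 (mkseq a n))%:R / (cfd0 (mkseq a n))%:R <= 1 :> R.
  by rewrite ler_pdivrMr ?ltr0n ?cfd0_gt0 // mul1r ler_nat cfd1_le_cfd0.
have /andP[v0 v1] := cfv_itv R (pos_shift n.+1 pa).
split; first by rewrite lerD // lerD2l.
move=> d hd; rewrite lerD // lerD2l cfv_rec; last exact: pos_shift.
rewrite {1}/shift addn0; apply: inv_natD_le => //.
by have /andP[] := cfv_itv R (pos_shift 1 (pos_shift n.+1 pa)).
Qed.
End NonCentral.

Section Blocks.
Variables (N : nat) (X Y mm : nat -> nat).
Hypotheses (N4 : (4 <= N)%N) (pX : pos_digits X) (pY : pos_digits Y).
Hypotheses (X3 : forall i, (X i <= 3)%N) (Y3 : forall i, (0 < i)%N -> (Y i <= 3)%N).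
Hypothesis Y0 : (N = 4 /\ (Y 0 <= 3) \/ 5 <= N /\ (Y 0 <= 4))%N.
Hypothesis mm5 : forall k, (5 <= mm k)%N.

Definition left_part W := W ++ rev (mkseq Y (mm (cfd0 W))).
(** At least q_n at the next letter N, so that cutting X after this many letters costs at most
    1/q_n^2. *)
Definition right_len W := maxn (cfd0 (left_part W)) 5.
Definition extend W := left_part W ++ N :: mkseq X (right_len W).
Definition word k := iter k extend [::].
Definition center k := size (left_part (word k)).

Lemma wordS k : word k.+1 = left_part (word k) ++ N :: mkseq X (right_len (word k)).
Proof. by []. Qed.

Lemma size_left_part W : size (left_part W) = (size W + mm (cfd0 W))%N.
Proof. by rewrite size_cat size_rev size_mkseq. Qed.

Lemma size_wordS k : size (word k.+1) = (center k + (right_len (word k)).+1)%N.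
Proof. by rewrite wordS size_cat /= size_mkseq. Qed.

Lemma center_ge k : (size (word k) + 5 <= center k)%N.
Proof. by rewrite /center size_left_part leq_add2l. Qed.

Lemma centerS k : (center k + 5 <= center k.+1)%N.
Proof. by have := center_ge k.+1; rewrite size_wordS; lia. Qed.

Lemma center_lt k l : (k < l)%N -> (center k + 5 <= center l)%N.
Proof.
elim: l => // l IH; rewrite ltnS leq_eqVlt => /orP[/eqP ->|/IH h]; first exact: centerS.
by have := centerS l; lia.
Qed.

Lemma size_word_ge k : (k <= size (word k))%N.
Proof. by elim: k => // k IH; have := center_ge k; rewrite size_wordS; lia. Qed.

Lemma exists_sequence : exists a : nat -> nat,
  [/\ pos_digits a, forall k, a (center k) = N,
      forall k, mkseq a (center k) = left_part (word k),
      forall k, mkseq (shift a (center k).+1) (right_len (word k)) = mkseq X (right_len (word k)) &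
      forall i, (forall k, i <> center k) -> (a i <= 3 \/ [/\ a i <= 4, a i.+1 = N & 5 <= N])%N].
Proof.
have pre k : prefix (word k) (word k.+1) by rewrite wordS /left_part -catA prefix_prefix.
have [a ha] := word_limit pre (fun M => ex_intro _ M.+1 (size_word_ge M.+1)).
have E k : [/\ mkseq a (center k) = left_part (word k), a (center k) = N &
    mkseq (shift a (center k).+1) (right_len (word k)) = mkseq X (right_len (word k))].
  have /eqP := ha k.+1; rewrite size_wordS mkseqD wordS eqseq_cat ?size_mkseq //.
  rewrite mkseqS_shift eqseq_cons => /andP[/eqP e1 /andP[/eqP e2 /eqP e3]]; split=> //.
    by rewrite e2 /shift addn0.
  rewrite e3; congr mkseq; apply/funext => i; rewrite /shift; congr (a _); lia.
have block i : exists k, (size (word k) <= i < size (word k.+1))%N.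
  have ex : exists k, (i < size (word k))%N by exists i.+1; exact: size_word_ge.
  case: (ex_minnP ex) => [[|k] hk mk]; first by move: hk.
  by exists k; rewrite hk andbT leqNgt; apply/negP => /mk; rewrite ltnn.
(* The index j = 0 is the letter just before N, the only place off the centers where a 4 may
   stand. *)
have dig i : exists k, [\/ (i < center k)%N /\ exists j, a i = Y j /\ (j = 0%N -> i.+1 = center k),
    i = center k | exists j, a i = X j].
  have [k /andP[ik ik']] := block i; exists k; have [e1 e2 e3] := E k.
  have [ic|ic|ic] := ltngtP i (center k); [apply: Or31|apply: Or33|exact: Or32].
    split=> //; have ec : center k = (size (word k) + mm (cfd0 (word k)))%N by exact:
      size_left_part.
    exists (mm (cfd0 (word k)) - (i - size (word k)).+1)%N; split; last by lia.
    rewrite -(nth_mkseq 0%N a ic) e1 /left_part nth_cat ltnNge ik /=.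
    by rewrite nth_rev size_mkseq; [rewrite nth_mkseq //; lia|lia].
  exists (i - (center k).+1)%N; rewrite size_wordS in ik'.
  have lt : (i - (center k).+1 < right_len (word k))%N by lia.
  have := congr1 (fun s => nth 0%N s (i - (center k).+1)%N) (esym e3); rewrite !nth_mkseq // => ->.
  by rewrite /shift; congr (a _); lia.
exists a; split; try by move=> k; case: (E k).
  move=> i; have [k [[_ [j [-> _]]]|->|[j ->]]] := dig i; rewrite ?pX ?pY //.
  by case: (E k) => _ -> _; lia.
move=> i nc; have [k [[_ [j [e h]]]|/nc //|[j ->]]] := dig i; last by left.
rewrite e; case: j h {e} => [|j] h; last by left; apply: Y3.
case: Y0 => -[h1 h2]; first by left.
by right; split=> //; rewrite h //; case: (E k).
Qed.
End Blocks.

Section Estimates.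
Variables (R : realType) (varpi : nat -> R) (N : nat) (X Y mm : nat -> nat).
Hypotheses (varpi_nd : forall i j, (i <= j)%N -> varpi i <= varpi j).
Hypotheses (pX : pos_digits X) (pY : pos_digits Y) (N4 : (4 <= N)%N).
Hypothesis mm_large : forall C, 4 * (C%:R ^+ 2) + 1 <= varpi (mm C).

Lemma positive_word k : positive (word N X Y mm k).
Proof.
elim: k => // k; rewrite wordS /positive !all_cat /= all_rev => ->.
rewrite [all _ (mkseq Y _)](positive_mkseq _ pY) [all _ (mkseq X _)](positive_mkseq _ pX).
by rewrite (leq_trans _ N4).
Qed.

Lemma cfd0_cat_le u w : positive u -> positive w -> (cfd0 (u ++ w) <= 2 * cfd0 u * cfd0 w)%N.
Proof.
move=> pu pw; rewrite -(ler_nat R) !natrM.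
have w01 : 0 <= cfval w (0 : R) <= 1 by apply: cfval_itv; rewrite ?lexx ?ler01.
have D v : (cfd0 v)%:R = den v 0 :> R by rewrite /den mulr0 addr0.
rewrite D den_cat // -D; apply: ler_wpM2r => //.
have c1 : (cfd1 u)%:R <= (cfd0 u)%:R :> R by rewrite ler_nat cfd1_le_cfd0.
have : (cfd1 u)%:R * cfval w 0 <= (cfd1 u)%:R :> R by case/andP: w01 => _ h; rewrite ler_piMr.
by rewrite /den; lra.
Qed.

(** The right tail is off by at most 1/q_n^2. The left one agrees with Y for M letters, so it is off
    by at most the inverse square of the denominator of [mkseq Y M], and q_n is at most [2 * cfd0 W]
    times that denominator. The total [4 * cfd0 W ^ 2 + 1] is dominated by [varpi M], and M <= n <=
    q_n. *)
Lemma center_estimate a k :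
  pos_digits a -> a (center N X Y mm k) = N ->
  mkseq a (center N X Y mm k) = left_part Y mm (word N X Y mm k) ->
  mkseq (shift a (center N X Y mm k).+1) (right_len Y mm (word N X Y mm k)) =
    mkseq X (right_len Y mm (word N X Y mm k)) ->
  `|approx_const R a (center N X Y mm k) - (N%:R + cfv R X + cfv R Y)| *
    (cfq a (center N X Y mm k))%:R ^+ 2 <= varpi (cfq a (center N X Y mm k)).
Proof.
move=> pa aN eL eR; set n := center N X Y mm k; set W := word N X Y mm k.
set M := mm (cfd0 W); have pW : positive W := positive_word k.
have q0 : 0 < (cfq a n)%:R :> R := q_gt0 R pa n.
have nM : (M <= n)%N by rewrite /n /center size_left_part leq_addl.
apply: (@le_trans _ _ (varpi M)); last by apply: varpi_nd; apply: leq_trans nM (cfq_ge pa n).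
apply: le_trans (mm_large (cfd0 W)).
have eq : cfq a n = cfd0 (left_part Y mm W) by rewrite /cfq eL.
set L := right_len Y mm W in eR.
have h1 : `|cfv R (shift a n.+1) - cfv R X| * (cfq a n)%:R ^+ 2 <= 1.
  have d0 : 0 < (cfd0 (mkseq X L))%:R :> R by rewrite ltr0n cfd0_gt0 // positive_mkseq.
  rewrite -ler_pdivlMr ?exprn_gt0 // mul1r.
  rewrite (cfvE R L (pos_shift n.+1 pa)) (cfvE R L pX) eR.
  have t1 := cfv_itv R (pos_shift L (pos_shift n.+1 pa)); have t2 := cfv_itv R (pos_shift L pX).
  apply: (le_trans (dist_cfval_le (positive_mkseq L pX) t1 t2)).
  rewrite lef_pV2 ?posrE ?exprn_gt0 // lerXn2r ?nnegrE //.
  rewrite ler_nat; have := cfd0_ge_size (positive_mkseq L pX); rewrite size_mkseq.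
  by apply: leq_trans; rewrite eq leq_maxl.
have h2 : `|cfval (rev (left_part Y mm W)) 0 - cfv R Y| * (cfq a n)%:R ^+ 2 <= 4 * (cfd0 W)%:R ^+ 2.
  have pM := positive_mkseq M pY.
  have d0 : 0 < (cfd0 (mkseq Y M))%:R :> R by rewrite ltr0n cfd0_gt0.
  have le : (cfq a n)%:R <= 2 * (cfd0 W)%:R * (cfd0 (mkseq Y M))%:R :> R.
    rewrite -!natrM ler_nat eq; have := cfd0_cat_le pW (w := rev (mkseq Y M)).
    by have [-> _ _ _] := cf_rev (mkseq Y M); apply; rewrite /positive all_rev.
  have le2 : (cfq a n)%:R ^+ 2 <= 4 * (cfd0 W)%:R ^+ 2 * (cfd0 (mkseq Y M))%:R ^+ 2 :> R.
    have -> : 4 * (cfd0 W)%:R ^+ 2 * (cfd0 (mkseq Y M))%:R ^+ 2 =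
      (2 * (cfd0 W)%:R * (cfd0 (mkseq Y M))%:R) ^+ 2 :> R by ring.
    by rewrite lerXn2r ?nnegrE // (le_trans _ le) // ltW.
  rewrite rev_cat revK cfval_cat (cfvE R M pY).
  have rW : 0 <= cfval (rev W) (0 : R) <= 1.
    by apply: cfval_itv; rewrite ?lexx ?ler01 // /positive all_rev.
  have dist := dist_cfval_le pM rW (cfv_itv R (pos_shift M pY)).
  apply: le_trans (ler_pM (normr_ge0 _) _ dist le2) _; first by rewrite exprn_ge0.
  by rewrite mulrC mulfK // gt_eqF // exprn_gt0.
have -> : approx_const R a n - (N%:R + cfv R X + cfv R Y) =
    (cfv R (shift a n.+1) - cfv R X) + (cfval (rev (left_part Y mm W)) 0 - cfv R Y).
  rewrite /approx_const aN /cfq eL cfd1_cfd0; first by ring.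
  by rewrite -eL positive_mkseq.
apply: (@le_trans _ _ ((`|cfv R (shift a n.+1) - cfv R X| +
   `|cfval (rev (left_part Y mm W)) 0 - cfv R Y|) * (cfq a n)%:R ^+ 2)).
  by rewrite ler_wpM2r ?exprn_ge0 // ler_normD.
by rewrite mulrDl; lra.
Qed.
End Estimates.

Lemma cfq_lt a i j : pos_digits a -> (0 < i < j)%N -> (cfq a i < cfq a j)%N.
Proof.
move=> pa /andP[i0]; elim: j => // j IH; rewrite ltnS leq_eqVlt => h.
have step n : (0 < n)%N -> (cfq a n < cfq a n.+1)%N.
  case: n => // n _; rewrite {2}/cfq mkseq_rcons cfd0_rcons cfd1_mkseq -/(cfq a n.+1).
  have := cfq_gt0 pa n; have := pa n.+1; have := cfq_gt0 pa n.+1; nia.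
case/orP: h => [/eqP <-|h]; first exact: step.
by apply: (ltn_trans (IH h)); apply: step; lia.
Qed.

Lemma approx_const_gt1 (R : realType) a n : pos_digits a -> 1 < approx_const R a n.
Proof.
move=> pa; have /andP[h _] := cfv_itv R (pos_shift 1 (pos_shift n.+1 pa)).
have a1 : 1 <= (a n)%:R :> R by rewrite ler1n; exact: pa.
have : 0 <= (cfd1 (mkseq a n))%:R / (cfq a n)%:R :> R by rewrite divr_ge0.
have : 0 < cfv R (shift a n.+1).
  by rewrite cfv_rec ?invr_gt0 ?ltr_wpDr // ?ltr0n; exact: pos_shift.
by rewrite /approx_const; lra.
Qed.

Section Approximation.
Variables (R : realType) (varpi : nat -> R) (gamma : R) (a c : nat -> nat).
Hypotheses (varpi_gt0 : forall n, 0 < varpi n) (gamma_ge2 : 2 <= gamma) (pa : pos_digits a).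
Local Notation V := (approx_const R a).
Local Notation q := (cfq a).
Local Notation p := (cfp a).

Lemma infinite_good :
  (forall k, (0 < c k < c k.+1)%N) ->
  (forall k, `|V (c k) - gamma| * (q (c k))%:R ^+ 2 <= varpi (q (c k))) ->
  infinite_set [set pq : int * nat |
      [/\ (0 < pq.2)%N, coprime `|pq.1|%N pq.2 &
          `|cfv R a - pq.1%:~R / pq.2%:R| <
            1 / (gamma * pq.2%:R ^+ 2) * (1 + varpi pq.2 / pq.2%:R ^+ 2)]].
Proof.
move=> cS hc; set A := [set pq | _].
pose f k : int * nat := ((p (c k))%:Z, q (c k)).
have fA k : A (f k).
  split=> /=; [exact: cfq_gt0|exact: coprime_convergent|].
  have q0 := q_gt0 R pa (c k); have V1 := approx_const_gt1 R (c k) pa.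
  rewrite -[(p _)%:Z%:~R]/((p (c k))%:R) convergent_dist //.
  have := hc k; have := varpi_gt0 (q (c k)); move: (varpi _) => w w0.
  move: (q (c k))%:R (V (c k)) q0 V1 => Q v Q0 v1 h.
  have Q2 : 0 < Q ^+ 2 by rewrite exprn_gt0.
  have g0 : 0 < gamma by move: gamma_ge2; lra.
  have v0 : 0 < v by lra.
  have pos : 0 < gamma * Q ^+ 2 * v by rewrite !mulr_gt0.
  rewrite -(ltr_pM2r pos).
  rewrite [ltLHS](_ : _ = gamma); last by field; rewrite !gt_eqF.
  rewrite [ltRHS](_ : _ = v + v * (w / Q ^+ 2)); last by field; rewrite !gt_eqF.
  have {}h : gamma - v <= w / Q ^+ 2.
    rewrite ler_pdivlMr //; apply: le_trans h; apply: ler_wpM2r; first exact: ltW.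
    by rewrite distrC ler_norm.
  have wQ : 0 < w / Q ^+ 2 by rewrite divr_gt0.
  (* Strictness comes from V_n > 1: gamma <= V_n + w/Q^2 < V_n (1 + w/Q^2). *)
  have vw : w / Q ^+ 2 < v * (w / Q ^+ 2) by rewrite ltr_pMl.
  lra.
have inj : injective (fun k => q (c k)).
  have lt k l : (k < l)%N -> (q (c k) < q (c l))%N.
    move=> kl; apply: cfq_lt => //; have /andP[-> _] := cS k.
    elim: l kl => // l IH; rewrite ltnS leq_eqVlt => /orP[/eqP ->|/IH h].
      by case/andP: (cS l).
    by apply: (ltn_trans h); case/andP: (cS l).
  by move=> k l e; have [/lt|/lt|//] := ltngtP k l; rewrite e ltnn.
move=> fin; apply: infinite_nat; apply: (@sub_finite_set _ _ (f @^-1` A)) => [k _|];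
  first exact: fA.
by apply: finite_preimage fin => k l _ _ [_ /inj].
Qed.

(** Legendre applies since gamma >= 2, but P/Q = p_n/q_n may be unreduced, Q = d q_n. For d >= 2 the
    inequality would force V_n > 4 gamma; for d = 1 it fails from n0 on. Only the first n0
    convergents remain. *)
Lemma finite_better n0 :
  (forall n, V n <= 4 * gamma) ->
  (forall n, (n0 <= n)%N -> V n * (1 - varpi (q n) / (q n)%:R ^+ 2) <= gamma) ->
  finite_set [set r : rat | exists (P : int) (Q : nat),
      [/\ (0 < Q)%N, r = P%:~R / Q%:R &
          `|cfv R a - P%:~R / Q%:R| < 1 / (gamma * Q%:R ^+ 2) * (1 - varpi Q / Q%:R ^+ 2)]].
Proof.
move=> V4 Vb; have g0 : 0 < gamma by move: gamma_ge2; lra.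
apply: (@sub_finite_set _ _ ((fun n => (p n)%:R / (q n)%:R) @` `I_n0));
  last exact/finite_image/finite_II.
move=> _ [P [Q [Q0 -> h]]] /=.
have Q0' : 0 < Q%:R :> R by rewrite ltr0n.
have w0 : 0 < varpi Q / Q%:R ^+ 2 by rewrite divr_gt0 // exprn_gt0.
have h' : `|cfv R a - P%:~R / Q%:R| < (gamma * Q%:R ^+ 2)^-1.
  apply: (lt_le_trans h); rewrite mul1r ler_piMr ?invr_ge0 ?mulr_ge0 ?exprn_ge0 ?ler0n //;
    first exact: ltW.
  by rewrite gerBl ltW.
have [n PQ] : exists n, P * (q n)%:Z = (p n)%:Z * Q%:Z.
  apply: (legendre pa Q0); apply: (lt_le_trans h').
  by rewrite lef_pV2 ?posrE ?mulr_gt0 ?exprn_gt0 // ler_wpM2r // exprn_ge0.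
have qn0 := cfq_gt0 pa n; have q0 := q_gt0 R pa n.
have eqF (F : numFieldType) : P%:~R / Q%:R = (p n)%:R / (q n)%:R :> F.
  apply/eqP; rewrite eqr_div ?pnatr_eq0 -?lt0n //; apply/eqP.
  by have := congr1 (fun z : int => z%:~R : F) PQ; rewrite !intrM.
exists n; last by rewrite -(eqF rat).
rewrite /= ltnNge; apply/negP => n0n.
have /dvdnP[d Qd] : (q n %| Q)%N.
  have : (q n %| p n * Q)%N.
    by apply/dvdnP; exists `|P|%N; have := congr1 absz PQ; rewrite !abszM /= => ->.
  by rewrite Gauss_dvdr // coprime_sym coprime_convergent.
have d0 : (0 < d)%N by move: Q0; rewrite Qd muln_gt0 => /andP[].
have V0 := lt_le_trans ltr01 (approx_const_ge1 R pa n).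
move: h; rewrite eqF convergent_dist // => h.
have h2 : gamma * d%:R ^+ 2 < V n * (1 - varpi Q / Q%:R ^+ 2).
  move: h; move: (varpi Q / _) => w; rewrite Qd natrM => h.
  have dR : 0 < d%:R :> R by rewrite ltr0n.
  have pos : 0 < gamma * d%:R ^+ 2 * (q n)%:R ^+ 2 * V n by rewrite !mulr_gt0 // exprn_gt0.
  have := h; rewrite -(ltr_pM2r pos).
  have -> : ((q n)%:R ^+ 2 * V n)^-1 * (gamma * d%:R ^+ 2 * (q n)%:R ^+ 2 * V n) = gamma * d%:R ^+
    2.
    by field; rewrite !gt_eqF.
  have -> // : 1 / (gamma * (d%:R * (q n)%:R) ^+ 2) * (1 - w) * (gamma * d%:R ^+ 2 * (q n)%:R ^+ 2
    * V n) =
     V n * (1 - w).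
  by field; rewrite !gt_eqF.
have [d1|d2] := leqP d 1.
  have d1' : d = 1%N by apply/eqP; rewrite eqn_leq d1.
  move: h2; rewrite d1' expr1n mulr1 Qd d1' mul1n ltNge => /negP; apply; exact: Vb.
have h3 : V n * (1 - varpi Q / Q%:R ^+ 2) < V n by rewrite gtr_pMr // gtrBl.
have d4 : 4 <= d%:R ^+ 2 :> R by rewrite -natrX ler_nat -[4%N]/(2 ^ 2)%N leq_exp2r.
have : 4 * gamma <= gamma * d%:R ^+ 2 by rewrite mulrC ler_pM2l.
have := V4 n; lra.
Qed.
End Approximation.

Lemma varpi_growth (R : realType) (varpi : nat -> R) (C : R) :
  (forall i j, (i <= j)%N -> varpi i <= varpi j) -> varpi n @[n --> \oo] --> +oo ->
  exists M, (5 <= M)%N /\ C <= varpi M.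
Proof.
move=> nd /cvgryPge /(_ C) [M _ hM]; exists (maxn M 5); split; first exact: leq_maxr.
by apply: hM; exact: leq_maxl.
Qed.

Theorem theorem4 (R : realType) (varpi : nat -> R) (gamma : R)
  (varpi_gt0 : forall n : nat, 0 < varpi n)
  (varpi_nd : forall m n : nat, (m <= n)%N -> varpi m <= varpi n)
  (varpi_infty : varpi n @[n --> \oo] --> +oo)
  (gamma_ge : 4 + periodic_cfrac R 0 [::] [:: 3; 1]%N
                + periodic_cfrac R 0 [:: 2]%N [:: 1; 3]%N <= gamma) :
  exists alpha : R,
    infinite_set [set pq : int * nat |
      [/\ (0 < pq.2)%N, coprime `|pq.1|%N pq.2 &
          `|alpha - pq.1%:~R / pq.2%:R| <
            1 / (gamma * pq.2%:R ^+ 2) *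
              (1 + varpi pq.2 / pq.2%:R ^+ 2)]] /\
    finite_set [set r : rat | exists (p : int) (q : nat),
      [/\ (0 < q)%N, r = p%:~R / q%:R &
          `|alpha - p%:~R / q%:R| <
            1 / (gamma * q%:R ^+ 2) *
              (1 - varpi q / q%:R ^+ 2)]].
Proof.
have m0 := markov_min_gt0 R; have mE := markov_min_eq R.
move: gamma_ge; rewrite periodic_213 -/(markov_min R) => g0.
have g1 : 3 + 47 / 29 <= gamma.
  apply: le_trans g0; rewrite pt21 //; have := m_gt m0 mE; lra.
have [N [X [Y [[pX pY] X3 Y3 NY gE]]]] := decompose m0 mE g0.
have N4 : (4 <= N)%N by case: NY => -[]; lia.
have [mm hmm] := choice (fun C : nat => varpi_growth (4 * C%:R ^+ 2 + 1) varpi_nd varpi_infty).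
have mm5 C : (5 <= mm C)%N by case: (hmm C).
have mml C : 4 * C%:R ^+ 2 + 1 <= varpi (mm C) by case: (hmm C).
have [a [pa aN eL eR nc]] := exists_sequence N4 pX pY X3 Y3 NY mm5.
pose c := center N X Y mm.
have clt k l : (k < l)%N -> (c k + 5 <= c l)%N by exact: center_lt.
have est k : `|approx_const R a (c k) - gamma| * (cfq a (c k))%:R ^+ 2 <= varpi (cfq a (c k)).
  by rewrite gE; apply: center_estimate.
have c0 k : (0 < c k)%N.
  have : (size (word N X Y mm k) + 5 <= c k)%N by exact: center_ge.
  lia.
have g2 : 2 <= gamma by lra.
(* This pays for a letter 4 before N >= 5, where V_n <= 4 + 1/5 + 1 <= N + 1/4. *)
have x1 : 1 / 4 <= cfv R X.
  have /andP[v0 v1] := cfv_itv R (pos_shift 1 pX).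
  rewrite cfv_rec // mul1r lef_pV2 ?posrE //; last by rewrite ltr_wpDr // ltr0n.
  by have : (X 0%N)%:R <= 3 :> R; [rewrite ler_nat|lra].
have y0 : 0 <= cfv R Y by have /andP[] := cfv_itv R pY.
have aN_le i : (a i <= N)%N.
  have [[k ->]|h] := pselect (exists k, i = c k); first by rewrite aN.
  by case: (nc i (fun k e => h (ex_intro _ k e))) => [|[]]; lia.
have Vc n : (4 <= n)%N -> (forall k, n <> c k) -> approx_const R a n <= gamma.
  move=> n4 hn; have [V1 V2] := approx_const_ubounds R pa n.
  case: NY => -[N_4 Y0].
    (* For N = 4 the fours are exactly the centers, at least 5 apart; n >= 4 provides the four
       letters on the left. *)
    have E : n = (n - 4 + 4)%N by lia.
    have notc i : (forall k, i <> c k) -> (a i <= 3)%N by move=> /nc [|[]] //; rewrite N_4.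
    rewrite E; apply: le_trans g1; apply: approx_const_le_isolated => //.
    - by move=> i; rewrite -N_4.
    - move=> i j ij ai aj.
      have cen l : a l = 4%N -> exists k, l = c k.
        move=> al; apply: contrapT => h.
        by have := notc l (fun k e => h (ex_intro _ k e)); rewrite al.
      have [k ik] := cen _ ai; have [l jl] := cen _ aj; rewrite ik jl in ij *.
      have [/clt //|/clt|kl] := ltngtP k l; first by lia.
      by rewrite kl ltnn in ij.
    - by rewrite -E; exact: notc.
  have NR : 5 <= N%:R :> R by rewrite ler_nat.
  case: (nc n hn) => [a3|[a4 an _]].
    have : (a n)%:R <= 3 :> R by rewrite ler_nat.
    by rewrite gE; lra.
  have h5 : (0 < 5 <= a n.+1)%N by rewrite an.
  have : (a n)%:R <= 4 :> R by rewrite ler_nat.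
  by have := V2 5%N h5; rewrite gE; lra.
have gN : N%:R <= gamma by rewrite gE; lra.
exists (cfv R a); split.
  apply: (infinite_good varpi_gt0 g2 pa (c := c)) => // k.
  by rewrite c0 /=; have := clt k k.+1 (ltnSn k); lia.
apply: (finite_better varpi_gt0 g2 pa (n0 := 4)) => n.
  (* V_n <= N + 2 <= gamma + 2 <= 4 gamma. *)
  have [V1 _] := approx_const_ubounds R pa n.
  have : (a n)%:R <= N%:R :> R by rewrite ler_nat.
  lra.
move=> n4; have q0 := q_gt0 R pa n; have V0 := lt_trans ltr01 (approx_const_gt1 R n pa).
have w0 : 0 < varpi (cfq a n) / (cfq a n)%:R ^+ 2 by rewrite divr_gt0 // exprn_gt0.
have [[k nk]|h] := pselect (exists k, n = c k); last first.
  apply: le_trans (Vc n n4 (fun k e => h (ex_intro _ k e))).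
  by rewrite ler_piMr ?ltW // gtrBl.
have V1 := approx_const_ge1 R pa n.
have := est k; rewrite -nk -ler_pdivlMr ?exprn_gt0 //.
move: (varpi _ / _) (approx_const R a n) w0 V0 V1 => w v w0 v0 v1; rewrite ler_norml => /andP[_ h].
(* As V_n >= 1, V_n (1 - w) <= V_n - w <= gamma. *)
by have : w <= v * w; [rewrite ler_peMl // ltW|rewrite mulrBr mulr1; lra].
Qed.
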